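(* Let $\Theta=\tilde p/p$ be a rational inner function on $\mathbb{D}^2$ of degree $(m,n)$, let $E_\Theta=\{\tau\in\mathbb{T}:\exists\,\tau_1\in\mathbb{T}\text{ with }p(\tau_1,\tau)=0\}$, let $\mathcal{K}_\Theta=\mathcal{S}_1\oplus\mathcal{S}_2$ be an orthogonal decomposition into closed subspaces with $\mathcal{S}_1$ invariant under $M_{z_1}$ and $\mathcal{S}_2$ invariant under $M_{z_2}$, and let $S^1_\Theta=P_{\mathcal{S}_2}M_{z_1}|_{\mathcal{S}_2}$. For $\tau\in\mathbb{T}\setminus E_\Theta$ let $\Theta_\tau=\Theta(\cdot,\tau)$ (a finite Blaschke product) and let $S_{\Theta_\tau}=P_{\mathcal{K}_{\Theta_\tau}}M_z|_{\mathcal{K}_{\Theta_\tau}}$ be the compressed shift on the one-variable model space $\mathcal{K}_{\Theta_\tau}=H^2(\mathbb{D})\ominus\Theta_\tau H^2(\mathbb{D})$. Then \[\mathrm{Clos}\big(\mathcal{W}(S^1_\Theta)\big)=\mathrm{Clos}\Big(\mathrm{Conv}\Big(\bigcup_{\tau\in\mathbb{T}\setminus E_\Theta}\mathcal{W}(S_{\Theta_\tau})\Big)\Big).\]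
   Context: $\mathbb{D}$ is the open unit disk, $\mathbb{T}$ the unit circle. A rational inner function on $\mathbb{D}^2$ is a rational function holomorphic on $\mathbb{D}^2$ with $|\Theta|=1$ a.e. on $\mathbb{T}^2$; its degree $(m,n)$: writing $\Theta=q/p$ in lowest terms, $m$ (resp. $n$) is the highest power of $z_1$ (resp. $z_2$) in $p$ or $q$. One may write $\Theta=\tilde p/p$ with $p$ a polynomial with no zeros on $\mathbb{D}^2$, $\tilde p(z)=z_1^mz_2^n\overline{p(1/\bar z_1,1/\bar z_2)}$, $p,\tilde p$ coprime; then $E_\Theta$ is finite. $\mathcal{K}_\Theta=H^2(\mathbb{D}^2)\ominus\Theta H^2(\mathbb{D}^2)$. $\mathcal{W}(T)=\{\langle Th,h\rangle:\|h\|=1\}$; Clos and Conv denote closure and convex hull. *)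

(* Defs.v *)
(* MathComp 2.5 + real_closed's complex numbers R[i] over an
   abstract complete ordered field R : realType (from mathcomp-analysis). *)
From Stdlib Require Import ClassicalEpsilon.
From mathcomp Require Import all_boot all_algebra.
From mathcomp Require Import reals.
From mathcomp Require Import complex.

Set Implicit Arguments.
Unset Strict Implicit.
Unset Printing Implicit Defensive.

Import GRing.Theory Num.Theory.
Local Open Scope ring_scope.

Section RIF.
Variable R : realType.
Local Notation C := R[i].

(* ---------- basic notions on C ---------- *)

Definition unit_circle : C -> Prop := fun z => `|z| = 1.
Definition open_disk : C -> Prop := fun z => `|z| < 1.

(* (metric) closure of a subset of C *)
Definition Clos (A : C -> Prop) : C -> Prop :=
  fun z => forall e : R, 0 < e -> exists w, A w /\ `|z - w| < (e%:C)%C.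

(* convex hull of a subset of C : all finite convex combinations *)
Definition Conv (A : C -> Prop) : C -> Prop :=
  fun z => exists (k : nat) (t : 'I_k -> R) (a : 'I_k -> C),
    (forall i, 0 <= t i) /\ \sum_(i < k) t i = 1 /\ (forall i, A (a i)) /\
    z = \sum_(i < k) ((t i)%:C)%C * a i.

(* convergence of a sequence of complex numbers *)
Definition cvgC (u : nat -> C) (l : C) : Prop :=
  forall e : R, 0 < e -> exists N, forall k, (N <= k)%N -> `|u k - l| < (e%:C)%C.

(* ---------- Hilbert spaces l^2(I) of Taylor coefficients ----------
   I is the index set of monomials (nat for H^2(D), nat*nat for H^2(D^2));
   win N is the finite list of indices of the N-th exhausting window. *)

Definition win1 (N : nat) : seq nat := iota 0 N.
Definition win2 (N : nat) : seq (nat * nat) :=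
  [seq (i, j) | i <- iota 0 N, j <- iota 0 N].

Section L2.
Variables (I : Type) (win : nat -> seq I).

Definition in_l2 (f : I -> C) : Prop :=
  exists B : R, forall N, (\sum_(x <- win N) `|f x| ^+ 2 <= B%:C)%C.

(* <f, g> = sum_x f x * conj (g x)  (a limit over the exhausting windows) *)
Definition inner (f g : I -> C) : C :=
  epsilon (inhabits 0)
    (fun l => cvgC (fun N => \sum_(x <- win N) f x * (g x)^*) l).

Definition addf (f g : I -> C) : I -> C := fun x => f x + g x.
Definition subf (f g : I -> C) : I -> C := fun x => f x - g x.
Definition scalf (c : C) (f : I -> C) : I -> C := fun x => c * f x.

(* closed (linear) subspace of l^2(I) *)
Definition closed_subspace (S : (I -> C) -> Prop) : Prop :=
  (forall f, S f -> in_l2 f) /\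
  S (fun _ => 0) /\
  (forall f g, S f -> S g -> S (addf f g)) /\
  (forall c f, S f -> S (scalf c f)) /\
  (forall f, in_l2 f ->
     (forall e : R, 0 < e -> exists g, S g /\
        `|inner (subf f g) (subf f g)| < (e%:C)%C) -> S f).

(* orthogonal projection onto a closed subspace S: the y in S with f - y ⊥ S *)
Definition proj (S : (I -> C) -> Prop) (f : I -> C) : I -> C :=
  epsilon (inhabits (fun _ => 0))
    (fun y => S y /\ forall s, S s -> inner (subf f y) s = 0).

(* numerical range of the compression P_S T |_S *)
Definition num_range_compr (S : (I -> C) -> Prop) (T : (I -> C) -> I -> C)
  : C -> Prop :=
  fun w => exists h, S h /\ inner h h = 1 /\ w = inner (proj S (T h)) h.

End L2.

(* ---------- one variable ---------- *)

(* multiplication by z on H^2(D) *)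
Definition Mz (f : nat -> C) : nat -> C :=
  fun k => if k is k'.+1 then f k' else 0.

(* Taylor coefficients of q * f for a polynomial q and f in H^2(D) *)
Definition conv1 (q : {poly C}) (f : nat -> C) : nat -> C :=
  fun k => \sum_(i < size q) q`_i * (if (i <= k)%N then f (k - i)%N else 0).

(* b H^2(D) for the rational function b = qt / q  (q(0) <> 0):
   g = b f  iff  q g = qt f *)
Definition mult_range1 (qt q : {poly C}) : (nat -> C) -> Prop :=
  fun g => in_l2 win1 g /\ exists f, in_l2 win1 f /\ conv1 q g = conv1 qt f.

(* model space K_b = H^2(D) ⊖ b H^2(D) *)
Definition model1 (qt q : {poly C}) : (nat -> C) -> Prop :=
  fun f => in_l2 win1 f /\
    forall g, mult_range1 qt q g -> inner win1 f g = 0.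

(* ---------- two variables ----------
   A polynomial p(z1,z2) is p : {poly {poly C}}, p = sum_j p`_j(z1) z2^j. *)

Definition eval2 (p : {poly {poly C}}) (z1 z2 : C) : C :=
  \sum_(j < size p) (p`_j).[z1] * z2 ^+ j.

(* one-variable slice z |-> p(z, tau) *)
Definition slice (p : {poly {poly C}}) (tau : C) : {poly C} :=
  \sum_(j < size p) (tau ^+ j) *: p`_j.

(* p has degree at most m in z1 and n in z2 *)
Definition deg_le (m n : nat) (p : {poly {poly C}}) : Prop :=
  leq (size p) n.+1 /\ forall j : nat, leq (size p`_j) m.+1.

(* reflection  pt(z) = z1^m z2^n conj(p(1/conj z1, 1/conj z2)) *)
Definition refl (m n : nat) (p : {poly {poly C}}) : {poly {poly C}} :=
  \poly_(j < n.+1) \poly_(i < m.+1) ((p`_(n - j)%N)`_(m - i)%N)^*.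

Definition dvd2 (q p : {poly {poly C}}) : Prop := exists r, p = q * r.

(* p and q have no common non-constant factor in C[z1,z2] *)
Definition coprime2 (p q : {poly {poly C}}) : Prop :=
  forall d, dvd2 d p -> dvd2 d q -> exists c : C, d = (c%:P)%:P.

Definition no_zeros_bidisk (p : {poly {poly C}}) : Prop :=
  forall z1 z2, open_disk z1 -> open_disk z2 -> eval2 p z1 z2 != 0.

(* E_Theta *)
Definition E_set (p : {poly {poly C}}) : C -> Prop :=
  fun tau => unit_circle tau /\
    exists tau1, unit_circle tau1 /\ eval2 p tau1 tau = 0.

(* multiplication by z1 on H^2(D^2) *)
Definition Mz1 (f : nat * nat -> C) : nat * nat -> C :=
  fun kl => if kl.1 is k'.+1 then f (k', kl.2) else 0.

Definition Mz2 (f : nat * nat -> C) : nat * nat -> C :=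
  fun kl => if kl.2 is l'.+1 then f (kl.1, l') else 0.

(* Taylor coefficients of p * f for a polynomial p(z1,z2) *)
Definition conv2 (p : {poly {poly C}}) (f : nat * nat -> C) : nat * nat -> C :=
  fun kl => \sum_(j < size p) \sum_(i < size p`_j)
     (p`_j)`_i * (if (i <= kl.1)%N && (j <= kl.2)%N
                  then f ((kl.1 - i)%N, (kl.2 - j)%N) else 0).

(* Theta H^2(D^2) for Theta = pt / p  (p(0,0) <> 0): g = Theta f iff p g = pt f *)
Definition mult_range2 (pt p : {poly {poly C}}) : (nat * nat -> C) -> Prop :=
  fun g => in_l2 win2 g /\ exists f, in_l2 win2 f /\ conv2 p g = conv2 pt f.

(* K_Theta = H^2(D^2) ⊖ Theta H^2(D^2) *)
Definition model2 (pt p : {poly {poly C}}) : (nat * nat -> C) -> Prop :=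
  fun f => in_l2 win2 f /\
    forall g, mult_range2 pt p g -> inner win2 f g = 0.

(* K = S1 ⊕ S2 (orthogonal decomposition into closed subspaces) *)
Definition orth_decomp (K S1 S2 : (nat * nat -> C) -> Prop) : Prop :=
  closed_subspace win2 S1 /\ closed_subspace win2 S2 /\
  (forall f, S1 f -> K f) /\ (forall f, S2 f -> K f) /\
  (forall f g, S1 f -> S2 g -> inner win2 f g = 0) /\
  (forall f, K f -> exists f1 f2, S1 f1 /\ S2 f2 /\ f = addf f1 f2).

End RIF.

(* Main.v *)
Require Import Defs.
From Stdlib Require Import ClassicalEpsilon.
From mathcomp Require Import all_boot all_order all_algebra.
From mathcomp Require Import boolp functions reals complex.
From mathcomp Require Import polyXY cyclic separable cyclotomic.
From mathcomp Require Import ring lra zify.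
Set Implicit Arguments.
Unset Strict Implicit.
Unset Printing Implicit Defensive.
Import Order.TTheory GRing.Theory Num.Theory.
Local Open Scope ring_scope.
Local Notation Re := complex.Re.
Local Notation Im := complex.Im.

(** Write [p~] for the reflection of [p] and [p_tau], [p~_tau] for the slices at [z2 = tau].
    Taylor coefficients replace boundary values throughout.

    A function [h] of [S2] satisfies [deg_z1 (p h) < m], since all its shifts [z2^k h] are
    orthogonal to [p~ z1^a z2^b]; likewise the one-variable model space at [tau] consists of the
    [v] with [deg (p_tau v) < m].  The resultant of [p] and [p~] in [z1] is a polynomial [r(z2)]
    of the form [A p + B p~], without zeros on the circle outside [E_Theta].  As [p~ / p] is a
    contraction, division by [p] becomes a bounded operation once it is multiplied by [r].

    For the inclusion from left to right, a truncation of [r h] is sliced at the roots of unity;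
    each slice is close to the model space at [tau], and by Parseval the average of the slices of
    the quadratic form is the quadratic form of [r h].  The factors of [r] are then removed by
    approximating [y] by multiples of [(1 - b z2) y].

    Conversely, a function [f] of the model space at [tau] is spread to [phi(z2) f(z1)], with [phi]
    concentrated at [tau], and corrected by a small term so that [deg_z1 (p h) < m]; a multiple
    [z2^J r~(z2) h] lies in [S2], because [r g = A p g + B p~ g] makes it orthogonal both to
    [Theta H^2] and to [S1].  Convex combinations come from [h1 + z2^k h2] with [k] large. *)

(** * Moduli and limits of complex numbers *)


Section ComplexModulus.
Variable R : realType.
Local Notation C := R[i].
Implicit Types (x y z l : C) (e : R).

(** The obstacle is that [p] may vanish on the torus. A quotient by [p] is then only a formal power
    series, and nothing is known in advance about its summability. Contractivity of [p~ / p] is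
    therefore proved on finite windows of Taylor coefficients, where it makes sense for every formal
    series. Zeros of [r] on the circle are harmless: a slice taken there contributes the zero
    vector.

    Both inclusions work with pairs (squared norm of [h], [<z1 h, h>]) for vectors [h] that are not
    normalised. Such pairs add up exactly under averaging over slices, and up to small cross terms
    under [h1 + z2^k h2]. Convexity thus becomes additivity in a cone, and the division by the
    squared norm is postponed to the very end, where it is continuous because the squared norm is
    close to 1. Since only these pairs matter, [h] may be replaced by [z2^k h], by a nearby vector,
    or by a vector in which a factor [z2 - al] has been traded for [1 - conj(al) z2]. *)

Definition cabs z : R := Normc.normc z.
Definition nsq z : R := cabs z ^+ 2.

Lemma norm_cabs z : `|z| = ((cabs z)%:C)%C. Proof. by []. Qed.

Lemma realc_inj : injective (fun x : R => (x%:C)%C).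
Proof. by move=> x y []. Qed.

Lemma cabs_ge0 z : 0 <= cabs z.
Proof. by rewrite -lecR -norm_cabs normr_ge0. Qed.

Lemma cabs0 : cabs 0 = 0.
Proof. by apply: realc_inj; rewrite -norm_cabs normr0. Qed.

Lemma cabs1 : cabs 1 = 1.
Proof. by apply: realc_inj; rewrite -norm_cabs normr1. Qed.

Lemma cabsM x y : cabs (x * y) = cabs x * cabs y.
Proof. exact: Normc.normcM. Qed.

Lemma cabsX x k : cabs (x ^+ k) = cabs x ^+ k.
Proof. by elim: k => [|k IH]; rewrite ?cabs1 // !exprS cabsM IH. Qed.

Lemma cabsD x y : cabs (x + y) <= cabs x + cabs y.
Proof.
by rewrite -lecR rmorphD /= -!norm_cabs ler_normD.
Qed.

Lemma cabsN x : cabs (- x) = cabs x.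
Proof. by apply: realc_inj; rewrite -!norm_cabs normrN. Qed.

Lemma cabsB x y : cabs (x - y) <= cabs x + cabs y.
Proof. by rewrite -(cabsN y) cabsD. Qed.

Lemma cabs_distC x y : cabs (x - y) = cabs (y - x).
Proof. by rewrite -cabsN opprB. Qed.

Lemma cabs_conj x : cabs x^* = cabs x.
Proof. by apply: realc_inj; rewrite -!norm_cabs norm_conjC. Qed.

Lemma cabs_real (a : R) : cabs (a%:C)%C = `|a|.
Proof. by rewrite /cabs /= expr0n /= addr0 sqrtr_sqr. Qed.

Lemma cabs_nat n : cabs n%:R = n%:R.
Proof. by rewrite -(rmorph_nat (real_complex R)) cabs_real ger0_norm. Qed.

Lemma cabsV x : cabs x^-1 = (cabs x)^-1.
Proof. exact: Normc.normcV. Qed.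

Lemma cabs_eq0 x : (cabs x == 0) = (x == 0).
Proof.
apply/eqP/eqP => [/(congr1 (fun a : R => (a%:C)%C))|->]; last exact: cabs0.
by rewrite -norm_cabs => /eqP; rewrite normr_eq0 => /eqP.
Qed.

Lemma cabs_sum (J : Type) (s : seq J) (P : pred J) (F : J -> C) :
  cabs (\sum_(j <- s | P j) F j) <= \sum_(j <- s | P j) cabs (F j).
Proof.
elim/big_ind2: _ => [||//]; first by rewrite cabs0.
by move=> a b c d H1 H2; apply: le_trans (cabsD _ _) (lerD _ _).
Qed.

Lemma nsq_ge0 z : 0 <= nsq z. Proof. by rewrite sqr_ge0. Qed.
Lemma nsq0 : nsq 0 = 0. Proof. by rewrite /nsq cabs0 expr0n. Qed.
Lemma nsqM x y : nsq (x * y) = nsq x * nsq y.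
Proof. by rewrite /nsq cabsM exprMn. Qed.
Lemma nsqN x : nsq (- x) = nsq x. Proof. by rewrite /nsq cabsN. Qed.
Lemma nsq_conj x : nsq x^* = nsq x. Proof. by rewrite /nsq cabs_conj. Qed.
Lemma nsq_eq0 x : (nsq x == 0) = (x == 0).
Proof. by rewrite /nsq expf_eq0 /= cabs_eq0. Qed.

Lemma mulr_conj z : z * z^* = ((nsq z)%:C)%C.
Proof. by rewrite -normCK norm_cabs rmorphXn. Qed.

Lemma nsqD_le x y : nsq (x + y) <= nsq x *+ 2 + nsq y *+ 2.
Proof.
rewrite /nsq; have := cabsD x y; have := cabs_ge0 (x + y).
have := cabs_ge0 x; have := cabs_ge0 y; set a := cabs x; set b := cabs y.
move=> a0 b0 c0 H; have : cabs (x + y) ^+ 2 <= (a + b) ^+ 2 by rewrite ler_sqr ?nnegrE ?addr_ge0.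
have := sqr_ge0 (a - b); nra.
Qed.

Lemma Re_le_cabs z : Re z <= cabs z.
Proof.
case: z => a b; rewrite /cabs /=; apply: le_trans (ler_norm a) _.
by rewrite -sqrtr_sqr ler_wsqrtr // lerDl sqr_ge0.
Qed.

Lemma normRe_le_cabs z : `|Re z| <= cabs z.
Proof.
rewrite ler_norml Re_le_cabs andbT lerNl.
by rewrite (_ : - Re z = Re (- z)) ?(le_trans (Re_le_cabs _)) ?cabsN //; case: z.
Qed.

Lemma normIm_le_cabs z : `|Im z| <= cabs z.
Proof.
case: z => a b; rewrite /cabs /= -sqrtr_sqr ler_wsqrtr // lerDr sqr_ge0 //.
Qed.

Lemma cabs_le_ReIm z : cabs z <= `|Re z| + `|Im z|.
Proof.
case: z => a b.
have -> : Complex a b = (a%:C)%C + ('i%C * (b%:C)%C).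
  by apply/eqP; rewrite eq_complex /=; apply/andP; split; apply/eqP; ring.
apply: le_trans (cabsD _ _) _; rewrite cabsM !cabs_real {1}/cabs /= expr0n add0r.
by rewrite expr1n sqrtr1 !mul0r !mul1r subrr addr0 !add0r.
Qed.

Lemma ReD x y : Re (x + y) = Re x + Re y. Proof. by case: x; case: y. Qed.
Lemma ReB x y : Re (x - y) = Re x - Re y. Proof. by case: x; case: y. Qed.
Lemma cRe_conj x : Re x^* = Re x. Proof. by case: x. Qed.
Lemma cvgCE (u : nat -> C) l : cvgC u l <->
  forall e, 0 < e -> exists N, forall k, (N <= k)%N -> cabs (u k - l) < e.
Proof.
split=> H e /H [N HN]; exists N => k /HN; first by rewrite norm_cabs ltcR.
by rewrite norm_cabs ltcR.
Qed.

Lemma eps_eq0 (a : R) : 0 <= a -> (forall e, 0 < e -> a < e) -> a = 0.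
Proof.
move=> a0 H; apply/eqP; rewrite eq_le a0 andbT leNgt; apply/negP => /H.
by rewrite ltxx.
Qed.

Lemma eps_le (a b : R) : (forall e, 0 < e -> a <= b + e) -> a <= b.
Proof.
move=> H; rewrite leNgt; apply/negP => ba.
have h : 0 < (a - b) / 2 by rewrite divr_gt0 ?subr_gt0.
by have := H _ h; lra.
Qed.

Lemma cvgC_cst l : cvgC (fun=> l) l.
Proof. by apply/cvgCE => e e0; exists 0%N => k _; rewrite subrr cabs0. Qed.

Lemma cvgC_unique u l l' : cvgC u l -> cvgC u l' -> l = l'.
Proof.
move=> /cvgCE H /cvgCE H'; apply/eqP; rewrite -subr_eq0 -cabs_eq0; apply/eqP.
apply: eps_eq0 (cabs_ge0 _) _ => e e0.
have h : 0 < e / 2 by rewrite divr_gt0.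
have [N HN] := H _ h; have [N' HN'] := H' _ h.
have := HN _ (leq_maxl N N'); have := HN' _ (leq_maxr N N').
set k := maxn _ _; rewrite [cabs (_ - l)]cabs_distC => a1 a2.
rewrite (_ : l - l' = (l - u k) + (u k - l')); last by ring.
by apply: le_lt_trans (cabsD _ _) _; lra.
Qed.

Lemma cvgCD u v l l' : cvgC u l -> cvgC v l' -> cvgC (fun k => u k + v k) (l + l').
Proof.
move=> /cvgCE H /cvgCE H'; apply/cvgCE => e e0.
have h : 0 < e / 2 by rewrite divr_gt0.
have [N HN] := H _ h; have [N' HN'] := H' _ h.
exists (maxn N N') => k; rewrite geq_max => /andP[/HN a1 /HN' a2].
rewrite (_ : _ - _ = (u k - l) + (v k - l')); last by ring.
by apply: le_lt_trans (cabsD _ _) _; lra.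
Qed.

Lemma cvgCMl c u l : cvgC u l -> cvgC (fun k => c * u k) (c * l).
Proof.
move=> /cvgCE H; apply/cvgCE => e e0.
have h : 0 < e / (cabs c + 1) by rewrite divr_gt0 // ltr_wpDl ?cabs_ge0.
have [N HN] := H _ h; exists N => k /HN; rewrite -mulrBr cabsM ltr_pdivlMr ?ltr_wpDl ?cabs_ge0 //.
by apply: le_lt_trans; rewrite mulrC ler_wpM2l ?cabs_ge0 // lerDl.
Qed.

Lemma cvgC_conj u l : cvgC u l -> cvgC (fun k => (u k)^*) l^*.
Proof.
move=> /cvgCE H; apply/cvgCE => e /H [N HN]; exists N => k /HN.
by rewrite -rmorphB cabs_conj.
Qed.

Lemma cvgC_bounded u l : cvgC u l -> exists B, forall k, cabs (u k) <= B.
Proof.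
move=> /cvgCE /(_ 1 ltr01)[N HN].
exists (cabs l + 1 + \sum_(i < N) cabs (u i)) => k.
case: (ltnP k N) => kN.
  rewrite (bigD1 (Ordinal kN)) //= addrCA lerDl !addr_ge0 ?cabs_ge0 //.
  by apply: sumr_ge0 => *; apply: cabs_ge0.
rewrite ler_wpDr //; first by apply: sumr_ge0 => *; apply: cabs_ge0.
rewrite -{1}(subrK l (u k)) addrC; apply: le_trans (cabsD _ _) _.
by rewrite lerD2l ltW // HN.
Qed.

Lemma cvgCM u v l l' : cvgC u l -> cvgC v l' -> cvgC (fun k => u k * v k) (l * l').
Proof.
move=> Hu Hv; have [B HB] := cvgC_bounded Hu.
have B1 : 0 < `|B| + 1 by rewrite ltr_wpDl.
have h1 := cvgCMl l' Hu.
have h2 : cvgC (fun k => u k * (v k - l')) 0.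
  apply/cvgCE => e e0; have h : 0 < e / (`|B| + 1) by rewrite divr_gt0.
  have [N HN] := (cvgCE _ _).1 Hv _ h; exists N => k /HN; rewrite subr0 cabsM ltr_pdivlMr //.
  apply: le_lt_trans; rewrite mulrC ler_wpM2l ?cabs_ge0 //.
  by apply: le_trans (HB k) _; rewrite ler_wpDr // ler_norm.
have := cvgCD h1 h2; rewrite addr0 [l' * l]mulrC.
by congr cvgC; apply/funext => k; ring.
Qed.

Lemma cvgC_sum (J : Type) (s : seq J) (F : J -> nat -> C) (L : J -> C) :
  (forall j, cvgC (F j) (L j)) ->
  cvgC (fun k => \sum_(j <- s) F j k) (\sum_(j <- s) L j).
Proof.
move=> H; elim: s => [|j s IH].
  rewrite big_nil; under eq_fun do rewrite big_nil; exact: cvgC_cst.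
by rewrite big_cons; under eq_fun do rewrite big_cons; apply: cvgCD.
Qed.

Lemma cvgCX u l n : cvgC u l -> cvgC (fun k => u k ^+ n) (l ^+ n).
Proof.
move=> H; elim: n => [|n IH]; first exact: cvgC_cst.
by rewrite exprS; under eq_fun do rewrite exprS; apply: cvgCM.
Qed.

Lemma cvgC_real_le (u v : nat -> R) (a b : R) : cvgC (fun k => ((u k)%:C)%C) (a%:C)%C ->
  cvgC (fun k => ((v k)%:C)%C) (b%:C)%C -> (forall k, u k <= v k) -> a <= b.
Proof.
move=> /cvgCE Hu /cvgCE Hv H; apply: eps_le => e e0.
have e2 : 0 < e / 2 by rewrite divr_gt0.
have [N HN] := Hu _ e2; have [N' HN'] := Hv _ e2.
have := HN _ (leq_maxl N N'); have := HN' _ (leq_maxr N N'); set k := maxn _ _.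
rewrite -!rmorphB !cabs_real !ltr_norml => /andP[h1 h2] /andP[h3 h4].
by have := H k; lra.
Qed.

Lemma cvgC_real_mono (u : nat -> R) B : (forall k, u k <= u k.+1) ->
  (forall k, u k <= B) -> exists l : R, cvgC (fun k => ((u k)%:C)%C) (l%:C)%C /\
    (forall k, u k <= l) /\ l <= B.
Proof.
move=> mono bd; pose A : classical_sets.set R := fun t : R => exists k, u k = t.
have mon i j : (i <= j)%N -> u i <= u j.
  by move=> ij; rewrite -(subnK ij); elim: (j - i)%N => // k IH; apply: le_trans IH _; apply: mono.
have Aub : classical_sets.has_sup A.
  split; first by exists (u 0%N), 0%N.
  by exists B => _ [k <-].
exists (sup A); split; last first.
  split; first by move=> k; apply: ub_le_sup; [exact: Aub.2| exists k].
  by apply: ge_sup; [exact: Aub.1|move=> _ [k <-]].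
apply/cvgCE => e e0; have [_ [N <-] HN] := sup_adherent e0 Aub.
exists N => k /mon Nk; rewrite -rmorphB cabs_real distrC ger0_norm; first by lra.
by rewrite subr_ge0; apply: ub_le_sup; [exact: Aub.2| exists k].
Qed.

(** The limit is the lower limit of [u], obtained as the supremum of its eventual lower bounds. *)
Lemma real_cauchy_cvg (u : nat -> R) : (forall e, 0 < e -> exists N, forall j k,
   (N <= j)%N -> (N <= k)%N -> `|u j - u k| <= e) ->
  exists l : R, forall e, 0 < e -> exists N, forall k, (N <= k)%N -> `|u k - l| <= e.
Proof.
move=> H; pose A : classical_sets.set R := fun t : R => exists N, forall k, (N <= k)%N -> t <= u k.
have key e N : (forall j k, (N <= j)%N -> (N <= k)%N -> `|u j - u k| <= e) ->
   A (u N - e) /\ classical_sets.ubound A (u N + e).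
  move=> HN; split; first by exists N => k Nk; have := HN _ _ (leqnn N) Nk; rewrite ler_norml; lra.
  move=> x [N' HN']; have := HN' _ (leq_maxr N N').
  by have := HN _ _ (leqnn N) (leq_maxl N N'); rewrite ler_norml; lra.
have Asup : classical_sets.has_sup A.
  have [N /key [h1 h2]] := H 1 ltr01; split; first by exists (u N - 1).
  by exists (u N + 1).
exists (sup A) => e e0; have e2 : 0 < e / 2 by rewrite divr_gt0.
have [N HN] := H _ e2; have [h1 h2] := key _ _ HN; exists N => k Nk.
have := HN _ _ (leqnn N) Nk; have := ub_le_sup Asup.2 h1; have := ge_sup Asup.1 h2.
by rewrite !ler_norml; lra.
Qed.

Definition iv k : R := (k.+1%:R)^-1.

Lemma iv_gt0 k : 0 < iv k. Proof. by rewrite invr_gt0. Qed.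

Lemma iv_mono k j : (k <= j)%N -> iv j <= iv k.
Proof. by move=> kj; rewrite lef_pV2 ?posrE // ler_nat. Qed.

Lemma iv_small e : 0 < e -> exists N, forall k, (N <= k)%N -> iv k <= e.
Proof.
move=> e0; have := archi_boundP (ltW (divr_gt0 ltr01 e0)); set N := Num.bound _ => HN.
exists N => k Nk; rewrite /iv -[e]invrK lef_pV2 ?posrE ?invr_gt0 // -div1r.
by apply: ltW; apply: lt_le_trans HN _; rewrite ler_nat ltnW.
Qed.

End ComplexModulus.

(** * The Hilbert space of square-summable families *)



Section L2Space.
Variable R : realType.
Local Notation C := R[i].
Variables (I : eqType) (win : nat -> seq I).
Implicit Types (f g h : I -> C) (c : C) (e : R).

(** All that is used of [win1] and [win2], so that one Hilbert space theory serves both Hardy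
    spaces. *)
Record exhausting : Prop := Exhausting {
  win_uniq : forall N, uniq (win N);
  win_sub : forall N M, (N <= M)%N -> {subset win N <= win M};
  win_cover : forall x, exists N, x \in win N }.

Hypothesis W : exhausting.

Local Notation l2 := (@in_l2 R I win).
Local Notation "<| f , g |>" := (@inner R I win f g) (at level 0).

Definition nS f N : R := \sum_(x <- win N) nsq (f x).
Definition N2 f : R := Re <|f, f|>.
Definition nm f : R := Num.sqrt (N2 f).

Lemma big_uniq_split (A : zmodType) (s t : seq I) (F : I -> A) : uniq s -> uniq t ->
  {subset s <= t} ->
  \sum_(x <- t) F x = \sum_(x <- s) F x + \sum_(x <- t | x \notin s) F x.
Proof.
move=> us ut st; rewrite (bigID (mem s)) /=; congr (_ + _).
rewrite -big_filter; apply: perm_big; apply: uniq_perm; rewrite ?filter_uniq //.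
by move=> x; rewrite mem_filter; case: (boolP (x \in s)) => //= /st.
Qed.

Lemma nS_mono f N M : (N <= M)%N -> nS f N <= nS f M.
Proof.
move=> NM; rewrite /nS (big_uniq_split _ (win_uniq W N) (win_uniq W M) (win_sub W NM)).
by rewrite lerDl; apply: sumr_ge0 => *; apply: nsq_ge0.
Qed.

Lemma nS_ge0 f N : 0 <= nS f N.
Proof. by apply: sumr_ge0 => *; apply: nsq_ge0. Qed.

Lemma in_l2E f : l2 f <-> exists B, forall N, nS f N <= B.
Proof.
have key N : \sum_(x <- win N) `|f x| ^+ 2 = ((nS f N)%:C)%C.
  by rewrite /nS rmorph_sum; apply: eq_bigr => x _; rewrite norm_cabs -rmorphXn.
by split=> -[B HB]; exists B => N; have := HB N; rewrite key lecR.
Qed.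

Lemma l2D f g : l2 f -> l2 g -> l2 (f + g).
Proof.
move=> /in_l2E[B HB] /in_l2E[B' HB']; apply/in_l2E; exists (B *+ 2 + B' *+ 2) => N.
apply: (@le_trans _ _ (nS f N *+ 2 + nS g N *+ 2)).
  rewrite -!sumrMnl -big_split; apply: ler_sum => x _; exact: nsqD_le.
by rewrite lerD ?lerMn2r ?HB ?HB'.
Qed.

Lemma nSZ c f N : nS (c *: f) N = nsq c * nS f N.
Proof. by rewrite /nS mulr_sumr; apply: eq_bigr => x _; rewrite -nsqM. Qed.

Lemma l2Z c f : l2 f -> l2 (c *: f).
Proof.
move=> /in_l2E[B HB]; apply/in_l2E; exists (nsq c * B) => N.
by rewrite nSZ ler_wpM2l ?nsq_ge0.
Qed.

Lemma l2N f : l2 f -> l2 (- f).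
Proof. by rewrite -scaleN1r; apply: l2Z. Qed.

Lemma l2B f g : l2 f -> l2 g -> l2 (f - g).
Proof. by move=> hf hg; apply: l2D => //; apply: l2N. Qed.

Lemma l20 : l2 0.
Proof.
apply/in_l2E; exists 0 => N; rewrite /nS big1 // => x _; exact: nsq0.
Qed.

Lemma l2_sum (J : Type) (s : seq J) (P : pred J) (F : J -> I -> C) :
  (forall j, P j -> l2 (F j)) -> l2 (\sum_(j <- s | P j) F j).
Proof. by move=> H; elim/big_ind: _ => //; [exact: l20|exact: l2D]. Qed.

Lemma inner_eq f g l : cvgC (fun N => \sum_(x <- win N) f x * (g x)^*) l -> <|f, g|> = l.
Proof.
move=> H; apply: cvgC_unique (H); rewrite /inner.
by apply: epsilon_spec; exists l.
Qed.

Lemma cvg_nS f : l2 f -> exists l : R,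
  cvgC (fun N => \sum_(x <- win N) f x * (f x)^*) (l%:C)%C /\
  (forall N, nS f N <= l) /\ (forall B, (forall N, nS f N <= B) -> l <= B).
Proof.
move=> /in_l2E[B HB]; have mono k : nS f k <= nS f k.+1 by apply: nS_mono.
have [l [Hl [H1 H2]]] := cvgC_real_mono mono HB; exists l; split; last split => //.
  move: Hl; congr cvgC; apply/funext => N; rewrite /nS rmorph_sum.
  by apply: eq_bigr => x _; rewrite mulr_conj.
move=> B' HB'; have [l' [Hl' [_]]] := cvgC_real_mono mono HB'.
by have := cvgC_unique Hl Hl' => -[->].
Qed.

(** Reduces convergence of inner products to that of squared norms, whose window sums are monotone
    and bounded. *)
Lemma polarization (x y : C) : x * y^* = 4^-1 * ((x + y) * (x + y)^* - (x - y) * (x - y)^*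
  + 'i * ((x + 'i * y) * (x + 'i * y)^*) - 'i * ((x - 'i * y) * (x - 'i * y)^*)).
Proof.
rewrite !(rmorphD, rmorphN, rmorphM) /= conjCi; set a := x^*; set b := y^*.
have h := sqrCi C.
rewrite [X in _ = _ * X](_ : _ = (2 - 2 * 'i ^+ 2) * (x * b) + (2 + 2 * 'i ^+ 2) * (y * a)); last by ring.
by rewrite h; field.
Qed.

Lemma cvg_inner f g : l2 f -> l2 g ->
  cvgC (fun N => \sum_(x <- win N) f x * (g x)^*) <|f, g|>.
Proof.
move=> hf hg; suff [l Hl] : exists l, cvgC (fun N => \sum_(x <- win N) f x * (g x)^*) l.
  by rewrite (inner_eq Hl).
have hi := l2Z 'i hg.
have [l1 [H1 _]] := cvg_nS (l2D hf hg); have [l2' [H2 _]] := cvg_nS (l2B hf hg).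
have [l3 [H3 _]] := cvg_nS (l2D hf hi); have [l4 [H4 _]] := cvg_nS (l2B hf hi).
have := cvgCMl 4^-1 (cvgCD (cvgCD (cvgCD H1 (cvgCMl (-1) H2)) (cvgCMl 'i H3)) (cvgCMl (- 'i) H4)).
set l := (_ * _) => H; exists l; move: H; congr cvgC; apply/funext => N.
rewrite !mulr_sumr -!big_split mulr_sumr; apply: eq_bigr => x _.
by rewrite (polarization (f x) (g x)) /= !mulNr mul1r.
Qed.

Lemma innerC f g : l2 f -> l2 g -> <|g, f|> = <|f, g|>^*.
Proof.
move=> hf hg; apply: inner_eq; have := cvgC_conj (cvg_inner hf hg); congr cvgC.
apply/funext => N; rewrite rmorph_sum; apply: eq_bigr => x _.
by rewrite rmorphM /= conjCK mulrC.
Qed.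

Lemma innerDl f g h : l2 f -> l2 g -> l2 h -> <|f + g, h|> = <|f, h|> + <|g, h|>.
Proof.
move=> hf hg hh; apply: inner_eq; have := cvgCD (cvg_inner hf hh) (cvg_inner hg hh).
by congr cvgC; apply/funext => N; rewrite -big_split; apply: eq_bigr => x _; rewrite /= -mulrDl.
Qed.

Lemma innerZl c f h : l2 f -> l2 h -> <|c *: f, h|> = c * <|f, h|>.
Proof.
move=> hf hh; apply: inner_eq; have := cvgCMl c (cvg_inner hf hh).
by congr cvgC; apply/funext => N; rewrite mulr_sumr; apply: eq_bigr => x _; rewrite mulrA.
Qed.

Lemma innerNl f h : l2 f -> l2 h -> <|- f, h|> = - <|f, h|>.
Proof. by move=> hf hh; rewrite -scaleN1r innerZl // mulN1r. Qed.

Lemma innerBl f g h : l2 f -> l2 g -> l2 h -> <|f - g, h|> = <|f, h|> - <|g, h|>.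
Proof. by move=> hf hg hh; rewrite innerDl ?innerNl //; apply: l2N. Qed.

Lemma innerDr f g h : l2 f -> l2 g -> l2 h -> <|h, f + g|> = <|h, f|> + <|h, g|>.
Proof.
move=> hf hg hh; by rewrite (innerC (l2D hf hg) hh) innerDl // rmorphD /= -!innerC.
Qed.

Lemma innerZr c f h : l2 f -> l2 h -> <|h, c *: f|> = c^* * <|h, f|>.
Proof.
move=> hf hh; by rewrite (innerC (l2Z c hf) hh) innerZl // rmorphM /= -!innerC.
Qed.

Lemma innerBr f g h : l2 f -> l2 g -> l2 h -> <|h, f - g|> = <|h, f|> - <|h, g|>.
Proof.
move=> hf hg hh; by rewrite (innerC (l2B hf hg) hh) innerBl // rmorphB /= -!innerC.
Qed.

Lemma inner0l f : <|0, f|> = 0.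
Proof.
apply: inner_eq; have := @cvgC_cst R 0; congr cvgC; apply/funext => N.
by rewrite big1 // => x _; rewrite mul0r.
Qed.

Lemma inner0r f : <|f, 0|> = 0.
Proof.
apply: inner_eq; have := @cvgC_cst R 0; congr cvgC; apply/funext => N.
by rewrite big1 // => x _; rewrite rmorph0 mulr0.
Qed.

Lemma inner_suml (J : Type) (s : seq J) (F : J -> I -> C) h :
  (forall j, l2 (F j)) -> l2 h ->
  <|\sum_(j <- s) F j, h|> = \sum_(j <- s) <|F j, h|>.
Proof.
move=> HF hh; elim: s => [|j s IH]; first by rewrite !big_nil inner0l.
by rewrite !big_cons innerDl ?IH //; apply: l2_sum.
Qed.

Lemma inner_sumr (J : Type) (s : seq J) (F : J -> I -> C) h :
  (forall j, l2 (F j)) -> l2 h ->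
  <|h, \sum_(j <- s) F j|> = \sum_(j <- s) <|h, F j|>.
Proof.
move=> HF hh; elim: s => [|j s IH]; first by rewrite !big_nil inner0r.
by rewrite !big_cons innerDr ?IH //; apply: l2_sum.
Qed.

Lemma innerN2 f : l2 f -> <|f, f|> = ((N2 f)%:C)%C.
Proof. by move=> /cvg_nS [l [/inner_eq H _]]; rewrite /N2 H. Qed.

Lemma nS_le_N2 f N : l2 f -> nS f N <= N2 f.
Proof. by move=> /cvg_nS [l [/inner_eq H [H1 _]]]; rewrite /N2 H. Qed.

Lemma N2_le f B : (forall N, nS f N <= B) -> N2 f <= B.
Proof.
move=> HB; have /cvg_nS [l [/inner_eq H [_ H1]]] : l2 f by apply/in_l2E; exists B.
by rewrite /N2 H; apply: H1.
Qed.

Lemma N2_ge0 f : l2 f -> 0 <= N2 f.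
Proof. by move=> hf; apply: le_trans (nS_ge0 f 0) (nS_le_N2 0 hf). Qed.

Lemma nsq_le_N2 f x : l2 f -> nsq (f x) <= N2 f.
Proof.
move=> hf; have [N xN] := win_cover W x; apply: le_trans (nS_le_N2 N hf).
rewrite /nS (bigD1_seq x) //=; last exact: win_uniq.
by rewrite lerDl; apply: sumr_ge0 => *; apply: nsq_ge0.
Qed.

Lemma N2_eq0 f : l2 f -> N2 f = 0 -> f = 0.
Proof.
move=> hf h0; apply/funext => x; apply/eqP; rewrite -nsq_eq0 eq_le nsq_ge0 andbT -h0.
exact: nsq_le_N2.
Qed.

Lemma N2Z c f : l2 f -> N2 (c *: f) = nsq c * N2 f.
Proof.
move=> hf; have hc := l2Z c hf; apply: realc_inj.
by rewrite -innerN2 // innerZl // innerZr // innerN2 // mulrA mulr_conj -rmorphM.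
Qed.

Lemma N2D f g : l2 f -> l2 g -> N2 (f + g) = N2 f + N2 g + Re <|f, g|> *+ 2.
Proof.
move=> hf hg; have hd := l2D hf hg.
rewrite /N2 innerDl // !innerDr // !ReD (innerC hf hg) cRe_conj; lra.
Qed.

Lemma N2N f : l2 f -> N2 (- f) = N2 f.
Proof.
move=> hf; rewrite -scaleN1r N2Z // nsqN /nsq cabs1; ring.
Qed.

Lemma N2B f g : l2 f -> l2 g -> N2 (f - g) = N2 f + N2 g - Re <|f, g|> *+ 2.
Proof.
move=> hf hg; have hn := l2N hg; rewrite N2D // N2N // (_ : <|f, -g|> = - <|f, g|>).
  by rewrite (_ : Re (- _) = - Re <|f, g|>) ?mulNrn //; case: <|f,g|>.
by rewrite -scaleN1r innerZr // rmorphN1 mulN1r.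
Qed.

(** Cauchy-Schwarz: [f - t <f,g> g] has nonnegative squared norm for every real [t]. The choice
    [t = 1 / N2 g] gives the bound; if [N2 g = 0], a large [t] forces [<f,g> = 0]. *)
Lemma nsq_inner_le f g : l2 f -> l2 g -> nsq <|f, g|> <= N2 f * N2 g.
Proof.
move=> hf hg; set a := <|f, g|>.
have key (t : R) : 0 <= N2 f - t * nsq a *+ 2 + t ^+ 2 * nsq a * N2 g.
  have hc := l2Z ((t%:C)%C * a) hg; have := N2_ge0 (l2B hf hc).
  rewrite N2B // N2Z // innerZr // -/a rmorphM /= -mulrA [a^* * _]mulrC mulr_conj.
  rewrite nsqM /nsq cabs_real -/(nsq a) real_normK ?num_real //.
  have -> : ((t%:C)%C)^* = (t%:C)%C by apply/eqP; rewrite eq_complex /= oppr0 !eqxx.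
  by rewrite -rmorphM /=; lra.
have a0 := nsq_ge0 a; have := N2_ge0 hg; rewrite le_eqVlt => /orP[/eqP g0|g0].
  rewrite -g0 mulr0; rewrite leNgt; apply/negP => an.
  have := key ((N2 f + 1) / nsq a); rewrite -g0 mulr0 addr0 divfK ?gt_eqF //.
  have := N2_ge0 hf; lra.
have := key (N2 g)^-1; rewrite [X in _ + X](_ : _ = ((N2 g)^-1 * N2 g) * ((N2 g)^-1 * nsq a)); last by ring.
rewrite mulVf ?gt_eqF // mul1r [_^-1 * _]mulrC => h.
have : 0 <= N2 f - nsq a / N2 g by lra.
by rewrite subr_ge0 ler_pdivrMr.
Qed.

Lemma nm_ge0 f : 0 <= nm f. Proof. exact: sqrtr_ge0. Qed.

Lemma nm_sqr f : l2 f -> nm f ^+ 2 = N2 f.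
Proof. by move=> hf; rewrite sqr_sqrtr // N2_ge0. Qed.

Lemma le_nm f (B : R) : 0 <= B -> l2 f -> N2 f <= B ^+ 2 -> nm f <= B.
Proof.
by move=> B0 hf H; rewrite -(@ler_sqr _ (nm f)) ?nnegrE ?nm_ge0 // nm_sqr.
Qed.

Lemma cabs_inner f g : l2 f -> l2 g -> cabs <|f, g|> <= nm f * nm g.
Proof.
move=> hf hg; rewrite -ler_sqr ?nnegrE ?cabs_ge0 ?mulr_ge0 ?nm_ge0 //.
by rewrite exprMn !nm_sqr //; apply: nsq_inner_le.
Qed.

Lemma nmD f g : l2 f -> l2 g -> nm (f + g) <= nm f + nm g.
Proof.
move=> hf hg; apply: le_nm; rewrite ?addr_ge0 ?nm_ge0 //; first exact: l2D.
rewrite N2D // sqrrD !nm_sqr // addrAC lerD2r lerD2l lerMn2r /=.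
by apply: le_trans (Re_le_cabs _) _; apply: cabs_inner.
Qed.

Lemma nmZ c f : l2 f -> nm (c *: f) = cabs c * nm f.
Proof.
by move=> hf; rewrite /nm N2Z // sqrtrM ?nsq_ge0 // sqrtr_sqr ger0_norm ?cabs_ge0.
Qed.

Lemma nmN f : l2 f -> nm (- f) = nm f.
Proof. by move=> hf; rewrite /nm N2N. Qed.

Lemma nmB f g : l2 f -> l2 g -> nm (f - g) <= nm f + nm g.
Proof. by move=> hf hg; rewrite -(nmN hg); apply: nmD => //; apply: l2N. Qed.

Lemma nm0 : nm 0 = 0.
Proof. by rewrite /nm /N2 inner0l sqrtr0. Qed.

Lemma nm_sum (J : Type) (s : seq J) (P : pred J) (F : J -> I -> C) :
  (forall j, l2 (F j)) ->
  nm (\sum_(j <- s | P j) F j) <= \sum_(j <- s | P j) nm (F j).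
Proof.
move=> HF; elim: s => [|j s IH]; first by rewrite !big_nil nm0.
rewrite !big_cons; case: ifP => // _; apply: le_trans (nmD _ _) _ => //.
  exact: l2_sum.
by rewrite lerD2l.
Qed.

Definition trunc N f : I -> C := fun x => if x \in win N then f x else 0.

Lemma nS_subtrunc f N M : nS (f - trunc N f) M <= nS f (maxn N M) - nS f N.
Proof.
apply: le_trans (nS_mono _ (leq_maxr N M)) _.
rewrite {2}/nS (big_uniq_split _ (win_uniq W N) (win_uniq W _) (win_sub W (leq_maxl N M))).
rewrite -/(nS f N) [X in _ <= X]addrAC subrr add0r [X in X <= _](bigID (mem (win N))) /= big1 ?add0r; last first.
  by move=> x xN; rewrite !fctE /trunc xN subrr nsq0.
by apply: ler_sum => x xN; rewrite !fctE /trunc (negbTE xN) subr0.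
Qed.

Lemma l2_subtrunc f N : l2 f -> l2 (f - trunc N f).
Proof.
move=> hf; apply/in_l2E; exists (N2 f) => M; apply: le_trans (nS_subtrunc _ _ _) _.
by have := nS_le_N2 (maxn N M) hf; have := nS_ge0 f N; lra.
Qed.

Lemma l2_trunc f N : l2 f -> l2 (trunc N f).
Proof. by move=> hf; rewrite -(subKr f (trunc N f)); apply: l2B => //; apply: l2_subtrunc. Qed.

Lemma trunc_cvg f e : l2 f -> 0 < e -> exists N0, forall N, (N0 <= N)%N ->
  nm (f - trunc N f) <= e.
Proof.
move=> hf e0; have e20 : 0 < e ^+ 2 by rewrite exprn_gt0.
have [N0 HN0] : exists N0, N2 f - nS f N0 <= e ^+ 2.
  apply: contrapT => H; have : N2 f <= N2 f - e ^+ 2; last by lra.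
  by apply: N2_le => N; rewrite leNgt; apply/negP => h; apply: H; exists N; lra.
exists N0 => N NN; apply: le_nm; rewrite ?(ltW e0) //; first exact: l2_subtrunc.
apply: N2_le => M; apply: le_trans (nS_subtrunc _ _ _) _.
by have := nS_le_N2 (maxn N M) hf; have := nS_mono f NN; lra.
Qed.

(** Completeness with an explicit rate: each coordinate converges, and the bound [B k] passes to the
    limit on every finite window. *)
Lemma l2_complete (s : nat -> I -> C) (B : nat -> R) : (forall k, l2 (s k)) ->
  (forall e, 0 < e -> exists N, forall k, (N <= k)%N -> B k <= e) ->
  (forall j k, (k <= j)%N -> N2 (s j - s k) <= B k) ->
  exists y, l2 y /\ forall k, N2 (y - s k) <= B k.
Proof.
move=> hs HB Hs.
have Bs k : 0 <= B k by have := Hs k k (leqnn k); apply: le_trans; apply: N2_ge0; apply: l2B.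
have cv x : exists l : C, cvgC (fun k => s k x) l.
  have cau e : 0 < e -> exists N, forall j k, (N <= j)%N -> (N <= k)%N -> cabs (s j x - s k x) <= e.
    move=> e0; have e2 : 0 < e ^+ 2 by rewrite exprn_gt0.
    have [N HN] := HB _ e2; exists N.
    have K j k : (k <= j)%N -> (N <= k)%N -> cabs (s j x - s k x) <= e.
      move=> kj Nk; rewrite -ler_sqr ?nnegrE ?cabs_ge0 ?(ltW e0) //.
      apply: le_trans (HN _ Nk); apply: le_trans (Hs _ _ kj).
      exact: (nsq_le_N2 x (l2B (hs j) (hs k))).
    move=> j k Nj Nk; case: (leqP k j) => h; first exact: K.
    by rewrite cabs_distC; apply: K => //; apply: ltnW.
  have [a Ha] : exists l : R, forall e, 0 < e -> exists N, forall k, (N <= k)%N -> `|Re (s k x) - l| <= e.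
    apply: real_cauchy_cvg => e /cau [N HN]; exists N => j k Nj Nk.
    by rewrite -ReB; apply: le_trans (normRe_le_cabs _) (HN _ _ Nj Nk).
  have [b Hb] : exists l : R, forall e, 0 < e -> exists N, forall k, (N <= k)%N -> `|Im (s k x) - l| <= e.
    apply: real_cauchy_cvg => e /cau [N HN]; exists N => j k Nj Nk.
    rewrite (_ : _ - _ = Im (s j x - s k x)); last by case: (s j x); case: (s k x).
    by apply: le_trans (normIm_le_cabs _) (HN _ _ Nj Nk).
  exists (Complex a b); apply/cvgCE => e e0; have e3 : 0 < e / 3 by rewrite divr_gt0.
  have [N HN] := Ha _ e3; have [N' HN'] := Hb _ e3; exists (maxn N N') => k.
  rewrite geq_max => /andP[/HN h1 /HN' h2]; apply: le_lt_trans (cabs_le_ReIm _) _.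
  by move: h1 h2; case: (s k x) => u v /=; lra.
pose y x := proj1_sig (cid (cv x)).
have Hy x : cvgC (fun k => s k x) (y x) by rewrite /y; case: cid.
have key k N : nS (y - s k) N <= B k.
  have cvd x : cvgC (fun j => (s j x - s k x) * (s j x - s k x)^*) ((y x - s k x) * (y x - s k x)^*).
    have h := cvgCD (Hy x) (cvgC_cst (- s k x)).
    exact: cvgCM h (cvgC_conj h).
  have /cvgCE lim := cvgC_sum (win N) cvd.
  apply: eps_le => e e0; have [K HK] := lim _ e0.
  have {}HK := HK _ (leq_maxl K k); have h2 := Hs _ _ (leq_maxr K k).
  set j := maxn K k in HK h2.
  have h3 := nS_le_N2 N (l2B (hs j) (hs k)).
  have E z : ((nS (z - s k) N)%:C)%C = \sum_(x <- win N) (z x - s k x) * (z x - s k x)^*.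
    by rewrite /nS rmorph_sum; apply: eq_bigr => x _; rewrite mulr_conj.
  move: HK; rewrite -!E -rmorphB cabs_real.
  rewrite ltr_norml => /andP[]; lra.
exists y; split; last by move=> k; apply: N2_le.
rewrite -(subrK (s 0%N) y); apply: l2D => //; apply/in_l2E; exists (B 0%N); exact: key.
Qed.

(* A minimising sequence is Cauchy by the parallelogram identity. *)
Lemma projection_exists (S : (I -> C) -> Prop) f : closed_subspace win S -> l2 f ->
  exists y, S y /\ forall s, S s -> <|subf f y, s|> = 0.
Proof.
move=> [Sl2 [S0 [SD [SZ Scl]]]] hf.
pose D : classical_sets.set R := fun t => exists s, S s /\ t = N2 (f - s).
have Dinf : classical_sets.has_inf D.
  split; first by exists (N2 (f - 0)), 0.
  by exists 0 => _ [s [hs ->]]; apply: N2_ge0; apply: l2B => //; apply: Sl2.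
set d := inf D.
have dle s : S s -> d <= N2 (f - s) by move=> hs; apply: ge_inf; [exact: Dinf.2|exists s].
have seqx k : exists s, S s /\ N2 (f - s) < d + iv R k.
  have k0 := iv_gt0 R k.
  by have [_ [s [hs ->]] H] := inf_adherent k0 Dinf; exists s.
pose s k := proj1_sig (cid (seqx k)).
have Hs k : S (s k) /\ N2 (f - s k) < d + iv R k.
  by rewrite /s; case: cid.
have ls k : l2 (s k) by apply: Sl2; apply: (Hs k).1.
pose B k : R := 4 * iv R k.
have Bcv e : 0 < e -> exists N, forall k, (N <= k)%N -> B k <= e.
  move=> e0; have e4 : 0 < e / 4 by rewrite divr_gt0.
  by have [N HN] := iv_small e4; exists N => k /HN; rewrite /B; lra.
have Scau j k : (k <= j)%N -> N2 (s j - s k) <= B k.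
  move=> kj; have hj := l2B hf (ls j); have hk := l2B hf (ls k).
  have hm : S (2^-1 *: (s j + s k)) by apply: SZ; apply: SD; [exact: (Hs j).1|exact: (Hs k).1].
  have := dle _ hm.
  have E1 : f - 2^-1 *: (s j + s k) = 2^-1 *: ((f - s j) + (f - s k)).
    apply/funext => x; rewrite !fctE /=; rewrite [_ *: _]/GRing.scale /= [in RHS]/GRing.scale /=.
    by field.
  have E2 : s j - s k = (f - s k) - (f - s j) by apply/funext => x; rewrite !fctE; ring.
  rewrite E1 N2Z; last exact: l2D.
  rewrite E2 N2B // N2D // (innerC hj hk) cRe_conj.
  have -> : nsq (2^-1 : C) = 4^-1.
    by rewrite /nsq cabsV cabs_nat; field.
  have := (Hs j).2; have := (Hs k).2.
  have := iv_mono R kj.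
  rewrite /B; lra.
have [y [ly Hy]] := l2_complete ls Bcv Scau.
have Sy : S y.
  apply: Scl => // e e0; have e2 : 0 < e / 2 by rewrite divr_gt0.
  have [N HN] := Bcv _ e2; exists (s N); split; first exact: (Hs N).1.
  rewrite norm_cabs ltcR innerN2; last exact: l2B.
  rewrite cabs_real ger0_norm; last by apply: N2_ge0; apply: l2B.
  by apply: le_lt_trans (Hy N) _; have := HN _ (leqnn N); lra.
have Ny : N2 (f - y) <= d.
  have hfy := l2B hf ly.
  suff h : nm (f - y) <= Num.sqrt d.
    rewrite -nm_sqr // -(@sqr_sqrtr _ d) ?ler_sqr ?nnegrE ?nm_ge0 ?sqrtr_ge0 //.
    by apply: lb_le_inf; [exact: Dinf.1|move=> _ [u [hu ->]]; apply: N2_ge0; apply: l2B => //; apply: Sl2].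
  have d0 : 0 <= d.
    by apply: lb_le_inf; [exact: Dinf.1|move=> _ [u [hu ->]]; apply: N2_ge0; apply: l2B => //; apply: Sl2].
  apply: eps_le => e e0; have e2 : 0 < (e / 4) ^+ 2 by rewrite exprn_gt0 // divr_gt0.
  have [N HN] := Bcv _ e2.
  have h1 : nm (f - s N) <= Num.sqrt d + e / 4.
    apply: le_nm; [by rewrite addr_ge0 ?sqrtr_ge0 // divr_ge0 // ltW|exact: l2B|].
    rewrite sqrrD sqr_sqrtr //; have := (Hs N).2; have := HN _ (leqnn N); rewrite /B.
    have : 0 <= Num.sqrt d * (e / 4) by rewrite mulr_ge0 ?sqrtr_ge0 // divr_ge0 // ltW.
    have := iv_gt0 R N.
    lra.
  have h2 : nm (y - s N) <= e / 4.
    apply: le_nm; [by rewrite divr_ge0 // ltW|exact: l2B|].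
    exact: le_trans (Hy N) (HN _ (leqnn N)).
  rewrite (_ : f - y = (f - s N) - (y - s N)); last by rewrite opprB addrA subrK.
  by apply: le_trans (nmB _ _) _; [exact: l2B|exact: l2B|lra].
exists y; split => // u hu; have lu := Sl2 _ hu; have hfy := l2B hf ly.
change (<|f - y, u|> = 0); set a := <|f - y, u|>.
(* Minimality of the distance at [y], tested against [y + t a u]. The value [t = 1 / (N2 u + 1)]
   below then forces [a = 0]. *)
have key (t : R) : t * nsq a *+ 2 <= t ^+ 2 * nsq a * N2 u.
  have hS : S (y + ((t%:C)%C * a) *: u) by apply: SD => //; apply: SZ.
  have := dle _ hS; have hc := l2Z ((t%:C)%C * a) lu.
  rewrite opprD addrA N2B // N2Z // innerZr // -/a rmorphM /= -mulrA [a^* * _]mulrC mulr_conj.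
  rewrite nsqM {1}/nsq cabs_real real_normK ?num_real //.
  have -> : ((t%:C)%C)^* = (t%:C)%C by apply/eqP; rewrite eq_complex /= oppr0 !eqxx.
  rewrite -rmorphM /=; lra.
have a0 := nsq_ge0 a; have u0 := N2_ge0 lu.
apply/eqP; rewrite -nsq_eq0 eq_le a0 andbT.
have := key (N2 u + 1)^-1; set t := _^-1.
have t0 : 0 < t by rewrite invr_gt0 ltr_wpDl.
have tu : t * N2 u <= 1 by rewrite mulrC ler_pdivrMr ?mul1r ?lerDl // ltr_wpDl.
have : t ^+ 2 * nsq a * N2 u <= t * nsq a.
  rewrite (_ : _ * N2 u = (t * N2 u) * (t * nsq a)); last by ring.
  by rewrite ler_piMl // mulr_ge0 // ltW.
move=> h1 h2; have h3 : t * nsq a <= 0 by lra.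
by rewrite -(pmulr_rle0 _ t0).
Qed.

(** As [h] lies in [S], the projection drops out of [<P T h, h>]; from here on only the quadratic
    form of [T] on [S] matters. *)
Lemma num_range_comprE (S : (I -> C) -> Prop) (T : (I -> C) -> I -> C) w :
  closed_subspace win S -> (forall h, S h -> l2 (T h)) ->
  num_range_compr win S T w <-> exists h, S h /\ N2 h = 1 /\ w = <|T h, h|>.
Proof.
move=> cS HT; have Sl2 := cS.1.
have key h : S h -> <|proj win S (T h), h|> = <|T h, h|>.
  move=> hS; have hT := HT _ hS.
  have [py ph] : S (proj win S (T h)) /\ forall s, S s -> <|subf (T h) (proj win S (T h)), s|> = 0.
    rewrite /proj.
    by apply: (@epsilon_spec _ _ (fun y => S y /\ forall s, S s -> <|subf (T h) y, s|> = 0)); apply: projection_exists.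
  have := ph _ hS; rewrite /subf.
  rewrite -/((T h) - (proj win S (T h))) innerBl //; [|exact: Sl2|exact: Sl2].
  by move/eqP; rewrite subr_eq0 => /eqP.
split=> -[h [hS [h1 ->]]]; exists h; split => //; split; rewrite ?key //.
  by rewrite /N2 h1.
by rewrite innerN2 ?h1 //; apply: Sl2.
Qed.

End L2Space.

(** * Actions of polynomials through shifts *)



Section PolyAction.
Variables (A : comNzRingType) (V : zmodType).
Implicit Types (sc : A -> V -> V) (T : V -> V) (p q : {poly A}).

Record is_action (B : nzRingType) (sc : B -> V -> V) : Prop := IsAction {
  actDl : forall a b f, sc (a + b) f = sc a f + sc b f;
  actDr : forall a f g, sc a (f + g) = sc a f + sc a g;
  actM : forall a b f, sc (a * b) f = sc a (sc b f);
  act1 : forall f, sc 1 f = f }.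

Lemma act0l (B : nzRingType) (sc : B -> V -> V) f : is_action sc -> sc 0 f = 0.
Proof. by move=> h; apply: (addrI (sc 0 f)); rewrite -(actDl h) !addr0. Qed.

Lemma act0r (B : nzRingType) (sc : B -> V -> V) a : is_action sc -> sc a 0 = 0.
Proof. by move=> h; apply: (addrI (sc a 0)); rewrite -(actDr h) !addr0. Qed.

Lemma actNl (B : nzRingType) (sc : B -> V -> V) a f : is_action sc -> sc (- a) f = - sc a f.
Proof. by move=> h; apply: (addrI (sc a f)); rewrite -(actDl h) !subrr act0l. Qed.

Lemma actNr (B : nzRingType) (sc : B -> V -> V) a f : is_action sc -> sc a (- f) = - sc a f.
Proof. by move=> h; apply: (addrI (sc a f)); rewrite -(actDr h) !subrr act0r. Qed.

Lemma actBl (B : nzRingType) (sc : B -> V -> V) a b f : is_action sc ->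
  sc (a - b) f = sc a f - sc b f.
Proof. by move=> h; rewrite (actDl h) actNl. Qed.

Lemma actBr (B : nzRingType) (sc : B -> V -> V) a f g : is_action sc ->
  sc a (f - g) = sc a f - sc a g.
Proof. by move=> h; rewrite (actDr h) actNr. Qed.

(** Evaluation of [p] at the operator [T]. Used twice, with scalar and then with polynomial
    coefficients, it makes bivariate polynomials act through two commuting shifts. *)
Definition pact sc T p f := \sum_(i < size p) iter i T (sc p`_i f).

Variables (sc : A -> V -> V) (T : V -> V).
Hypothesis Hsc : is_action sc.
Hypothesis TD : forall f g, T (f + g) = T f + T g.
Hypothesis TC : forall a f, T (sc a f) = sc a (T f).

Lemma additive0 (U : V -> V) : (forall f g, U (f + g) = U f + U g) -> U 0 = 0.
Proof. by move=> h; apply: (addrI (U 0)); rewrite -h !addr0. Qed.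

Lemma additive_sum (U : V -> V) (J : Type) (s : seq J) (F : J -> V) :
  (forall f g, U (f + g) = U f + U g) ->
  U (\sum_(j <- s) F j) = \sum_(j <- s) U (F j).
Proof. by move=> h; apply: (big_morph U h); apply: additive0. Qed.

Lemma iter_addf i f g : iter i T (f + g) = iter i T f + iter i T g.
Proof. by elim: i => //= i ->; rewrite TD. Qed.

Lemma iter_sc i a f : iter i T (sc a f) = sc a (iter i T f).
Proof. by elim: i => //= i ->; rewrite TC. Qed.

Lemma pactE n p f : (size p <= n)%N -> pact sc T p f = \sum_(i < n) iter i T (sc p`_i f).
Proof.
move=> pn; rewrite /pact (big_ord_widen n (fun i => iter i T (sc p`_i f)) pn).
rewrite big_mkcond; apply: eq_bigr => i _; case: ltnP => // h.
by rewrite nth_default // act0l // additive0 //; apply: iter_addf.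
Qed.

Lemma pactDl p q f : pact sc T (p + q) f = pact sc T p f + pact sc T q f.
Proof.
set n := maxn (size p) (size q).
rewrite !(@pactE n) ?leq_maxl ?leq_maxr ?size_polyD // -big_split.
by apply: eq_bigr => i _; rewrite coefD (actDl Hsc) iter_addf.
Qed.

Lemma pactDr p f g : pact sc T p (f + g) = pact sc T p f + pact sc T p g.
Proof. by rewrite /pact -big_split; apply: eq_bigr => i _; rewrite (actDr Hsc) iter_addf. Qed.

Lemma pactC a f : pact sc T a%:P f = sc a f.
Proof. by rewrite (@pactE 1) ?size_polyC_leq1 // big_ord1 coefC. Qed.

Lemma pactMX p f : pact sc T (p * 'X) f = T (pact sc T p f).
Proof.
rewrite (@pactE (size p).+1); last first.
  by apply: leq_trans (size_polyMleq _ _) _; rewrite size_polyX addn2.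
rewrite big_ord_recl coefMX /= act0l // add0r /pact additive_sum //.
by apply: eq_bigr => i _; rewrite coefMX.
Qed.

Lemma pactX f : pact sc T 'X f = T f.
Proof. by rewrite -['X]mul1r pactMX -polyC1 pactC (act1 Hsc). Qed.

Lemma pact_comm (U : V -> V) p f : (forall f g, U (f + g) = U f + U g) ->
  (forall a f, U (sc a f) = sc a (U f)) -> (forall f, U (T f) = T (U f)) ->
  U (pact sc T p f) = pact sc T p (U f).
Proof.
move=> UD UC UT; rewrite /pact additive_sum //; apply: eq_bigr => i _.
rewrite -UC; elim: (nat_of_ord i) (sc _ _) => //= k IH g.
by rewrite UT IH.
Qed.

Lemma pactMC a p f : pact sc T (a%:P * p) f = sc a (pact sc T p f).
Proof.
rewrite (@pactE (size p)); last by rewrite mul_polyC size_scale_leq.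
rewrite /pact (additive_sum _ _ (actDr Hsc a)); apply: eq_bigr => i _.
by rewrite coefCM (actM Hsc) iter_sc.
Qed.

Lemma pactM p q f : pact sc T (p * q) f = pact sc T p (pact sc T q f).
Proof.
elim/poly_ind: p f => [|p c IH] f.
  by rewrite mul0r -polyC0 !pactC !act0l.
by rewrite mulrDl !pactDl mulrAC !pactMX IH pactMC pactC.
Qed.

Lemma pact_action : is_action (pact sc T).
Proof.
split; [exact: pactDl|exact: pactDr|exact: pactM|].
by move=> f; rewrite -polyC1 pactC (act1 Hsc).
Qed.

Lemma pactT p f : pact sc T p (T f) = T (pact sc T p f).
Proof. by rewrite -pactX -pactM mulrC pactM pactX. Qed.

End PolyAction.

(** * The shifts of the two Hardy spaces and their polynomial actions *)

Section Shifts.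
Variable R : realType.
Local Notation C := R[i].

Lemma exhausting_win1 : exhausting win1.
Proof.
split; first by move=> N; apply: iota_uniq.
  by move=> N M NM x; rewrite !mem_iota !add0n => /andP[_ h]; apply: leq_trans h NM.
by move=> x; exists x.+1; rewrite mem_iota /= add0n.
Qed.

Lemma mem_win2 N (x : nat * nat) : (x \in win2 N) = (x.1 < N)%N && (x.2 < N)%N.
Proof.
case: x => i j; rewrite /win2; apply/allpairsP/andP => /=.
  by move=> [[a b] /= []]; rewrite !mem_iota !add0n /= => ha hb [-> ->].
by move=> [ha hb]; exists (i, j); rewrite !mem_iota.
Qed.

Lemma exhausting_win2 : exhausting win2.
Proof.
split; first by move=> N; apply: allpairs_uniq; rewrite ?iota_uniq //; case=> [a b] [c d].
  move=> N M NM x; rewrite !mem_win2 => /andP[a b].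
  by rewrite !(leq_trans _ NM).
by move=> x; exists (maxn x.1 x.2).+1; rewrite mem_win2 !ltnS leq_maxl leq_maxr.
Qed.

Lemma big_win2 (A : nmodType) N (F : nat * nat -> A) :
  \sum_(x <- win2 N) F x = \sum_(i < N) \sum_(j < N) F (nat_of_ord i, nat_of_ord j).
Proof.
rewrite /win2 big_allpairs_dep /= -{1}(subn0 N) -/(index_iota 0 N) big_mkord.
by apply: eq_bigr => i _; rewrite -{1}(subn0 N) -/(index_iota 0 N) big_mkord.
Qed.

Lemma big_win1 (A : nmodType) N (F : nat -> A) :
  \sum_(x <- win1 N) F x = \sum_(i < N) F i.
Proof. by rewrite /win1 -{1}(subn0 N) -/(index_iota 0 N) big_mkord. Qed.

Section Generic.
Variables (I : eqType) (win : nat -> seq I).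
Hypothesis W : exhausting win.
Local Notation V := (I -> C).
Implicit Types (f g h : V).
Local Notation l2 := (@in_l2 R I win).
Local Notation "<| f , g |>" := (@inner R I win f g) (at level 0).
Local Notation nS := (@nS R I win).
Local Notation N2 := (@N2 R I win).
Local Notation nm := (@nm R I win).

(** An isometry [T] with its adjoint [B], phrased on windows so that each instance is a reindexing
    of finite sums. By [sh_orth], [T f] and [g - T (B g)] have disjoint supports; by [sh_nil], the
    powers of [T] leave every window. *)
Record is_shift (T B : V -> V) : Prop := IsShift {
  shD : forall f g, T (f + g) = T f + T g;
  shZ : forall c f, T (c *: f) = c *: T f;
  sh_le : forall f N, nS (T f) N <= nS f N;
  sh_ge : forall f N, nS f N <= nS (T f) N.+1;
  shB_le : forall f N, nS (B f) N <= nS f N.+1;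
  sh_orth : forall f g x, T f x * ((g - T (B g)) x)^* = 0;
  sh_nil : forall f x N n, (N <= n)%N -> x \in win N -> iter n T f x = 0 }.

Variables (T B : V -> V).
Hypothesis sh : is_shift T B.

Lemma l2_shift f : l2 f -> l2 (T f).
Proof.
move=> hf; apply/in_l2E; exists (N2 f) => N; apply: le_trans (sh_le sh _ _) _.
exact: nS_le_N2.
Qed.

Lemma l2_unshift f : l2 f -> l2 (B f).
Proof.
move=> hf; apply/in_l2E; exists (N2 f) => N; apply: le_trans (shB_le sh _ _) _.
exact: nS_le_N2.
Qed.

Lemma N2_shift f : l2 f -> N2 (T f) = N2 f.
Proof.
move=> hf; apply/eqP; rewrite eq_le; apply/andP; split; apply: N2_le => // N.
  by apply: le_trans (sh_le sh _ _) _; apply: nS_le_N2.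
by apply: le_trans (sh_ge sh _ _) _; apply: nS_le_N2 => //; apply: l2_shift.
Qed.

Lemma nm_shift f : l2 f -> nm (T f) = nm f.
Proof. by move=> hf; rewrite /nm N2_shift. Qed.

(** Preservation of norms gives the real parts; the imaginary parts follow on replacing [g] by
    ['i *: g]. *)
Lemma inner_shift f g : l2 f -> l2 g -> <|T f, T g|> = <|f, g|>.
Proof.
have key h k : l2 h -> l2 k -> Re <|T h, T k|> = Re <|h, k|>.
  move=> hh hk; have := N2D W hh hk; have := N2D W (l2_shift hh) (l2_shift hk).
  rewrite -(shD sh) !N2_shift //; [lra|exact: l2D].
move=> hf hg; have h1 := key _ _ hf hg; have := key _ _ hf (l2Z 'i hg).
rewrite (shZ sh) !innerZr //; try exact: l2_shift; rewrite conjCi.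
have E z : Re (- 'i * z : C) = Im z by case: z => a b /=; ring.
by rewrite !E; move: h1; case: <|T f, T g|> => a b; case: <|f, g|> => c d /= -> ->.
Qed.

Lemma inner_pointwise0 f g : (forall x, f x * (g x)^* = 0) -> <|f, g|> = 0.
Proof.
move=> H; apply: inner_eq; have := @cvgC_cst R 0; congr cvgC; apply/funext => N.
by rewrite big1.
Qed.

Lemma adjoint_shift f g : l2 f -> l2 g -> <|T f, g|> = <|f, B g|>.
Proof.
move=> hf hg; have hB := l2_unshift hg; have hT := l2_shift hf; have hTB := l2_shift hB.
rewrite -(subrK (T (B g)) g) innerDr //; last exact: l2B.
rewrite inner_pointwise0 ?add0r ?inner_shift //; last exact: (sh_orth sh).
by rewrite subrK.
Qed.

Lemma adjoint_unshift f g : l2 f -> l2 g -> <|B f, g|> = <|f, T g|>.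
Proof.
move=> hf hg; rewrite (innerC W hg (l2_unshift hf)) -adjoint_shift //.
by rewrite -(innerC W) //; apply: l2_shift.
Qed.

Lemma l2_iter i f : l2 f -> l2 (iter i T f).
Proof. by move=> hf; elim: i => //= i IH; apply: l2_shift. Qed.

Lemma l2_iterB i f : l2 f -> l2 (iter i B f).
Proof. by move=> hf; elim: i => //= i IH; apply: l2_unshift. Qed.

Lemma nm_iter i f : l2 f -> nm (iter i T f) = nm f.
Proof. by move=> hf; elim: i => //= i <-; rewrite nm_shift //; apply: l2_iter. Qed.

Lemma N2_iter i f : l2 f -> N2 (iter i T f) = N2 f.
Proof. by move=> hf; elim: i => //= i <-; rewrite N2_shift //; apply: l2_iter. Qed.

Lemma inner_iter i f g : l2 f -> l2 g -> <|iter i T f, iter i T g|> = <|f, g|>.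
Proof. by move=> hf hg; elim: i => //= i <-; rewrite inner_shift //; apply: l2_iter. Qed.

Lemma adjoint_iter i f g : l2 f -> l2 g -> <|f, iter i T g|> = <|iter i B f, g|>.
Proof.
elim: i f g => //= i IH f g hf hg.
by rewrite (adjoint_unshift (l2_iterB i hf) hg) -(IH _ _ hf (l2_shift hg)) -iterSr.
Qed.

(** Powers of a shift tend weakly to 0: [g] is cut to a window at small cost, and [iter n T f]
    vanishes on that window. This makes vectors almost orthogonal, both for convex combinations and
    for [sparse_mean]. *)
Lemma weak_shift f g (e : R) : l2 f -> l2 g -> 0 < e -> exists N, forall n, (N <= n)%N ->
  cabs <|iter n T f, g|> <= e.
Proof.
move=> hf hg e0; have f1 : 0 < nm f + 1 by rewrite ltr_wpDl ?nm_ge0.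
have e1 : 0 < e / (nm f + 1) by rewrite divr_gt0.
have [N HN] := trunc_cvg W hg e1; exists N => n Nn; have hi := l2_iter n hf.
have hs := l2_subtrunc W N hg; have ht := l2_trunc W N hg.
rewrite -(subrK (trunc win N g) g) innerDr // [X in _ + X]inner_pointwise0 ?addr0; last first.
  move=> x; rewrite /trunc; case: ifP => xN; last by rewrite rmorph0 mulr0.
  by rewrite (sh_nil sh _ Nn xN) mul0r.
apply: le_trans (cabs_inner W _ _) _ => //; rewrite nm_iter //.
apply: (@le_trans _ _ (nm f * (e / (nm f + 1)))).
  by rewrite ler_wpM2l ?nm_ge0 ?HN.
rewrite mulrA ler_pdivrMr // mulrC; apply: ler_wpM2l; first exact: ltW.
by rewrite lerDl.
Qed.

Definition bdd (F : V -> V) (K : R) := 0 <= K /\ forall f, l2 f -> l2 (F f) /\ nm (F f) <= K * nm f.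

Lemma bdd_pact (A : comNzRingType) (sc : A -> V -> V) (p : {poly A}) :
  (forall a, exists K, bdd (sc a) K) -> exists K, bdd (pact sc T p) K.
Proof.
move=> H; pose K i := sval (cid (H p`_i)).
have HK i : bdd (sc p`_i) (K i) by rewrite /K; case: cid.
have l2s i f : l2 f -> l2 (iter i T (sc p`_i f)).
  by move=> hf; apply: l2_iter; apply: ((HK i).2 _ hf).1.
exists (\sum_(i < size p) K i); split; first by apply: sumr_ge0 => i _; apply: (HK i).1.
move=> f hf; split; first by apply: l2_sum => // i _; apply: l2s.
apply: le_trans (nm_sum W _ _ _) _; first by move=> i; apply: l2s.
rewrite mulr_suml; apply: ler_sum => i _; rewrite nm_iter; last exact: ((HK i).2 _ hf).1.
exact: ((HK i).2 _ hf).2.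
Qed.

End Generic.

Definition Bz (f : nat -> C) : nat -> C := fun k => f k.+1.
Definition Bz1 (f : nat * nat -> C) : nat * nat -> C := fun x => f (x.1.+1, x.2).
Definition Bz2 (f : nat * nat -> C) : nat * nat -> C := fun x => f (x.1, x.2.+1).

Lemma iter_Mz n f k : iter n (@Mz R) f k = if (n <= k)%N then f (k - n)%N else 0.
Proof.
elim: n k => [|n IH] k /=; first by rewrite subn0.
by case: k => [|k] //=; rewrite IH ltnS subSS.
Qed.

Lemma iter_Mz1 n f x : iter n (@Mz1 R) f x = if (n <= x.1)%N then f ((x.1 - n)%N, x.2) else 0.
Proof.
elim: n x => [|n IH] [k l] /=; first by rewrite subn0.
by case: k => [|k] //=; rewrite /Mz1 /= IH ltnS subSS.
Qed.

Lemma iter_Mz2 n f x : iter n (@Mz2 R) f x = if (n <= x.2)%N then f (x.1, (x.2 - n)%N) else 0.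
Proof.
elim: n x => [|n IH] [k l] /=; first by rewrite subn0.
by case: l => [|l] //=; rewrite /Mz2 /= IH ltnS subSS.
Qed.

Lemma iter_Bz n f k : iter n Bz f k = f (k + n)%N.
Proof. by elim: n k => [|n IH] k /=; rewrite ?addn0 // /Bz IH addSnnS. Qed.

Lemma iter_Bz1 n f x : iter n Bz1 f x = f ((x.1 + n)%N, x.2).
Proof. by elim: n x => [|n IH] [k l] /=; rewrite ?addn0 // /Bz1 IH /= addSnnS. Qed.

Lemma iter_Bz2 n f x : iter n Bz2 f x = f (x.1, (x.2 + n)%N).
Proof. by elim: n x => [|n IH] [k l] /=; rewrite ?addn0 // /Bz2 IH /= addSnnS. Qed.

Lemma shift_Mz : is_shift win1 (@Mz R) Bz.
Proof.
split=> //.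
- by move=> f g; apply/funext => -[|k]; rewrite !fctE //= addr0.
- by move=> c f; apply/funext => -[|k] //=; rewrite !fctE /= scaler0.
- move=> f [|N]; first by rewrite /nS !big_nil.
  rewrite /nS !big_win1 big_ord_recl nsq0 add0r [X in _ <= X]big_ord_recr /=.
  by rewrite lerDl nsq_ge0.
- by move=> f N; rewrite /nS !big_win1 [X in _ <= X]big_ord_recl nsq0 add0r.
- by move=> f N; rewrite /nS !big_win1 [X in _ <= X]big_ord_recl lerDr nsq_ge0.
- by move=> f g [|k]; rewrite !fctE /= ?mul0r // subrr rmorph0 mulr0.
- move=> f x N n Nn; rewrite mem_iota add0n => /andP[_ xN]; rewrite iter_Mz leqNgt.
  by rewrite (leq_trans xN Nn).
Qed.

Lemma shift_Mz1 : is_shift win2 (@Mz1 R) Bz1.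
Proof.
split=> //.
- by move=> f g; apply/funext => -[[|k] l]; rewrite !fctE /Mz1 //= addr0.
- by move=> c f; apply/funext => -[[|k] l] //=; rewrite !fctE /Mz1 /= scaler0.
- move=> f [|N]; first by rewrite /nS !big_win2 !big_ord0.
  rewrite /nS !big_win2 big_ord_recl big1 ?add0r; last by move=> i _; rewrite /Mz1 /= nsq0.
  rewrite [X in _ <= X]big_ord_recr /= lerDl; apply: sumr_ge0 => *; exact: nsq_ge0.
- move=> f N; rewrite /nS !big_win2 [X in _ <= X]big_ord_recl /= [X in _ <= X + _]big1 ?add0r; last by move=> i _; rewrite /Mz1 /= nsq0.
  by apply: ler_sum => i _; rewrite big_ord_recr /= lerDl nsq_ge0.
- move=> f N; rewrite /nS !big_win2 [X in _ <= X]big_ord_recl /= ler_wpDl //.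
    by apply: sumr_ge0 => *; apply: nsq_ge0.
  by apply: ler_sum => i _; rewrite big_ord_recr /= lerDl nsq_ge0.
- by move=> f g [[|k] l]; rewrite !fctE /Mz1 /= ?mul0r // subrr rmorph0 mulr0.
- move=> f x N n Nn; rewrite mem_win2 => /andP[xN _]; rewrite iter_Mz1 leqNgt.
  by rewrite (leq_trans xN Nn).
Qed.

Lemma shift_Mz2 : is_shift win2 (@Mz2 R) Bz2.
Proof.
split=> //.
- by move=> f g; apply/funext => -[k [|l]]; rewrite !fctE /Mz2 //= addr0.
- by move=> c f; apply/funext => -[k [|l]] //=; rewrite !fctE /Mz2 /= scaler0.
- move=> f [|N]; first by rewrite /nS !big_win2 !big_ord0.
  rewrite /nS !big_win2; apply: ler_sum => i _; rewrite big_ord_recl nsq0 add0r.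
  by rewrite [X in _ <= X]big_ord_recr /= lerDl nsq_ge0.
- move=> f N; rewrite /nS !big_win2 [X in _ <= X]big_ord_recr /= ler_wpDr //.
    by apply: sumr_ge0 => *; apply: nsq_ge0.
  by apply: ler_sum => i _; rewrite big_ord_recl nsq0 add0r.
- move=> f N; rewrite /nS !big_win2 [X in _ <= X]big_ord_recr /= ler_wpDr //.
    by apply: sumr_ge0 => *; apply: nsq_ge0.
  by apply: ler_sum => i _; rewrite [X in _ <= X]big_ord_recl lerDr nsq_ge0.
- by move=> f g [k [|l]]; rewrite !fctE /Mz2 /= ?mul0r // subrr rmorph0 mulr0.
- move=> f x N n Nn; rewrite mem_win2 => /andP[_ xN]; rewrite iter_Mz2 leqNgt.
  by rewrite (leq_trans xN Nn).
Qed.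

Definition scal1 (I : Type) (c : C) (f : I -> C) : I -> C := c *: f.

Lemma scal1_action (I : Type) : is_action (@scal1 I).
Proof.
split; rewrite /scal1.
- by move=> a b f; rewrite scalerDl.
- by move=> a f g; rewrite scalerDr.
- by move=> a b f; rewrite scalerA.
- by move=> f; rewrite scale1r.
Qed.

Lemma bdd_scal1 (I : eqType) (win : nat -> seq I) c : exhausting win ->
  exists K, bdd win (scal1 c) K.
Proof.
move=> W; exists (cabs c); split; first exact: cabs_ge0.
by move=> f hf; split; [apply: l2Z|rewrite /scal1 nmZ].
Qed.

Definition acts1 : {poly C} -> (nat -> C) -> nat -> C := pact (@scal1 nat) (@Mz R).
Definition acts21 : {poly C} -> (nat * nat -> C) -> nat * nat -> C :=
  pact (@scal1 (nat * nat)%type) (@Mz1 R).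
Definition acts2 : {poly {poly C}} -> (nat * nat -> C) -> nat * nat -> C :=
  pact acts21 (@Mz2 R).

Lemma acts1_action : is_action acts1.
Proof. by apply: pact_action; [exact: scal1_action|exact: (shD shift_Mz)|exact: (shZ shift_Mz)]. Qed.

Lemma acts21_action : is_action acts21.
Proof. by apply: pact_action; [exact: scal1_action|exact: (shD shift_Mz1)|exact: (shZ shift_Mz1)]. Qed.

Lemma Mz12C f : @Mz2 R (Mz1 f) = Mz1 (Mz2 f).
Proof. by apply/funext => -[[|k] [|l]]. Qed.

Lemma acts21_Mz2 q f : @Mz2 R (acts21 q f) = acts21 q (Mz2 f).
Proof.
apply: pact_comm; [exact: (shD shift_Mz2)|exact: (shZ shift_Mz2)|exact: Mz12C].
Qed.

Lemma acts2_action : is_action acts2.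
Proof. by apply: pact_action; [exact: acts21_action|exact: (shD shift_Mz2)|exact: acts21_Mz2]. Qed.

Lemma conv1E q f : conv1 q f = acts1 q f.
Proof.
apply/funext => k; rewrite /conv1 /acts1 /pact fct_sumE; apply: eq_bigr => i _.
by rewrite iter_Mz; case: ifP => //; rewrite mulr0.
Qed.

Lemma conv2E p f : conv2 p f = acts2 p f.
Proof.
apply/funext => -[k l]; rewrite /conv2 /acts2 /pact fct_sumE; apply: eq_bigr => j _.
rewrite iter_Mz2 /=; case: leqP => jl; last first.
  by rewrite big1 // => i _; rewrite andbF mulr0.
rewrite /acts21 /pact fct_sumE; apply: eq_bigr => i _; rewrite iter_Mz1 andbT /=.
by case: ifP => //; rewrite mulr0.
Qed.

Lemma bdd_acts1 q : exists K, bdd win1 (acts1 q) K.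
Proof.
apply: (bdd_pact exhausting_win1 shift_Mz) => a; exact: (bdd_scal1 _ exhausting_win1).
Qed.

Lemma bdd_acts2 p : exists K, bdd win2 (acts2 p) K.
Proof.
apply: (bdd_pact exhausting_win2 shift_Mz2) => a.
apply: (bdd_pact exhausting_win2 shift_Mz1) => b; exact: (bdd_scal1 _ exhausting_win2).
Qed.

End Shifts.

(** * Polynomials without zeros in the disk *)



Section OneVariable.
Variable R : realType.
Local Notation C := R[i].
Implicit Types (q v u : {poly C}) (b z tau : C).

Definition refl1 m q : {poly C} := \poly_(i < m.+1) (q`_(m - i))^*.

Lemma size_refl1 m q : (size (refl1 m q) <= m.+1)%N.
Proof. exact: size_poly. Qed.

(** The reflection is taken at a formal degree, so a factor can be peeled off even when [b = 0] and
    the true degree does not drop. *)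
Lemma refl1_step m b q : (size q <= m.+1)%N ->
  refl1 m.+1 ((1 - b *: 'X) * q) = ('X - (b^*)%:P) * refl1 m q.
Proof.
move=> sq; apply/polyP => i; rewrite coef_poly.
rewrite mulrBl mul1r -scalerAl [in LHS]coefB coefZ coefXM [in RHS]mulrBl coefB coefXM coefCM.
rewrite !coef_poly; case: i => [|i] /=.
  by rewrite !subn0 /= (nth_default 0 sq) !sub0r rmorphN rmorphM.
rewrite !ltnS subSS; case: ltngtP => im.
- have -> : (m - i == 0)%N = false by apply/negbTE; rewrite subn_eq0 -ltnNge.
  by rewrite rmorphB rmorphM /= subnS.
- by rewrite mulr0 subrr.
- by rewrite im subnn /= mulr0 mulr0 !subr0.
Qed.

Lemma nsqE z : nsq z = Re z ^+ 2 + Im z ^+ 2.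
Proof. by case: z => a c; rewrite /nsq /cabs /= sqr_sqrtr // addr_ge0 ?sqr_ge0. Qed.

(** Window version of the equality of [|z - conj b|] and [|1 - b z|] on the circle: the two
    truncated sums differ exactly by the boundary term [(1 - |b|^2) |u_N|^2] of the last index
    [N]. *)
Lemma blaschke_window b u N : cabs b <= 1 ->
  \sum_(k < N) nsq (('X - (b^*)%:P) * u)`_k <= \sum_(k < N) nsq ((1 - b *: 'X) * u)`_k.
Proof.
move=> b1; have b2 : nsq b <= 1 by rewrite /nsq expr_le1 ?cabs_ge0.
have E k : (('X - (b^*)%:P) * u)`_k = (if k == 0%N then 0 else u`_k.-1) - b^* * u`_k.
  by rewrite mulrBl coefB coefXM coefCM.
have E' k : ((1 - b *: 'X) * u)`_k = u`_k - b * (if k == 0%N then 0 else u`_k.-1).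
  by rewrite mulrBl mul1r -scalerAl coefB coefZ coefXM.
case: N => [|N]; first by rewrite !big_ord0.
suff : \sum_(k < N.+1) nsq ((1 - b *: 'X) * u)`_k =
       \sum_(k < N.+1) nsq (('X - (b^*)%:P) * u)`_k + (1 - nsq b) * nsq u`_N.
  by move=> ->; rewrite lerDl mulr_ge0 ?nsq_ge0 // subr_ge0.
elim: N => [|N IH].
  by rewrite !big_ord1 E E' /= mulr0 subr0 sub0r nsqN nsqM nsq_conj; ring.
rewrite big_ord_recr IH [in RHS]big_ord_recr /= E E' /=.
suff -> : nsq (u`_N.+1 - b * u`_N) =
   nsq (u`_N - b^* * u`_N.+1) + (1 - nsq b) * (nsq u`_N.+1 - nsq u`_N) by ring.
case: b {b1 b2 E E' IH} => b1 b2; case: u`_N => x y; case: u`_N.+1 => s t.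
by rewrite !nsqE /=; ring.
Qed.

Definition nonvan q := forall z, cabs z < 1 -> q.[z] != 0.

(** A root [a] satisfies [|a| >= 1] and gives [b = 1/a]. If [q] has less than the full formal
    degree, [b = 0] lowers that degree for free. *)
Lemma nonvan_factor m q : nonvan q -> (size q <= m.+2)%N ->
  exists b q', [/\ cabs b <= 1, nonvan q', (size q' <= m.+1)%N & q = (1 - b *: 'X) * q'].
Proof.
move=> nq; rewrite leq_eqVlt => /orP[/eqP sq|sq]; last first.
  by exists 0, q; split; rewrite ?cabs0 // scale0r subr0 mul1r.
have /closed_rootP [a ra] : size q != 1 by rewrite sq.
have a1 : 1 <= cabs a by rewrite leNgt; apply/negP => /nq; rewrite -rootE ra.
have a0 : a != 0 by rewrite -cabs_eq0 gt_eqF // (lt_le_trans ltr01).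
have /factor_theorem [q1 Eq] := ra.
have q10 : q1 != 0 by apply/eqP => q10; move: sq; rewrite Eq q10 mul0r size_poly0.
have E : q = (1 - a^-1 *: 'X) * ((- a) *: q1).
  rewrite Eq -scalerAr scalerAl [RHS]mulrC; congr (_ * _).
  by rewrite scalerBr scalerA mulNr divff // !scaleNr scale1r opprK alg_polyC addrC.
exists a^-1, ((- a) *: q1); split => //.
- by rewrite cabsV invf_le1 // (lt_le_trans ltr01).
- by move=> z /nq; rewrite E hornerM mulf_eq0 negb_or => /andP[].
- rewrite size_scale ?oppr_eq0 //; move: sq; rewrite Eq size_Mmonic ?monicXsubC //.
  by rewrite size_XsubC addn2 /= => -[->].
Qed.

(** The finite Blaschke product formed by the reflection over [q] is contractive on every window,
    one linear factor at a time. *)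
Lemma nonvan_window m q v N : nonvan q -> (size q <= m.+1)%N ->
  \sum_(k < N) nsq (refl1 m q * v)`_k <= \sum_(k < N) nsq (q * v)`_k.
Proof.
elim: m q v => [|m IH] q v nq sq.
  rewrite (size1_polyC sq); set c := q`_0.
  have -> : refl1 0 c%:P = (c^*)%:P.
    by apply/polyP => i; rewrite coef_poly !coefC; case: i.
  by apply: ler_sum => k _; rewrite !coefCM !nsqM nsq_conj.
have [b [q' [b1 nq' sq' ->]]] := nonvan_factor nq sq.
rewrite refl1_step // -mulrA; apply: le_trans (blaschke_window _ _ b1) _.
by rewrite mulrCA -mulrA [X in _ <= X](eq_bigr (fun k : 'I_N => nsq (q' * ((1 - b *: 'X) * v))`_k)) ?IH // => k _; rewrite mulrCA.
Qed.

(** Each factor [1 - b z] with [|b| <= 1] at most doubles a bound on the coefficients. Unlike the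
    absence of zeros, this inequality survives limits of polynomials; together with [nonvan_lower]
    it replaces Hurwitz's theorem. *)
Lemma nonvan_coef m q i : nonvan q -> (size q <= m.+1)%N -> cabs q`_i <= 2 ^+ m * cabs q`_0.
Proof.
elim: m q i => [|m IH] q i nq sq.
  rewrite (size1_polyC sq) mul1r !coefC /=; case: eqP => // _.
  by rewrite cabs0 cabs_ge0.
have [b [q' [b1 nq' sq' ->]]] := nonvan_factor nq sq.
rewrite mulrBl mul1r -scalerAl !coefB !coefZ !coefXM /= mulr0 subr0.
apply: le_trans (cabsB _ _) _; rewrite exprS.
have h1 := IH _ i nq' sq'; have h2 := IH _ i.-1 nq' sq'.
have h3 : cabs (b * (if i == 0%N then 0 else q'`_i.-1)) <= 2 ^+ m * cabs q'`_0.
  rewrite cabsM; case: eqP => _; first by rewrite cabs0 mulr0 mulr_ge0 ?exprn_ge0 ?cabs_ge0.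
  by apply: le_trans h2; rewrite ler_piMl ?cabs_ge0.
by rewrite -mulrA; lra.
Qed.

Lemma nonvan_lower m q z : nonvan q -> (size q <= m.+1)%N -> cabs z < 1 ->
  cabs q`_0 * (1 - cabs z) ^+ m <= cabs q.[z].
Proof.
move=> + + z1; elim: m q => [|m IH] q nq sq.
  by rewrite (size1_polyC sq) mulr1 hornerC coefC.
have [b [q' [b1 nq' sq' ->]]] := nonvan_factor nq sq.
have -> : ((1 - b *: 'X) * q')`_0 = q'`_0.
  by rewrite mulrBl mul1r -scalerAl coefB coefZ coefXM /= mulr0 subr0.
have -> : ((1 - b *: 'X) * q').[z] = (1 - b * z) * q'.[z] by rewrite hornerM !hornerE.
have h := IH _ nq' sq'; rewrite exprS mulrCA cabsM; apply: ler_pM => //; rewrite ?mulr_ge0 ?exprn_ge0 ?subr_ge0 ?cabs_ge0 ?(ltW z1) //.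
have := cabsD (1 - b * z) (b * z); rewrite subrK cabs1 cabsM.
have : cabs b * cabs z <= cabs z by rewrite ler_piMl ?cabs_ge0.
lra.
Qed.

End OneVariable.

(** * Slices of a bivariate polynomial at points of the circle *)

Section Slices.
Variable R : realType.
Local Notation C := R[i].
Implicit Types (p : {poly {poly C}}) (v : {poly C}) (tau z : C).

Lemma sliceE p tau : slice p tau = p.[tau%:P].
Proof.
rewrite /slice horner_coef; apply: eq_bigr => j _.
by rewrite -polyC_exp mulrC mul_polyC.
Qed.

Lemma eval2E p z tau : eval2 p z tau = (slice p tau).[z].
Proof.
rewrite /eval2 /slice horner_sum; apply: eq_bigr => j _.
by rewrite hornerZ mulrC.
Qed.

Lemma coef_slice p tau i n : (size p <= n)%N -> (slice p tau)`_i = \sum_(j < n) tau ^+ j * p`_j`_i.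
Proof.
move=> pn; rewrite sliceE (horner_coef_wide _ pn) coef_sum; apply: eq_bigr => j _.
by rewrite -polyC_exp mulrC coefCM.
Qed.

Lemma size_slice m n p tau : deg_le m n p -> (size (slice p tau) <= m.+1)%N.
Proof.
move=> [_ h]; apply: leq_trans (size_sum _ _ _) _; apply/bigmax_leqP => j _.
by apply: leq_trans (size_scale_leq _ _) (h j).
Qed.

Lemma conj_unit tau : cabs tau = 1 -> tau * tau^* = 1.
Proof. by move=> h; rewrite mulr_conj /nsq h expr1n. Qed.

Lemma coef_refl m n p i j : (refl m n p)`_j`_i =
  if (j <= n)%N && (i <= m)%N then (p`_(n - j)`_(m - i))^* else 0.
Proof.
by rewrite /refl coef_poly ltnS; case: leqP => //= _; rewrite ?coef0 // coef_poly ltnS.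
Qed.

Lemma slice_refl m n p tau : deg_le m n p -> cabs tau = 1 ->
  slice (refl m n p) tau = tau ^+ n *: refl1 m (slice p tau).
Proof.
move=> [sp _] t1; apply/polyP => i; rewrite coefZ coef_poly ltnS.
rewrite (@coef_slice _ _ _ n.+1); last exact: size_poly.
case: leqP => im; last first.
  by rewrite mulr0 big1 // => j _; rewrite coef_refl [(i <= m)%N]leqNgt im andbF mulr0.
rewrite (coef_slice _ _ sp) rmorph_sum mulr_sumr (reindex_inj rev_ord_inj) /=.
apply: eq_bigr => j _; have jn : (j <= n)%N by rewrite -ltnS.
rewrite coef_refl im subSS leq_subr /= subKn // rmorphM rmorphXn /= mulrA; congr (_ * _).
have -> : tau ^+ n = tau ^+ (n - j) * tau ^+ j by rewrite -exprD subnK.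
by rewrite -mulrA -exprMn conj_unit // expr1n mulr1.
Qed.

Section Boundary.
Variables (m n : nat) (p : {poly {poly C}}) (tau : C).
Hypotheses (degp : deg_le m n p) (nz : no_zeros_bidisk p) (t1 : cabs tau = 1).

(** Radial approach to [tau] through the open disk, where the slices of [p] have no zeros in the
    disk. The statements at the boundary are limits along [rho]. *)
Let rho k : C := ((1 - iv R k)%:C)%C * tau.

Let cabs_rho k : cabs (rho k) < 1.
Proof.
rewrite cabsM t1 mulr1 cabs_real; have := iv_gt0 R k; have := iv_mono R (leq0n k).
by rewrite [iv R 0]invr1 ltr_norml; lra.
Qed.

Let cvg_rho : cvgC rho tau.
Proof.
apply/cvgCE => e e0; have e2 : 0 < e / 2 by rewrite divr_gt0.
have [N HN] := iv_small e2; exists N => k /HN h; have := iv_gt0 R k.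
rewrite (_ : _ - _ = ((- iv R k)%:C)%C * tau); last by rewrite /rho rmorphB rmorphN rmorph1 /=; ring.
rewrite cabsM t1 mulr1 cabs_real normrN => h0; rewrite gtr0_norm //; lra.
Qed.

Let nonvan_rho k : nonvan (slice p (rho k)).
Proof.
by move=> z z1; rewrite -eval2E; apply: nz; rewrite /open_disk norm_cabs -[1]/((1%:C)%C) ltcR.
Qed.

Let cvg_coef i : cvgC (fun k => (slice p (rho k))`_i) (slice p tau)`_i.
Proof.
rewrite (coef_slice _ _ (leqnn (size p))).
under eq_fun do rewrite (coef_slice _ _ (leqnn (size p))).
apply: cvgC_sum => j; apply: cvgCM; last exact: cvgC_cst.
by apply: cvgCX; apply: cvg_rho.
Qed.

Lemma boundary_window v N :
  \sum_(k < N) nsq (refl1 m (slice p tau) * v)`_k <= \sum_(k < N) nsq (slice p tau * v)`_k.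
Proof.
have nsq_cvg (q : nat -> {poly C}) (q0 : {poly C}) : (forall i, cvgC (fun k => (q k)`_i) q0`_i) ->
  cvgC (fun k => ((\sum_(j < N) nsq (q k * v)`_j)%:C)%C) ((\sum_(j < N) nsq (q0 * v)`_j)%:C)%C.
  move=> H; rewrite rmorph_sum /=; under eq_fun do rewrite rmorph_sum.
  apply: cvgC_sum => j.
  have h : cvgC (fun k => (q k * v)`_j) (q0 * v)`_j.
    rewrite coefM; under eq_fun do rewrite coefM.
    by apply: cvgC_sum => i; apply: cvgCM => //; apply: cvgC_cst.
  have := cvgCM h (cvgC_conj h); rewrite mulr_conj; congr cvgC.
  by apply/funext => k; rewrite mulr_conj.
have h1 := nsq_cvg _ _ cvg_coef.
have h2 : cvgC (fun k => ((\sum_(j < N) nsq (refl1 m (slice p (rho k)) * v)`_j)%:C)%C)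
     ((\sum_(j < N) nsq (refl1 m (slice p tau) * v)`_j)%:C)%C.
  apply: nsq_cvg => i; rewrite coef_poly; under eq_fun do rewrite coef_poly.
  by case: ifP => _; [apply: cvgC_conj|apply: cvgC_cst].
apply: (cvgC_real_le h2 h1) => k; apply: nonvan_window => //.
exact: size_slice degp.
Qed.

Lemma boundary_coef i : cabs (slice p tau)`_i <= 2 ^+ m * cabs (slice p tau)`_0.
Proof.
apply: eps_le => e e0.
have e1 : 0 < e / (2 ^+ m + 1) by rewrite divr_gt0 // ltr_wpDl ?exprn_ge0.
have [N HN] := (cvgCE _ _).1 (cvg_coef i) _ e1.
have [N' HN'] := (cvgCE _ _).1 (cvg_coef 0%N) _ e1.
have := HN _ (leq_maxl N N'); have := HN' _ (leq_maxr N N'); set k := maxn _ _ => h1 h2.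
have h3 := nonvan_coef i (@nonvan_rho k) (size_slice _ degp).
set d := e / _ in e1 h1 h2; have Ed : e = d * 2 ^+ m + d.
  by rewrite -[X in _ + X]mulr1 -mulrDr divfK // gt_eqF // ltr_wpDl ?exprn_ge0.
rewrite Ed; set a := (slice p tau)`_i in h2 *; set a0 := (slice p tau)`_0 in h1 *.
have h4 : cabs a <= cabs (slice p (rho k))`_i + d.
  rewrite -(subrK (slice p (rho k))`_i a) addrC; apply: le_trans (cabsD _ _) _.
  by rewrite lerD2l cabs_distC ltW.
have h5 : cabs (slice p (rho k))`_0 <= cabs a0 + d.
  rewrite -(subrK a0 (slice p (rho k))`_0) addrC; apply: le_trans (cabsD _ _) _.
  by rewrite lerD2l ltW.
have h6 : 2 ^+ m * cabs (slice p (rho k))`_0 <= 2 ^+ m * (cabs a0 + d).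
  by rewrite ler_wpM2l ?exprn_ge0.
rewrite mulrDr [2 ^+ m * d]mulrC in h6; lra.
Qed.

Lemma boundary_lower z : cabs z < 1 ->
  cabs (slice p tau)`_0 * (1 - cabs z) ^+ m <= cabs (slice p tau).[z].
Proof.
move=> z1; have cv : cvgC (fun k => (slice p (rho k)).[z]) (slice p tau).[z].
  rewrite (horner_coef_wide _ (size_slice _ degp)).
  under eq_fun do rewrite (horner_coef_wide _ (size_slice _ degp)).
  by apply: cvgC_sum => j; apply: cvgCM => //; apply: cvgC_cst.
set t := (1 - cabs z) ^+ m.
have t0 : 0 <= t by rewrite exprn_ge0 // subr_ge0 ltW.
have tl : t <= 1 by rewrite exprn_ile1 ?subr_ge0 ?(ltW z1) // lerBlDr lerDl cabs_ge0.
apply: eps_le => e e0; have e1 : 0 < e / 2 by rewrite divr_gt0.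
have [N HN] := (cvgCE _ _).1 cv _ e1.
have [N' HN'] := (cvgCE _ _).1 (cvg_coef 0%N) _ e1.
have := HN _ (leq_maxl N N'); have := HN' _ (leq_maxr N N'); set k := maxn _ _ => h1 h2.
have h3 := nonvan_lower (@nonvan_rho k) (size_slice _ degp) z1.
rewrite -/t in h3.
set a := (slice p tau).[z] in h2 *; set a0 := (slice p tau)`_0 in h1 *.
have h4 : cabs (slice p (rho k)).[z] <= cabs a + e / 2.
  rewrite -(subrK a (slice p (rho k)).[z]) addrC; apply: le_trans (cabsD _ _) _.
  by rewrite lerD2l ltW.
have h5 : cabs a0 <= cabs (slice p (rho k))`_0 + e / 2.
  rewrite -(subrK (slice p (rho k))`_0 a0) addrC; apply: le_trans (cabsD _ _) _.
  by rewrite lerD2l cabs_distC ltW.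
have h6 : cabs a0 * t <= (cabs (slice p (rho k))`_0 + e / 2) * t by rewrite ler_wpM2r.
have h7 : e / 2 * t <= e / 2 by rewrite ler_piMr // ltW.
rewrite mulrDl in h6; lra.
Qed.

Lemma boundary_eq0 : (slice p tau)`_0 = 0 -> slice p tau = 0.
Proof.
move=> h; apply/polyP => i; rewrite coef0; apply/eqP; rewrite -cabs_eq0 eq_le cabs_ge0 andbT.
by apply: le_trans (boundary_coef i) _; rewrite h cabs0 mulr0.
Qed.

End Boundary.
End Slices.

(** * Elimination of the first variable *)



Lemma comb01 (A : nzRingType) (x y : A) : 0 * x + 1 * y = y.
Proof. by rewrite mul0r add0r mul1r. Qed.

Section GaussLemma.
Variable C : closedFieldType.
Implicit Types (d x y P Q : {poly {poly C}}) (a c : {poly C}) (al : C).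

Local Notation evc al := (map_poly (horner_eval al)).

Lemma dvd_linear x al : evc al x = 0 -> exists x', x = ('X - al%:P)%:P * x'.
Proof.
move=> H; exists (map_poly (fun a => a %/ ('X - al%:P)) x); apply/polyP => i.
rewrite coefCM coef_map_id0 ?div0p // mulrC divpK // dvdp_XsubCl rootE.
by have := congr1 (fun q : {poly C} => q`_i) H; rewrite coef_map coef0 /= horner_evalE => ->.
Qed.

(** Over an algebraically closed field a content without roots is constant, so primitivity reads: no
    specialisation of the coefficients kills the polynomial. Linear contents are removed by
    induction on the degree of the leading coefficient. *)
Lemma primitive_part d : d != 0 ->
  exists c d', [/\ c != 0, d = c%:P * d' & forall al, evc al d' != 0].
Proof.
have [k] := ubnP (size (lead_coef d)); elim: k d => // k IH d sd d0.
have [H|/existsNP [al /negP]] := pselect (forall al, evc al d != 0).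
  by exists 1, d; split; rewrite ?oner_eq0 // mul1r.
rewrite negbK => /eqP /dvd_linear [d1 Ed].
have X0 : ('X - al%:P) != 0 :> {poly C} by rewrite polyXsubC_eq0.
have d10 : d1 != 0 by apply: contraNneq d0 => d10; rewrite Ed d10 mulr0.
have [|c [d' [c0 Ed' Hd']]] := IH d1 _ d10.
  move: sd; rewrite Ed lead_coefM lead_coefC.
  by rewrite mulrC size_Mmonic ?monicXsubC ?lead_coef_eq0 // size_XsubC addn2 /= ltnS.
exists (('X - al%:P) * c), d'; split; rewrite ?mulf_neq0 //.
by rewrite Ed Ed' mulrA polyCM.
Qed.

(** Gauss's lemma: at a root [al] of [a] the product [d x] specialises to 0 in a domain while [d]
    does not, so the linear factor divides [x] and cancels. It turns divisibility up to a
    coefficient polynomial into genuine divisibility. *)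
Lemma gauss_dvd d a P x : (forall al, evc al d != 0) -> a != 0 -> a%:P * P = d * x ->
  exists x', P = d * x'.
Proof.
move=> dp; have [k] := ubnP (size a); elim: k a x => // k IH a x sa a0 E.
have [s1|/closed_rootP [al /factor_theorem [a' Ea]]] := eqVneq (size a) 1%N.
  have /size_poly1P [c c0 Ea] : size a == 1%N by rewrite s1.
  exists ((c^-1%:P)%:P * x); rewrite mulrCA -E Ea mulrA -!polyCM mulVf // !polyC1 mul1r //.
have X0 : ('X - al%:P) != 0 :> {poly C} by rewrite polyXsubC_eq0.
have a'0 : a' != 0 by apply: contraNneq a0 => h; rewrite Ea h mul0r.
have : evc al (a%:P * P) = evc al (d * x) by rewrite E.
have := dp al; move=> dpa; rewrite !rmorphM /= map_polyC /= horner_evalE Ea hornerM !hornerE subrr mulr0.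
rewrite polyC0 mul0r => /esym /eqP; rewrite mulf_eq0 (negbTE dpa) /= => /eqP /dvd_linear [x1 Ex].
apply: (IH a' x1) => //.
  move: sa; rewrite Ea size_Mmonic ?monicXsubC // size_XsubC addn2 /= => h.
  by rewrite -ltnS.
have X1 : ('X - al%:P)%:P != 0 :> {poly {poly C}} by rewrite polyC_eq0.
by apply: (mulfI X1); rewrite [RHS]mulrCA -Ex -E Ea polyCM mulrA; congr (_ * P); rewrite mulrC.
Qed.

End GaussLemma.

Section Elimination.
Variable R : realType.
Local Notation C := R[i].
Implicit Types (tau z : C).

Lemma refl1_horner m (q : {poly C}) z : (size q <= m.+1)%N -> z != 0 ->
  (refl1 m q).[z] = z ^+ m * (q.[(z^*)^-1])^*.
Proof.
move=> sq z0; rewrite (horner_coef_wide _ sq) horner_poly rmorph_sum mulr_sumr.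
rewrite (reindex_inj rev_ord_inj); apply: eq_bigr => i _ /=.
have im : (i <= m)%N by rewrite -ltnS.
rewrite subSS subKn // rmorphM rmorphXn /= fmorphV /= conjCK mulrCA; congr (_ * _).
have -> : z ^+ m = z ^+ (m - i) * z ^+ i by rewrite -exprD subnK.
by rewrite -mulrA -exprMn divff // expr1n mulr1.
Qed.

Section Bivariate.
Variables (m n : nat) (p : {poly {poly C}}).
Hypotheses (degp : deg_le m n p) (nz : no_zeros_bidisk p) (cop : coprime2 (refl m n p) p).

(** A vanishing constant term would annihilate the whole slice by [boundary_eq0]; then [z2 - tau]
    would divide both [p] and its reflection, against coprimality. *)
Lemma boundary_const tau : cabs tau = 1 -> (slice p tau)`_0 != 0.
Proof.
move=> t1; apply/eqP => h0; have s0 := boundary_eq0 degp nz t1 h0.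
have [r1 E1] : exists r, p = r * ('X - (tau%:P)%:P).
  by apply/factor_theorem; rewrite rootE -sliceE s0.
have [r2 E2] : exists r, refl m n p = r * ('X - (tau%:P)%:P).
  apply/factor_theorem; rewrite rootE -sliceE slice_refl // s0.
  by rewrite (_ : refl1 m 0 = 0) ?scaler0 //; apply/polyP => i; rewrite coef_poly !coef0 rmorph0 if_same.
have [] := cop (d := 'X - (tau%:P)%:P).
- by exists r2; rewrite mulrC.
- by exists r1; rewrite mulrC.
- by move=> c /(congr1 (fun q : {poly {poly C}} => size q)); rewrite size_XsubC size_polyC; case: eqP.
Qed.

Lemma p00 : p`_0`_0 != 0.
Proof.
have := nz (z1 := 0) (z2 := 0); rewrite /open_disk normr0 eval2E sliceE => /(_ ltr01 ltr01).
by rewrite polyC0 !horner_coef0.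
Qed.

Lemma boundary_nonvan tau z : cabs tau = 1 -> cabs z < 1 -> (slice p tau).[z] != 0.
Proof.
move=> t1 z1; have := boundary_lower degp nz t1 z1; apply: contraTneq => ->.
rewrite cabs0 -ltNge mulr_gt0 ?exprn_gt0 ?subr_gt0 //.
by rewrite lt_def cabs_eq0 cabs_ge0 andbT boundary_const.
Qed.

Let P := swapXY p.
Let Q := swapXY (refl m n p).
(** The degree of [p] in z1 may drop, at some [tau] or altogether, whereas that of the reflection is
    exactly [m], also on slices over the circle. Adding [z1 p~] gives a polynomial of exact degree
    [m + 1] with the leading coefficient of [Q], generating the same ideal with [Q], so the
    resultant commutes with slicing. *)
Let Q2 := P + 'X * Q.

Let Qcoef i j : Q`_i`_j = if (j <= n)%N && (i <= m)%N then (p`_(n - j)`_(m - i))^* else 0.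
Proof. by rewrite coef_swapXY coef_refl. Qed.

Let Qm0 : Q`_m != 0.
Proof.
apply/eqP => h; have := Qcoef m n; rewrite h coef0 !leqnn !subnn /= => /esym /eqP.
by rewrite conjC_eq0 (negbTE p00).
Qed.

Let sizeQ : size Q = m.+1.
Proof.
apply/eqP; rewrite eqn_leq; apply/andP; split.
  apply/leq_sizeP => i mi; apply/polyP => j; rewrite Qcoef coef0.
  by rewrite [(i <= m)%N]leqNgt mi andbF.
by rewrite ltnNge; apply/negP => /leq_sizeP /(_ m (leqnn m)) h; have := Qm0; rewrite h eqxx.
Qed.

Let leadQ : lead_coef Q = Q`_m. Proof. by rewrite lead_coefE sizeQ. Qed.

Let sizeP : (size P <= m.+1)%N.
Proof.
apply/leq_sizeP => i mi; apply/polyP => j; rewrite coef_swapXY coef0.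
by rewrite nth_default //; apply: leq_trans mi; apply: degp.2.
Qed.

Let Q0 : Q != 0. Proof. by rewrite -size_poly_eq0 sizeQ. Qed.

Let sizeXQ : size ('X * Q) = m.+2.
Proof. by rewrite mulrC size_mulX ?sizeQ. Qed.

Let sizeQ2 : size Q2 = m.+2.
Proof. by rewrite /Q2 addrC size_polyDl sizeXQ. Qed.

Let leadQ2 : lead_coef Q2 = Q`_m.
Proof. by rewrite /Q2 addrC lead_coefDl ?sizeXQ // lead_coefM lead_coefX mul1r leadQ. Qed.

Let mapQ tau : map_poly (horner_eval tau) Q = slice (refl m n p) tau.
Proof. by rewrite -horner_swapXY swapXYK sliceE. Qed.

Let mapQ2 tau : map_poly (horner_eval tau) Q2 = slice p tau + 'X * slice (refl m n p) tau.
Proof. by rewrite rmorphD rmorphM /= map_polyX mapQ -horner_swapXY swapXYK !sliceE. Qed.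

Let Qm_tau tau : cabs tau = 1 -> (Q`_m).[tau] != 0.
Proof.
move=> t1; have := congr1 (fun q : {poly C} => q`_m) (mapQ tau).
rewrite coef_map /= horner_evalE => ->; rewrite slice_refl // coefZ coef_poly leqnn subnn.
by rewrite mulf_neq0 ?expf_neq0 ?conjC_eq0 ?boundary_const // -cabs_eq0 t1 oner_eq0.
Qed.

Lemma refl_zero tau z : cabs tau = 1 -> cabs z = 1 -> (slice p tau).[z] = 0 ->
  (slice (refl m n p) tau).[z] = 0.
Proof.
move=> t1 z1 h; have z0 : z != 0 by rewrite -cabs_eq0 z1 oner_eq0.
rewrite slice_refl // hornerZ refl1_horner //; last exact: size_slice degp.
have -> : (z^*)^-1 = z.
  by apply: (mulfI (x := z^*)); rewrite ?conjC_eq0 // divff ?conjC_eq0 // mulrC conj_unit.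
by rewrite h rmorph0 !mulr0.
Qed.

(** The slice of [p] has no zero in the open disk, and a zero of the reflection outside the closed
    disk is mirrored to such a zero. A common zero must therefore lie on the circle. *)
Let common_zero tau z : cabs tau = 1 -> (slice (refl m n p) tau).[z] = 0 ->
  (slice p tau).[z] = 0 -> E_set p tau.
Proof.
move=> t1 h1 h2; have [zl|zg|z1] := ltgtP (cabs z) 1.
- by have := boundary_nonvan t1 zl; rewrite h2 eqxx.
- have z0 : z != 0 by rewrite -cabs_eq0 gt_eqF // (lt_trans ltr01).
  move: h1; rewrite slice_refl // hornerZ refl1_horner //; last exact: size_slice degp.
  move/eqP; rewrite !mulf_eq0 !expf_eq0 -cabs_eq0 t1 oner_eq0 andbF (negbTE z0) andbF /= conjC_eq0.
  have zl : cabs (z^*)^-1 < 1 by rewrite cabsV cabs_conj invf_lt1 // (lt_trans ltr01).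
  by rewrite (negbTE (boundary_nonvan t1 zl)).
- split; first by rewrite /unit_circle norm_cabs t1.
  by exists z; split; rewrite ?eval2E // /unit_circle norm_cabs z1.
Qed.

Lemma elimination : exists (r : {poly C}) (A B : {poly {poly C}}),
  [/\ r^:P = A * p + B * refl m n p, r != 0 &
      forall tau, cabs tau = 1 -> ~ E_set p tau -> r.[tau] != 0].
Proof.
(* For [m = 0] both reflection and [p] are polynomials in z2 alone, the resultant has positive
   degrees no longer, and the reflection itself serves as [r]. *)
case: (posnP m) => m0.
  exists (Q`_0), 0, 1; split.
  - have EQ : Q = (Q`_0)%:P by apply: size1_polyC; rewrite sizeQ m0.
    have Z : 0 * p + 1 * refl m n p = refl m n p by apply: comb01.
    apply: etrans (esym (swapXY_polyC _)) (etrans _ (esym Z)).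
    by rewrite -EQ swapXYK.
  - by rewrite -m0.
  - by move=> tau t1 _; rewrite -{1}m0; apply: Qm_tau.
have [||[u v] /= _ Er] := @resultant_in_ideal _ Q Q2; rewrite ?sizeQ ?sizeQ2 //.
exists (resultant Q Q2), (swapXY v), (swapXY (u + v * 'X)); split.
- have Ep : p = swapXY P by rewrite swapXYK.
  have Eq : refl m n p = swapXY Q by rewrite swapXYK.
  rewrite -swapXY_polyC Er [X in _ = _ * X + _]Ep [X in _ = _ + _ * X]Eq -!rmorphM -rmorphD.
  by congr swapXY; rewrite /Q2; ring.
(* A zero resultant means a common factor over the fraction field of the coefficients; its primitive
   part divides both polynomials in [C[z1,z2]]. *)
- rewrite resultant_eq0 -leqNgt leqNgt; apply/negP => sd.
  set d := Pdiv.Idomain.gcdp Q Q2 in sd.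
  have /Pdiv.Idomain.dvdpP [[a x] /= a0 Ea] : Pdiv.Idomain.dvdp d Q by apply: Pdiv.Idomain.dvdp_gcdl.
  have /Pdiv.Idomain.dvdpP [[b y] /= b0 Eb] : Pdiv.Idomain.dvdp d Q2 by apply: Pdiv.Idomain.dvdp_gcdr.
  have d0 : d != 0 by rewrite -size_poly_gt0 ltnW.
  have [c [d' [c0 Ed Hd]]] := primitive_part d0.
  have sd' : (1 < size d')%N by move: sd; rewrite Ed mul_polyC size_scale.
  have [x' Ex] : exists x', Q = d' * x'.
    apply: (gauss_dvd Hd a0 (x := x * c%:P)); rewrite mul_polyC Ea Ed; ring.
  have [y' Ey] : exists x', Q2 = d' * x'.
    apply: (gauss_dvd Hd b0 (x := y * c%:P)); rewrite mul_polyC Eb Ed; ring.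
  have EP : P = d' * (y' - 'X * x') by rewrite mulrBr mulrCA -Ex -Ey /Q2; ring.
  have [] := cop (d := swapXY d').
  + by exists (swapXY x'); rewrite -rmorphM -Ex /= swapXYK.
  + by exists (swapXY (y' - 'X * x')); rewrite -rmorphM -EP /= swapXYK.
  + move=> e He; move: sd'; rewrite -[d']swapXYK He swapXY_polyC map_polyC /= size_polyC.
    by case: eqP.
(* Both leading coefficients are nonzero at [tau], so the value of the resultant is the resultant of
   the slices, and its vanishing produces a common zero. *)
- move=> tau t1 nE; rewrite -horner_evalE map_resultant ?leadQ ?leadQ2 ?horner_evalE ?Qm_tau //.
  rewrite resultant_eq0 mapQ mapQ2; apply/negP => sd; apply: nE.
  have /closed_rootP [z] : size (gcdp (slice (refl m n p) tau) (slice p tau + 'X * slice (refl m n p) tau)) != 1%N.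
    by rewrite gtn_eqF.
  rewrite root_gcd => /andP[/eqP z1 /eqP]; rewrite hornerD hornerM z1 mulr0 addr0 => z2.
  exact: common_zero z1 z2.
Qed.

End Bivariate.
End Elimination.

(** * Formal division of power series *)



Section PowerSeries.
Variable R : realType.
Local Notation C := R[i].
Implicit Types (q s : {poly C}) (p X Y : {poly {poly C}}) (z b : C).

Lemma acts1E q f k : acts1 q f k = \sum_(i < k.+1) q`_i * f (k - i)%N :> C.
Proof.
rewrite -conv1E /conv1; set n := maxn (size q) k.+1.
rewrite (big_ord_widen n (fun i => q`_i * (if (i <= k)%N then f (k - i)%N else 0)) (leq_maxl _ _)).
rewrite (big_ord_widen n (fun i => q`_i * f (k - i)%N) (leq_maxr _ _)).
rewrite big_mkcond [RHS]big_mkcond; apply: eq_bigr => i _; rewrite ltnS.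
case: ltnP => h; case: leqP => //; rewrite ?mulr0 //.
by rewrite nth_default ?mul0r.
Qed.

Lemma acts2E p f k l : acts2 p f (k, l) =
  \sum_(j < l.+1) \sum_(i < k.+1) p`_j`_i * f ((k - i)%N, (l - j)%N) :> C.
Proof.
have E1 (q : {poly C}) g x : acts21 q g x = \sum_(i < x.1.+1) q`_i * g ((x.1 - i)%N, x.2).
  rewrite -(acts1E q (fun a => g (a, x.2))) /acts1 /acts21 /pact !fct_sumE.
  by apply: eq_bigr => i _; rewrite iter_Mz iter_Mz1.
rewrite /acts2 /pact fct_sumE; set n := maxn (size p) l.+1.
pose G j := if (j <= l)%N then acts21 p`_j f (k, (l - j)%N) else 0.
rewrite (eq_bigr (fun j : 'I_(size p) => G j)); last by move=> j _; rewrite iter_Mz2.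
rewrite (big_ord_widen n G (leq_maxl _ _)).
rewrite (big_ord_widen n (fun j => \sum_(i < k.+1) p`_j`_i * f ((k - i)%N, (l - j)%N)) (leq_maxr _ _)).
rewrite big_mkcond [RHS]big_mkcond; apply: eq_bigr => j _; rewrite ltnS /G.
case: (ltnP j (size p)) => h; case: (leqP j l) => jl //.
by rewrite nth_default // big1 // => i _; rewrite coef0 mul0r.
Qed.

Definition cf (v : {poly C}) : nat -> C := fun k => v`_k.
Definition cf2 X : nat * nat -> C := fun x => X`_(x.2)`_(x.1).

Lemma acts1_cf q v : acts1 q (cf v) = cf (q * v).
Proof. by apply/funext => k; rewrite acts1E /cf coefM. Qed.

Lemma acts2_cf p X : acts2 p (cf2 X) = cf2 (p * X).
Proof.
apply/funext => -[k l]; rewrite acts2E /cf2 /= coefM coef_sum; apply: eq_bigr => j _.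
by rewrite coefM.
Qed.

Lemma acts1_local q f g k : (forall i, (i <= k)%N -> f i = g i) -> acts1 q f k = acts1 q g k :> C.
Proof. by move=> H; rewrite !acts1E; apply: eq_bigr => i _; rewrite H ?leq_subr. Qed.

Lemma acts2_local p f g k l : (forall i j, (i <= k)%N -> (j <= l)%N -> f (i, j) = g (i, j)) ->
  acts2 p f (k, l) = acts2 p g (k, l) :> C.
Proof.
move=> H; rewrite !acts2E; apply: eq_bigr => j _; apply: eq_bigr => i _.
by rewrite H ?leq_subr.
Qed.

Lemma acts2_const (c : C) f : acts2 (c%:P)%:P f = c *: f.
Proof.
rewrite /acts2 pactC; [|exact: acts21_action|exact: (shD (shift_Mz2 R))].
rewrite /acts21 pactC //; [exact: scal1_action|exact: (shD (shift_Mz1 R))].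
Qed.

(** Order of vanishing at the origin, measured by total degree. *)
Definition van D (f : nat * nat -> C) := forall k l, (k + l < D)%N -> f (k, l) = 0.

Lemma acts2_van p D f : p`_0`_0 = 0 -> van D f -> van D.+1 (acts2 p f).
Proof.
move=> p0 vf k l kl; rewrite acts2E big1 // => j _; rewrite big1 // => i _.
have [h|h] := posnP (i + j); last by rewrite vf ?mulr0 //; have := ltn_ord i; have := ltn_ord j; lia.
have [-> ->] : i = 0%N :> nat /\ j = 0%N :> nat by lia.
by rewrite p0 mul0r.
Qed.

(** Geometric series for [1/p] with [s = 1 - p/c], where [c] is the constant term: [s ^+ t] vanishes
    to order [t], so a coefficient of total degree [D] needs only [t <= D]. The quotient is formal;
    no summability is claimed. *)
Lemma solve2 p f : p`_0`_0 != 0 -> exists v, acts2 p v = f :> (nat * nat -> C).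
Proof.
move=> c0; set c := p`_0`_0 in c0; set ci := ((c^-1)%:P)%:P : {poly {poly C}}.
pose s := 1 - ci * p; have s0 : s`_0`_0 = 0.
  by rewrite coefB coef1 coefB coef1 /= !coefCM mulVf // subrr.
have vs t : van t (acts2 (s ^+ t) f).
  elim: t => [|t IH]; first by move=> k l; rewrite ltn0.
  by rewrite exprS (actM (acts2_action R)); apply: acts2_van.
pose G D := \sum_(t < D.+1) s ^+ t.
pose v (x : nat * nat) := acts2 (ci * G (x.1 + x.2)%N) f x.
exists v; apply/funext => -[k l].
have loc i j : (i <= k)%N -> (j <= l)%N -> v (i, j) = acts2 (ci * G (k + l)%N) f (i, j).
  move=> ik jl; rewrite /v !(actM (acts2_action R)) !acts2_const /=; congr (_ * _).
  have ij : (i + j <= k + l)%N by rewrite leq_add.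
  rewrite /G -(subnKC ij); elim: (k + l - (i + j))%N => [|d IH]; first by rewrite addn0.
  rewrite addnS [in RHS]big_ord_recr /= (actDl (acts2_action R)) -[RHS]/(acts2 _ f (i, j) + acts2 _ f (i, j)) -IH.
  by rewrite [X in _ + X](vs _) ?addr0 // ltnS leq_addr.
rewrite (acts2_local _ loc) -(actM (acts2_action R)).
have -> : p * (ci * G (k + l)%N) = 1 - s ^+ (k + l).+1.
  have -> : p * (ci * G (k + l)%N) = (1 - s) * G (k + l)%N by rewrite /s; ring.
  have := subrX1 s (k + l).+1; rewrite -/(G (k + l)%N) => h.
  by rewrite -opprB mulNr -h opprB.
rewrite (actBl _ _ _ (acts2_action R)) (act1 (acts2_action R)) !fctE.
by rewrite (vs (k + l).+1) ?subr0.
Qed.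

Lemma acts2_inj_window p u N : p`_0`_0 != 0 ->
  (forall k l, (k < N)%N -> (l < N)%N -> acts2 p u (k, l) = 0) ->
  forall k l, (k < N)%N -> (l < N)%N -> u (k, l) = 0 :> C.
Proof.
move=> c0 H k l; have [d] := ubnP (k + l); elim: d k l => // d IH k l kl kN lN.
have := H _ _ kN lN; rewrite acts2E big_ord_recl big_ord_recl /= !subn0.
rewrite big1 ?addr0 => [|i _]; last first.
  by rewrite IH ?mulr0 //; have := ltn_ord i; rewrite /bump /=; lia.
rewrite big1 ?addr0 => [|j _]; last first.
  rewrite big1 // => i _.
  by rewrite IH ?mulr0 //; have := ltn_ord j; have := ltn_ord i; rewrite /bump /=; lia.
by move/eqP; rewrite mulf_eq0 (negbTE c0) => /eqP.
Qed.

Lemma solve1 q f : q`_0 != 0 -> exists v, acts1 q v = f :> (nat -> C).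
Proof.
move=> c0; have [|w Hw] := @solve2 q%:P (fun x => if x.2 is 0 then f x.1 else 0).
  by rewrite coefC.
exists (fun k => w (k, 0%N)); apply/funext => k.
have := congr1 (fun g : nat * nat -> C => g (k, 0%N)) Hw; rewrite acts2E big_ord1 coefC /= => <-.
by rewrite acts1E; apply: eq_bigr => i _; rewrite subn0.
Qed.

Lemma geo_small (b e : R) : 0 <= b -> b < 1 -> 0 < e -> exists N, forall k, (N <= k)%N -> b ^+ k <= e.
Proof.
move=> b0 b1 e0.
(* Bernoulli's inequality in product form, which makes [b ^+ k] at most of order [1/k]. *)
have key k : b ^+ k * (1 + k%:R * (1 - b)) <= 1.
  elim: k => [|k IH]; first by rewrite expr0 mul0r addr0 mul1r.
  apply: le_trans IH; rewrite exprS mulrAC mulrC ler_wpM2l ?exprn_ge0 //.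
  rewrite -natr1; have k0 : 0 <= k%:R :> R by [].
  have : 0 <= k%:R * (1 - b) ^+ 2 by rewrite mulr_ge0 ?sqr_ge0.
  have := sqr_ge0 (1 - b); nra.
have c0 : 0 < 1 - b by rewrite subr_gt0.
have d0 : 0 < (1 - b) * e by rewrite mulr_gt0.
have [N HN] := iv_small d0; exists N.+1 => k Nk.
have kp : (0 < k)%N by apply: leq_trans Nk.
have h : (k%:R)^-1 <= (1 - b) * e by have := HN k.-1; rewrite /iv -ltnS prednK //; apply.
have := key k.
have kk : 0 < k%:R :> R by rewrite ltr0n.
rewrite -ler_pdivlMr; last by rewrite ltr_wpDr // mulr_ge0 // ltW.
move=> h2; apply: le_trans h2 _; rewrite div1r.
have h3 : 1 <= k%:R * ((1 - b) * e).
  by have := ler_wpM2l (ltW kk) h; rewrite divff ?gt_eqF.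
have pos : 0 < 1 + k%:R * (1 - b) by rewrite ltr_wpDr // mulr_ge0 // ltW.
rewrite -[_^-1]mul1r ler_pdivrMr // mulrDr mulr1; apply: le_trans h3 _.
rewrite mulrA [e * _]mulrC lerDr; exact: ltW.
Qed.

Lemma cvgC_unshift (u : nat -> C) l d : cvgC (fun k => u (k + d)%N) l -> cvgC u l.
Proof.
move=> /cvgCE H; apply/cvgCE => e /H [N HN]; exists (N + d)%N => k Nk.
have dk : (d <= k)%N by apply: leq_trans (leq_addl _ _) Nk.
by rewrite -(subnK dk); apply: HN; rewrite leq_subRL // addnC.
Qed.

Lemma recur_cvg0 (b : C) (y t : nat -> C) : cabs b < 1 -> cvgC t 0 ->
  (forall k, y k.+1 = b * y k + t k.+1) -> cvgC y 0.
Proof.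
move=> b1 /cvgCE ct Hy; apply/cvgCE => e e0.
set B := cabs b in b1; have B0 : 0 <= B := cabs_ge0 b.
have c0 : 0 < 1 - B by rewrite subr_gt0.
have d0 : 0 < (1 - B) * (e / 3) by rewrite mulr_gt0 // divr_gt0.
have [N HN] := ct _ d0.
have key j : cabs (y (N + j)%N) <= B ^+ j * cabs (y N) + e / 3.
  elim: j => [|j IH]; first by rewrite addn0 expr0 mul1r lerDl divr_ge0 // ltW.
  rewrite addnS Hy; apply: le_trans (cabsD _ _) _; rewrite cabsM -/B exprS.
  have := HN (N + j).+1; rewrite subr0 => /(_ (leq_trans (leq_addr _ _) (leqnSn _))) h.
  have := ler_wpM2l B0 IH; rewrite mulrDr mulrA; nra.
have f0 : 0 < (e / 3) / (cabs (y N) + 1) by rewrite divr_gt0 ?divr_gt0 // ltr_wpDl ?cabs_ge0.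
have [K HK] := geo_small B0 b1 f0.
exists (N + K)%N => k Nk; rewrite subr0.
have Nk' : (N <= k)%N by apply: leq_trans Nk; apply: leq_addr.
rewrite -(subnKC Nk'); apply: le_lt_trans (key _) _.
have {}HK := HK (k - N)%N; rewrite leq_subRL // in HK; have {}HK := HK Nk.
have y0 := cabs_ge0 (y N).
rewrite ler_pdivlMr ?ltr_wpDl // in HK; rewrite mulrDr mulr1 in HK.
have : 0 <= B ^+ (k - N) by rewrite exprn_ge0.
lra.
Qed.

Lemma acts1_cvg0 q f : cvgC f 0 -> cvgC (acts1 q f) 0.
Proof.
move=> H; have -> : acts1 q f = fun k => \sum_(i < size q) q`_i * iter i (@Mz R) f k.
  by apply/funext => k; rewrite /acts1 /pact fct_sumE; apply: eq_bigr => i _; rewrite !iter_Mz; case: ifP; rewrite ?mulr0.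
rewrite [X in cvgC _ X](_ : 0 = \sum_(i < size q) q`_i * 0); last by rewrite big1 // => i _; rewrite mulr0.
apply: cvgC_sum => i; apply: cvgCMl; apply: (@cvgC_unshift _ _ i).
by move: H; congr cvgC; apply/funext => k; rewrite iter_Mz leq_addl addnK.
Qed.

(** Dividing by a linear factor with root [al], [|al| > 1], is the recursion
    [y (k+1) = y k / al + t (k+1)], which damps the past geometrically. *)
Lemma acts1_cvg0_inv s x : (forall z, cabs z <= 1 -> s.[z] != 0) -> cvgC (acts1 s x) 0 -> cvgC x 0.
Proof.
have [k] := ubnP (size s); elim: k s x => // k IH s x sk ns H.
have [s1|/closed_rootP [al ra]] := eqVneq (size s) 1%N.
  have /size_poly1P [c c0 Es] : size s == 1%N by rewrite s1.
  have := cvgCMl c^-1 H; rewrite mulr0; congr cvgC; apply/funext => j.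
  rewrite Es /acts1 pactC; [|exact: scal1_action|exact: (shD (shift_Mz R))].
  by rewrite /scal1 fctE mulKf.
have al1 : 1 < cabs al by rewrite ltNge; apply/negP => /ns; rewrite -rootE ra.
have al0 : al != 0 by rewrite -cabs_eq0 gt_eqF // (lt_trans ltr01).
have /factor_theorem [s' Es] := ra.
have s'0 : s' != 0.
  by apply/eqP => h; have := ns 0; rewrite cabs0 Es h mul0r horner0 eqxx => /(_ ler01).
have Es2 : s = (1 - al^-1 *: 'X) * ((- al) *: s').
  rewrite Es -scalerAr scalerAl [RHS]mulrC; congr (_ * _).
  by rewrite scalerBr scalerA mulNr divff // !scaleNr scale1r opprK alg_polyC addrC.
apply: (IH ((- al) *: s')).
- rewrite size_scale ?oppr_eq0 //; move: sk; rewrite Es size_Mmonic ?monicXsubC //.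
  by rewrite size_XsubC addn2 /= ltnS.
- by move=> z /ns; rewrite Es2 hornerM mulf_eq0 negb_or => /andP[].
set y := acts1 _ x; have Hy : acts1 s x = acts1 (1 - al^-1 *: 'X) y by rewrite Es2 (actM (acts1_action R)).
apply: (recur_cvg0 (b := al^-1) (t := acts1 s x)) => //; first by rewrite cabsV invf_lt1 // (lt_trans ltr01).
move=> j; rewrite Hy (actBl _ _ _ (acts1_action R)) (act1 (acts1_action R)) -mul_polyC.
rewrite (actM (acts1_action R)) /acts1 pactC; [|exact: scal1_action|exact: (shD (shift_Mz R))].
rewrite pactX; [|exact: scal1_action|exact: (shD (shift_Mz R))].
by rewrite -[(_ - _) _]/(y j.+1 - al^-1 * y j) addrC subrK.
Qed.

End PowerSeries.

(** * Contractivity of the rational inner function *)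



Lemma prim_root_exists (F : numClosedFieldType) n : (0 < n)%N -> exists z : F, n.-primitive_root z.
Proof.
move=> n0; pose p : {poly F} := 'X^n - 1; have [r Dp] := closed_field_poly_normal p.
rewrite (monicP _) ?monicXnsubC // scale1r in Dp.
have rn1 : all n.-unity_root r by apply/allP => z; rewrite -root_prod_XsubC -Dp.
have sr : (n < (size r).+1)%N by rewrite -(size_prod_XsubC r id) -Dp size_XnsubC.
have [|z _ hz] := hasP (has_prim_root n0 rn1 _ sr); last by exists z.
by rewrite -separable_prod_XsubC -Dp separable_Xn_sub_1 // pnatr_eq0 -lt0n.
Qed.

Section Parseval.
Variable R : realType.
Local Notation C := R[i].
Variables (M : nat) (zeta : C).
Hypotheses (M0 : (0 < M)%N) (hz : M.-primitive_root zeta).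

Lemma cabs_prim : cabs zeta = 1.
Proof.
have := prim_expr_order hz; move/(congr1 (@cabs R)); rewrite cabsX cabs1 => /eqP.
by rewrite pexpr_eq1 ?cabs_ge0 // => /eqP.
Qed.

Lemma cabs_primX k : cabs (zeta ^+ k) = 1.
Proof. by rewrite cabsX cabs_prim expr1n. Qed.

Lemma sum_prim i j : (i < M)%N -> (j < M)%N ->
  \sum_(k < M) (zeta ^+ k) ^+ i * ((zeta ^+ k) ^+ j)^* = if i == j then M%:R else 0.
Proof.
move=> iM jM; have zc : zeta * zeta^* = 1 by apply: conj_unit; apply: cabs_prim.
pose w := zeta ^+ i * (zeta^*) ^+ j.
rewrite (eq_bigr (fun k : 'I_M => w ^+ k)); last first.
  by move=> k _; rewrite /w exprMn !rmorphXn /= -!exprM (mulnC k i) (mulnC k j).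
case: eqP => [ij|/eqP ij].
  rewrite (eq_bigr (fun=> 1)) ?sumr_const ?card_ord // => k _.
  by rewrite /w ij -exprMn zc !expr1n.
have w1 : w != 1.
  apply/negP => /eqP w1; move: ij; apply/negP; rewrite negbK.
  have := congr1 (fun x => x * zeta ^+ j) w1; rewrite /w mul1r -mulrA -exprMn [_^* * _]mulrC zc expr1n mulr1.
  by move/eqP; rewrite (eq_prim_root_expr hz) !modn_small.
have wM : w ^+ M = 1.
  have zM : zeta^* ^+ M = 1 by rewrite -(rmorphXn Num.conj) prim_expr_order // rmorph1.
  by rewrite /w exprMn -!exprM (mulnC i) (mulnC j) !exprM (prim_expr_order hz) zM !expr1n mulr1.
have := subrX1 w M; rewrite wM subrr => /esym /eqP; rewrite mulf_eq0 subr_eq0 (negbTE w1) /=.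
by move/eqP.
Qed.

(** Slicing at the [M]-th roots of unity is a discrete Fourier transform in z2, so the mean over
    slices replaces the integral over the circle exactly once [M] exceeds the degrees in z2. *)
Lemma parseval (Y Y' : {poly {poly C}}) a a' : (size Y <= M)%N -> (size Y' <= M)%N ->
  \sum_(k < M) (slice Y (zeta ^+ k))`_a * ((slice Y' (zeta ^+ k))`_a')^* =
  M%:R * \sum_(b < M) Y`_b`_a * (Y'`_b`_a')^*.
Proof.
move=> sY sY'.
rewrite (eq_bigr (fun k : 'I_M => \sum_(b < M) \sum_(b' < M)
   (Y`_b`_a * (Y'`_b'`_a')^*) * ((zeta ^+ k) ^+ b * ((zeta ^+ k) ^+ b')^*))); last first.
  move=> k _; rewrite (coef_slice _ _ sY) (coef_slice _ _ sY') rmorph_sum mulr_suml.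
  apply: eq_bigr => b _; rewrite mulr_sumr; apply: eq_bigr => b' _.
  by rewrite rmorphM /=; ring.
rewrite exchange_big mulr_sumr; apply: eq_bigr => b _; rewrite exchange_big (bigD1 b) //=.
rewrite -mulr_sumr sum_prim // eqxx big1 ?addr0; first by ring.
move=> b' bb; rewrite -mulr_sumr sum_prim //; case: eqP => [/val_inj bE|_]; last by rewrite mulr0.
by rewrite bE eqxx in bb.
Qed.

Lemma parseval_nsq (Y : {poly {poly C}}) a : (size Y <= M)%N ->
  \sum_(k < M) nsq (slice Y (zeta ^+ k))`_a = M%:R * \sum_(b < M) nsq Y`_b`_a.
Proof.
move=> sY; apply: realc_inj; rewrite rmorph_sum rmorphM rmorph_nat rmorph_sum /=.
apply: etrans (etrans (parseval a a sY sY) _).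
  by apply: eq_bigr => k _; rewrite mulr_conj.
by congr (_ * _); apply: eq_bigr => b _; rewrite mulr_conj.
Qed.

End Parseval.

(** * Division by p and multiplication by its reflection, on windows *)

Section Contraction.
Variable R : realType.
Local Notation C := R[i].
Variables (m n : nat) (p : {poly {poly C}}).
Hypotheses (degp : deg_le m n p) (nz : no_zeros_bidisk p) (cop : coprime2 (refl m n p) p).

Local Notation pt := (refl m n p).

(** The polynomial [p(0, z2)]. *)
Let s := (swapXY p)`_0.

Lemma s_nonvan z : cabs z <= 1 -> s.[z] != 0.
Proof.
have -> : s.[z] = (slice p z)`_0.
  by rewrite sliceE; have := horner_swapXY (swapXY p) z; rewrite swapXYK => ->; rewrite coef_map.
rewrite le_eqVlt => /orP[/eqP z1|z1]; first exact: (boundary_const degp nz cop z1).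
have := @nz 0 z; rewrite /open_disk norm_cabs cabs0 norm_cabs -[1]/((1%:C)%C) !ltcR ltr01 => /(_ isT z1).
by rewrite eval2E horner_coef0.
Qed.

Lemma acts2_row (q : {poly {poly C}}) v a b : acts2 q v (a, b) =
  \sum_(i < a.+1) acts1 ((swapXY q)`_i) (fun b' => v ((a - i)%N, b')) b :> C.
Proof.
rewrite acts2E exchange_big; apply: eq_bigr => i _; rewrite acts1E.
by apply: eq_bigr => j _; rewrite coef_swapXY.
Qed.

(** Comparing coefficients of [z1^a] expresses [p(0,z2) v_a] through [f_a] and the earlier [v_i]. As
    [p(0,z2)] has no zeros in the closed disk, decay in z2 propagates by induction on [a]. This is
    what lets [v] be truncated in z2. *)
Lemma quotient_cvg0 N f v : acts2 p v = f -> (forall a b, (N <= b)%N -> f (a, b) = 0) ->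
  forall a, cvgC (fun b => v (a, b)) (0 : C).
Proof.
move=> Ev fN a; have [k] := ubnP a; elim: k a => // k IH a ak.
apply: (@acts1_cvg0_inv _ s); first exact: s_nonvan.
have -> : acts1 s (fun b => v (a, b)) = fun b => f (a, b) + (-1) *
    \sum_(i < a) acts1 ((swapXY p)`_i.+1) (fun b' => v ((a - i.+1)%N, b')) b.
  apply/funext => b; rewrite -Ev acts2_row big_ord_recl subn0 mulN1r.
  by rewrite (eq_bigr (fun i : 'I_a => acts1 ((swapXY p)`_i.+1) (fun b' => v ((a - i.+1)%N, b')) b)) ?addrK.
rewrite [X in cvgC _ X](_ : 0 = 0 + -1 * 0); last by rewrite mulr0 addr0.
apply: cvgCD.
  apply/cvgCE => e e0; exists N => b Nb; rewrite fN // subr0 cabs0 //.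
apply: cvgCMl.
rewrite [X in cvgC _ X](_ : 0 = \sum_(i < a) 0); last by rewrite big1.
apply: (@cvgC_sum _ _ _ (fun i : 'I_a => acts1 ((swapXY p)`_i.+1) (fun b' => v ((a - i.+1)%N, b'))) (fun=> 0)).
move=> i; apply: acts1_cvg0; apply: IH.
by have := ltn_ord i; lia.
Qed.

Lemma size_refl : (size pt <= n.+1)%N. Proof. exact: size_poly. Qed.

Let tr v N L : {poly {poly C}} := \poly_(b < L) \poly_(a < N) v (a, b).

Let coef_tr v N L a b : (tr v N L)`_b`_a = if (b < L)%N && (a < N)%N then v (a, b) else 0.
Proof.
by rewrite coef_poly; case: ifP => /= _; rewrite ?coef0 // coef_poly.
Qed.

Let tr_local q v N L a b : (a < N)%N -> (b < L)%N -> (q * tr v N L)`_b`_a = acts2 q v (a, b).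
Proof.
move=> aN bL; rewrite -[LHS]/(cf2 (q * tr v N L) (a, b)) -acts2_cf.
apply: acts2_local => i j ia jb; rewrite /cf2 /= coef_tr.
by rewrite (leq_ltn_trans ia aN) (leq_ltn_trans jb bL).
Qed.

(** [boundary_window] averaged over roots of unity; [L + n] of them resolve all powers of z2 in
    [p X] and in [p~ X]. *)
Lemma window_avg (X : {poly {poly C}}) L N : (size X <= L)%N ->
  \sum_(a < N) \sum_(b < L + n) nsq (pt * X)`_b`_a <= \sum_(a < N) \sum_(b < L + n) nsq (p * X)`_b`_a.
Proof.
move=> sX; case: (posnP (L + n)) => M0.
  by rewrite M0; apply: ler_sum => a _; rewrite !big_ord0.
have [zeta hz] := prim_root_exists C M0; set M := (L + n)%N in hz M0 *.
have sz (q : {poly {poly C}}) : (size q <= n.+1)%N -> (size (q * X)%R <= M)%N.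
  by move=> sq; apply: leq_trans (size_polyMleq _ _) _; rewrite /M; lia.
have M1 : 0 < M%:R :> R by rewrite ltr0n.
rewrite -(ler_pM2l M1) !mulr_sumr.
rewrite (eq_bigr (fun a : 'I_N => \sum_(k < M) nsq (slice (pt * X) (zeta ^+ k))`_a)); last first.
  by move=> a _; rewrite parseval_nsq // sz // size_refl.
rewrite [X in _ <= X](eq_bigr (fun a : 'I_N => \sum_(k < M) nsq (slice (p * X) (zeta ^+ k))`_a)); last first.
  by move=> a _; rewrite parseval_nsq // sz // degp.1.
rewrite exchange_big [X in _ <= X]exchange_big; apply: ler_sum => k _.
have t1 := cabs_primX M0 hz k; set tau := zeta ^+ k in t1 *.
have sm q : slice (q * X) tau = slice q tau * slice X tau by rewrite !sliceE hornerM.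
rewrite !sm; apply: le_trans (boundary_window degp nz t1 (slice X tau) N).
rewrite le_eqVlt; apply/orP; left; apply/eqP; apply: eq_bigr => a _.
rewrite slice_refl // -scalerAl coefZ nsqM.
by rewrite /nsq cabsX t1 !expr1n mul1r.
Qed.

Lemma contraction_row N f v : acts2 p v = f -> (forall a b, (N <= b)%N -> f (a, b) = 0) ->
  nS win2 (acts2 pt v) N <= nS win2 f N.
Proof.
move=> Ev fN; have cv := quotient_cvg0 Ev fN.
(* Cutting [v] at z2-degree [N + k] leaves an overhang of [n] powers of z2 in the product with [p].
   It involves only the last [n] powers kept in [v], hence tends to 0. *)
pose err k : R := \sum_(a < N) \sum_(d < n) nsq (p * tr v N (N + k))`_(N + k + d)`_a.
have step k : nS win2 (acts2 pt v) N <= nS win2 f N + err k.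
  set L := (N + k)%N; have sX : (size (tr v N L) <= L)%N by apply: size_poly.
  have := window_avg N sX; rewrite /nS !big_win2 => h.
  apply: le_trans (le_trans _ h) _.
    apply: ler_sum => a _; rewrite big_split_ord /= /L big_split_ord /= -addrA.
    rewrite [X in _ <= X + _](eq_bigr (fun b : 'I_N => nsq (acts2 pt v (nat_of_ord a, nat_of_ord b)))); last first.
      by move=> b _; rewrite tr_local // (leq_trans (ltn_ord b)) // leq_addr.
    by rewrite lerDl addr_ge0 // sumr_ge0 // => *; apply: nsq_ge0.
  rewrite /err -/L -big_split le_eqVlt; apply/orP; left; apply/eqP; apply: eq_bigr => a _.
  rewrite big_split_ord /=; congr (_ + _).
  rewrite (eq_bigr (fun b : 'I_L => nsq (f (nat_of_ord a, nat_of_ord b)))); last first.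
    by move=> b _; rewrite tr_local // Ev.
  rewrite /L big_split_ord /= [X in _ + X]big1 ?addr0 // => b _.
  by rewrite fN ?nsq0 // leq_addr.
have err0 : cvgC (fun k => ((err k)%:C)%C) ((0 : R)%:C)%C.
  rewrite (_ : ((0 : R)%:C)%C = \sum_(a < N) \sum_(d < n) (0 : C)); last first.
    by rewrite big1 // => a _; rewrite big1.
  rewrite /err; under eq_fun do rewrite rmorph_sum.
  apply: (@cvgC_sum _ _ _ (fun a k => _) (fun=> _)) => a.
  under eq_fun do rewrite rmorph_sum.
  apply: (@cvgC_sum _ _ _ (fun a k => _) (fun=> _)) => d.
  have h : cvgC (fun k => (p * tr v N (N + k))`_(N + k + d)`_a) 0.
    have -> : (fun k => (p * tr v N (N + k))`_(N + k + d)`_a) = (fun k =>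
      \sum_(j < n.+1) \sum_(i < a.+1) p`_j`_i * (if (j <= N + k + d)%N then (tr v N (N + k))`_(N + k + d - j)`_(a - i) else 0)).
      apply/funext => k; rewrite coefM coef_sum.
      set K := maxn n.+1 (N + k + d).+1.
      rewrite (big_ord_widen K (fun j => (p`_j * (tr v N (N + k))`_(N + k + d - j))`_a) (leq_maxr _ _)).
      rewrite (big_ord_widen K (fun j => \sum_(i < a.+1) p`_j`_i * (if (j <= N + k + d)%N then (tr v N (N + k))`_(N + k + d - j)`_(a - i) else 0)) (leq_maxl _ _)).
      rewrite big_mkcond [RHS]big_mkcond; apply: eq_bigr => j _; rewrite ltnS.
      case: (leqP j (N + k + d)) => h1; last first.
        by rewrite big1 ?if_same // => i _; rewrite mulr0.
      rewrite coefM; case: ltnP => // h2.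
      by rewrite big1 // => i _; rewrite (nth_default 0 (leq_trans degp.1 h2)) coef0 mul0r.
    rewrite [X in cvgC _ X](_ : 0 = \sum_(j < n.+1) \sum_(i < a.+1) p`_j`_i * 0); last first.
      by rewrite big1 // => j _; rewrite big1 // => i _; rewrite mulr0.
    apply: (@cvgC_sum _ _ _ (fun j k => _)) => j; apply: (@cvgC_sum _ _ _ (fun i k => _)) => i.
    apply: cvgCMl; apply/cvgCE => e e0; have [K HK] := (cvgCE _ _).1 (cv (a - i)%N) _ e0.
    exists (K + j)%N => k Kk; rewrite coef_tr !(fun_if (fun x : C => x - 0)) !(fun_if (@cabs R)).
    rewrite subrr cabs0; case: ifP => // _; case: ifP => // _; apply: HK; lia.
  have := cvgCM h (cvgC_conj h); rewrite rmorph0 mul0r; congr cvgC.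
  by apply/funext => k; rewrite mulr_conj.
apply: eps_le => e e0; have [K /(_ K (leqnn K))] := (cvgCE _ _).1 err0 _ e0.
rewrite subr0 cabs_real => h; have := step K; have := ler_norm (err K); lra.
Qed.

(** Nothing is assumed on the growth of [v]. Coefficients of a product in a window depend only on
    [v] there, so [p v] may be cut to the window and divided by [p] anew. *)
Lemma contraction v N : nS win2 (acts2 pt v) N <= nS win2 (acts2 p v) N.
Proof.
set f := acts2 p v.
pose f' : nat * nat -> C := fun x => if (x.1 < N)%N && (x.2 < N)%N then f x else 0.
have c0 := p00 nz.
have [v' Ev'] := solve2 f' c0.
have vv' k l : (k < N)%N -> (l < N)%N -> v (k, l) = v' (k, l).
  move=> kN lN; apply/eqP; rewrite -subr_eq0; apply/eqP.
  apply: (@acts2_inj_window _ p (v - v') N c0) => // {kN lN}k {}l kN lN.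
  rewrite (actBr _ _ _ (acts2_action R)) Ev' -[(_ - _) _]/(f (k, l) - f' (k, l)) /f' /= kN lN /=.
  by rewrite subrr.
have E q x : x \in win2 N -> acts2 q v x = acts2 q v' x.
  case: x => a b; rewrite mem_win2 => /andP[aN bN]; apply: acts2_local => i j ia jb.
  by apply: vv'; [apply: leq_ltn_trans ia aN|apply: leq_ltn_trans jb bN].
rewrite /nS; under eq_big_seq => x xN do rewrite E //.
apply: le_trans (contraction_row (N := N) Ev' _) _.
  by move=> a b Nb; rewrite /f' /= [(b < N)%N]ltnNge Nb andbF.
rewrite le_eqVlt; apply/orP; left; apply/eqP; apply: eq_big_seq => x.
by rewrite mem_win2 /f' => ->.
Qed.

End Contraction.

(** * Adjoints *)



Section Adjoints.
Variable R : realType.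
Local Notation C := R[i].
Local Notation W1 := exhausting_win1.
Local Notation W2 := exhausting_win2.
Local Notation H1 := (shift_Mz1 R).
Local Notation H2 := (shift_Mz2 R).

Definition delta (I : eqType) (x : I) : I -> C := fun y => (y == x)%:R.

Lemma sum_delta (I : eqType) (s : seq I) x (F : I -> C) : uniq s ->
  \sum_(y <- s) F y * (delta x y)^* = if x \in s then F x else 0.
Proof.
move=> us; case: ifP => xs.
  rewrite (bigD1_seq x) //= /delta eqxx rmorph1 mulr1 big1 ?addr0 // => y yx.
  by rewrite (negbTE yx) rmorph0 mulr0.
rewrite big_seq big1 // => y ys; rewrite /delta; case: eqP => [E|_]; last by rewrite rmorph0 mulr0.
by rewrite -E ys in xs.
Qed.

Lemma l2_delta (I : eqType) (win : nat -> seq I) x : exhausting win -> in_l2 win (delta x).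
Proof.
move=> W; apply/in_l2E; exists 1 => N; rewrite -lecR /nS rmorph_sum /=.
under eq_bigr do rewrite -mulr_conj; rewrite sum_delta ?(win_uniq W) //.
by case: ifP => _; rewrite ?/delta ?eqxx // -[0]/((0%:C)%C) lecR.
Qed.

Lemma inner_delta (I : eqType) (win : nat -> seq I) x (g : I -> C) : exhausting win ->
  inner win g (delta x) = g x.
Proof.
move=> W; apply: inner_eq; apply/cvgCE => e e0; have [N xN] := win_cover W x.
exists N => k Nk; rewrite sum_delta ?(win_uniq W) // (win_sub W Nk xN) subrr cabs0 //.
Qed.

Lemma acts1_wide (q : {poly C}) d f : (size q <= d.+1)%N ->
  acts1 q f = \sum_(i < d.+1) q`_i *: iter i (@Mz R) f.
Proof.
move=> sq; rewrite /acts1 (@pactE _ _ _ _ _ _ d.+1) //; last 2 first.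
- exact: scal1_action.
- exact: (shD (shift_Mz R)).
by apply: eq_bigr => i _; rewrite iter_sc //; apply: (shZ (shift_Mz R)).
Qed.

Lemma acts2_wide (q : {poly {poly C}}) m n f : deg_le m n q ->
  acts2 q f = \sum_(j < n.+1) \sum_(i < m.+1) q`_j`_i *: iter j (@Mz2 R) (iter i (@Mz1 R) f).
Proof.
move=> [sq sqj]; rewrite /acts2 (@pactE _ _ _ _ _ _ n.+1) //; last 2 first.
- exact: acts21_action.
- exact: (shD H2).
apply: eq_bigr => j _; rewrite /acts21 (@pactE _ _ _ _ _ _ m.+1) //; last 2 first.
- exact: scal1_action.
- exact: (shD H1).
rewrite (additive_sum _ _ (iter_addf (shD H2) j)); apply: eq_bigr => i _.
rewrite (iter_sc (shZ H1)) /scal1; move: (q`_j`_i) => c; elim: (nat_of_ord j) => //= k ->.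
by rewrite (shZ H2).
Qed.

Lemma deg_refl m n (p : {poly {poly C}}) : deg_le m n (refl m n p).
Proof.
split; first exact: size_poly.
move=> j; apply/leq_sizeP => i im; rewrite coef_refl [(i <= m)%N]leqNgt im andbF //.
Qed.

(** On the circle the reflection equals [z^m conj(q)], so its adjoint multiplies by [q] and then
    shifts back [m] times. *)
Lemma adjoint1 m (q : {poly C}) u s : (size q <= m.+1)%N -> in_l2 win1 u -> in_l2 win1 s ->
  inner win1 u (acts1 (refl1 m q) s) = inner win1 (iter m (@Bz R) (acts1 q u)) s.
Proof.
move=> sq hu hs; rewrite (acts1_wide _ (size_refl1 m q)).
have hM i : in_l2 win1 (iter i (@Mz R) s) := l2_iter W1 (shift_Mz R) i hs.
rewrite inner_sumr => [|//|i|//]; [|exact: W1|exact: l2Z].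
have -> : iter m (@Bz R) (acts1 q u) = \sum_(i < m.+1) q`_(m - i) *: iter i (@Bz R) u.
  apply/funext => k; rewrite iter_Bz (acts1_wide _ sq) !fct_sumE (reindex_inj rev_ord_inj) /=.
  apply: eq_bigr => i _; have im : (i <= m)%N by rewrite -ltnS.
  rewrite -[LHS]/(q`_(m.+1 - i.+1) * iter (m.+1 - i.+1) (@Mz R) u (k + m)%N).
  rewrite -[RHS]/(q`_(m - i) * iter i (@Bz R) u k) subSS iter_Mz iter_Bz.
  have -> : (m - i <= k + m)%N by lia.
  by congr (_ * u _); lia.
have hB i : in_l2 win1 (iter i (@Bz R) u) := l2_iterB W1 (shift_Mz R) i hu.
rewrite inner_suml => [|//|i|//]; [|exact: W1|exact: l2Z].
apply: eq_bigr => i _; have im : (i <= m)%N by rewrite -ltnS.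
rewrite coef_poly ltnS im (innerZr W1) // (innerZl W1) // conjCK.
by rewrite (adjoint_iter W1 (shift_Mz R)).
Qed.

Lemma adjoint2 m n (p : {poly {poly C}}) u s : deg_le m n p -> in_l2 win2 u -> in_l2 win2 s ->
  inner win2 u (acts2 (refl m n p) s) =
  inner win2 (iter m (@Bz1 R) (iter n (@Bz2 R) (acts2 p u))) s.
Proof.
move=> dp hu hs; rewrite (acts2_wide _ (deg_refl m n p)).
have hM i j : in_l2 win2 (iter j (@Mz2 R) (iter i (@Mz1 R) s)).
  by apply: (l2_iter W2 H2); apply: (l2_iter W2 H1).
have hB i j : in_l2 win2 (iter i (@Bz1 R) (iter j (@Bz2 R) u)).
  by apply: (l2_iterB W2 H1); apply: (l2_iterB W2 H2).
have -> : iter m (@Bz1 R) (iter n (@Bz2 R) (acts2 p u)) =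
   \sum_(j < n.+1) \sum_(i < m.+1) p`_(n - j)`_(m - i) *: iter i (@Bz1 R) (iter j (@Bz2 R) u).
  apply/funext => -[k l]; rewrite iter_Bz1 iter_Bz2 (acts2_wide _ dp) !fct_sumE (reindex_inj rev_ord_inj) /=.
  apply: eq_bigr => j _; have jn : (j <= n)%N by rewrite -ltnS.
  rewrite !fct_sumE (reindex_inj rev_ord_inj) /=; apply: eq_bigr => i _; have im : (i <= m)%N by rewrite -ltnS.
  rewrite !subSS.
  rewrite -[LHS]/(p`_(n - j)`_(m - i) * iter (n - j) (@Mz2 R) (iter (m - i) (@Mz1 R) u) ((k + m)%N, (l + n)%N)).
  rewrite -[RHS]/(p`_(n - j)`_(m - i) * iter i (@Bz1 R) (iter j (@Bz2 R) u) (k, l)).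
  rewrite iter_Mz2 iter_Mz1 iter_Bz1 iter_Bz2 /=.
  have -> : (n - j <= l + n)%N by lia.
  have -> : (m - i <= k + m)%N by lia.
  by congr (_ * u (_, _)); lia.
rewrite inner_sumr => [|//|j|//]; [|exact: W2|by apply: l2_sum => i _; apply: l2Z].
rewrite inner_suml => [|//|j|//]; [|exact: W2|by apply: l2_sum => i _; apply: l2Z].
apply: eq_bigr => j _; have jn : (j <= n)%N by rewrite -ltnS.
rewrite inner_sumr => [|//|i|//]; [|exact: W2|exact: l2Z].
rewrite inner_suml => [|//|i|//]; [|exact: W2|exact: l2Z].
apply: eq_bigr => i _; have im : (i <= m)%N by rewrite -ltnS.
rewrite coef_refl jn im /= (innerZr W2) // (innerZl W2) // conjCK.
rewrite (adjoint_iter W2 H2) //; last exact: (l2_iter W2 H1).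
by rewrite (adjoint_iter W2 H1) //; apply: (l2_iterB W2 H2).
Qed.

Lemma acts2C (q q' : {poly {poly C}}) f : acts2 q (acts2 q' f) = acts2 q' (acts2 q f).
Proof. by rewrite -!(actM (acts2_action R)) mulrC. Qed.

Lemma acts1C (q q' : {poly C}) f : acts1 q (acts1 q' f) = acts1 q' (acts1 q f).
Proof. by rewrite -!(actM (acts1_action R)) mulrC. Qed.

Lemma l2_acts1 q f : in_l2 win1 f -> in_l2 win1 (acts1 q f : nat -> C).
Proof. by move=> hf; have [K [_ HK]] := bdd_acts1 q; apply: (HK _ hf).1. Qed.

Lemma l2_acts2 q f : in_l2 win2 f -> in_l2 win2 (acts2 q f : nat * nat -> C).
Proof. by move=> hf; have [K [_ HK]] := bdd_acts2 q; apply: (HK _ hf).1. Qed.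

(** By [adjoint2] the inner product sees only coefficients of [p u] whose z1-exponent is at least
    [m]. A degree condition thus yields orthogonality. *)
Lemma orth2 m n (p : {poly {poly C}}) u s : deg_le m n p -> in_l2 win2 u -> in_l2 win2 s ->
  (forall a b, (m <= a)%N -> acts2 p u (a, b) = 0) ->
  inner win2 u (acts2 (refl m n p) s) = 0.
Proof.
move=> dp hu hs H; rewrite adjoint2 // (_ : iter m _ _ = 0) ?inner0l //.
by apply/funext => -[k l]; rewrite iter_Bz1 iter_Bz2 /= H // leq_addl.
Qed.

Lemma orth1 m (q : {poly C}) u s : (size q <= m.+1)%N -> in_l2 win1 u -> in_l2 win1 s ->
  (forall k, (m <= k)%N -> acts1 q u k = 0) -> inner win1 u (acts1 (refl1 m q) s) = 0.
Proof.
move=> sq hu hs H; rewrite adjoint1 // (_ : iter m _ _ = 0) ?inner0l //.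
by apply/funext => k; rewrite iter_Bz /= H // leq_addl.
Qed.

Lemma acts2_Mz2 q f : acts2 q (Mz2 f) = Mz2 (acts2 q f) :> (nat * nat -> C).
Proof.
rewrite /acts2 pactT //; [exact: acts21_action|exact: (shD H2)|exact: acts21_Mz2].
Qed.

Lemma acts2_Mz1 q f : acts2 q (Mz1 f) = Mz1 (acts2 q f) :> (nat * nat -> C).
Proof.
rewrite /acts2; apply/esym; apply: pact_comm; [exact: (shD H1)| |by move=> g; rewrite Mz12C].
move=> a g; rewrite /acts21 pactT //; [exact: scal1_action|exact: (shD H1)|exact: (shZ H1)].
Qed.

Lemma acts2_iter2 q k f : acts2 q (iter k (@Mz2 R) f) = iter k (@Mz2 R) (acts2 q f).
Proof. by elim: k => //= k <-; rewrite acts2_Mz2. Qed.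

Lemma acts2_iter1 q k f : acts2 q (iter k (@Mz1 R) f) = iter k (@Mz1 R) (acts2 q f).
Proof. by elim: k => //= k <-; rewrite acts2_Mz1. Qed.

Lemma acts2_z2 (q : {poly C}) d f : (size q <= d.+1)%N ->
  acts2 q^:P f = \sum_(i < d.+1) q`_i *: iter i (@Mz2 R) f.
Proof.
move=> sq; rewrite (@acts2_wide _ 0 d); last first.
  split; first by rewrite (leq_trans (size_poly _ _)).
  by move=> j; rewrite coef_map size_polyC; case: eqP.
by apply: eq_bigr => i _; rewrite big_ord1 coef_map coefC.
Qed.

Lemma adjoint_z2 d (q : {poly C}) u g : (size q <= d.+1)%N -> in_l2 win2 u -> in_l2 win2 g ->
  inner win2 (acts2 (refl1 d q)^:P u) g = inner win2 (iter d (@Mz2 R) u) (acts2 q^:P g).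
Proof.
move=> sq hu hg; rewrite (acts2_z2 _ (size_refl1 d q)) (acts2_z2 _ sq).
have hM i v : in_l2 win2 v -> in_l2 win2 (iter i (@Mz2 R) v) by apply: (l2_iter W2 H2).
rewrite inner_suml => [|//|i|//]; [|exact: W2|by apply: l2Z; apply: hM].
rewrite inner_sumr => [|//|i|]; [|exact: W2|by apply: l2Z; apply: hM|exact: hM].
rewrite (reindex_inj rev_ord_inj) /=; apply: eq_bigr => i _.
have id : (i <= d)%N by rewrite -ltnS.
rewrite subSS coef_poly ltnS leq_subr subKn // (innerZl W2) ?(innerZr W2) //; try exact: hM.
have -> : iter d (@Mz2 R) u = iter i (@Mz2 R) (iter (d - i) (@Mz2 R) u) by rewrite -iterD subnKC.
by rewrite (inner_iter W2 H2) //; apply: hM.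
Qed.

End Adjoints.

(** * Multipliers and model spaces *)



Section ModelSpaces.
Variable R : realType.
Local Notation C := R[i].
Local Notation W1 := exhausting_win1.
Local Notation W2 := exhausting_win2.
Local Notation H1 := (shift_Mz1 R).
Local Notation H2 := (shift_Mz2 R).
Local Notation nm1 := (nm win1).
Local Notation nm2 := (nm win2).

Lemma nm_le_window (I I' : eqType) (win : nat -> seq I) (win' : nat -> seq I') (f : I -> C) (g : I' -> C) :
  exhausting win -> exhausting win' -> in_l2 win' g -> (forall N, nS win f N <= nS win' g N) ->
  in_l2 win f /\ nm win f <= nm win' g.
Proof.
move=> W W' hg H; have H' N : nS win f N <= N2 win' g by apply: le_trans (H N) (nS_le_N2 W' N hg).
have hf : in_l2 win f by apply/in_l2E; exists (N2 win' g).
by split => //; rewrite /nm ler_wsqrtr // N2_le.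
Qed.

Lemma acts1_scale (c : C) q f : acts1 (c *: q) f = c *: acts1 q f.
Proof.
rewrite -mul_polyC (actM (acts1_action R)) {1}/acts1 pactC //.
- exact: scal1_action.
- exact: (shD (shift_Mz R)).
Qed.

Lemma acts1_const (c : C) f : acts1 c%:P f = c *: f.
Proof. by rewrite -[c%:P]mulr1 mul_polyC acts1_scale (act1 (acts1_action R)). Qed.

Lemma acts1_slice (X : {poly {poly C}}) tau f :
  acts1 (slice X tau) f = \sum_(j < size X) tau ^+ j *: acts1 X`_j f.
Proof.
rewrite /slice (big_morph (fun q => acts1 q f) (id1 := 0) (op1 := +%R)).
- by apply: eq_bigr => j _; rewrite acts1_scale.
- by move=> q q'; rewrite (actDl (acts1_action R)).
- exact: act0l (acts1_action R).
Qed.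

Lemma bdd_slice (X : {poly {poly C}}) : exists K : R, 0 <= K /\ forall tau f, cabs tau = 1 ->
  in_l2 win1 f -> in_l2 win1 (acts1 (slice X tau) f) /\ nm1 (acts1 (slice X tau) f) <= K * nm1 f.
Proof.
pose K j := sval (cid (bdd_acts1 X`_j)).
have HK j : bdd win1 (acts1 X`_j) (K j) by rewrite /K; case: cid.
exists (\sum_(j < size X) K j); split; first by apply: sumr_ge0 => j _; apply: (HK j).1.
move=> tau f t1 hf; split; first exact: l2_acts1.
have hj j : in_l2 win1 (acts1 X`_j f) by apply: l2_acts1.
rewrite acts1_slice; apply: le_trans (nm_sum W1 _ _ _) _; first by move=> j; apply: l2Z.
rewrite mulr_suml; apply: ler_sum => j _; rewrite (nmZ W1) // cabsX t1 expr1n mul1r.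
exact: ((HK j).2 _ hf).2.
Qed.

Lemma orth_complement_closed (I : eqType) (win : nat -> seq I) (G : (I -> C) -> Prop) :
  exhausting win -> (forall g, G g -> in_l2 win g) ->
  closed_subspace win (fun f => in_l2 win f /\ forall g, G g -> inner win f g = 0).
Proof.
move=> W HG; split; first by move=> f [].
split; first by split; [exact: l20|move=> g _; exact: inner0l].
split.
  move=> f g [hf Hf] [hg Hg]; split; first exact: (l2D hf hg).
  by move=> k Gk; rewrite (innerDl W hf hg (HG _ Gk)) Hf // Hg // addr0.
split.
  move=> c f [hf Hf]; split; first exact: (l2Z c hf).
  by move=> k Gk; rewrite (innerZl W c hf (HG _ Gk)) Hf // mulr0.
move=> f hf H; split => // g Gg; have hg := HG _ Gg.
apply/eqP; rewrite -nsq_eq0; apply/eqP; apply: eps_eq0 (nsq_ge0 _) _ => e e0.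
have g1 : 0 < N2 win g + 1 by rewrite ltr_wpDl ?N2_ge0.
have e1 : 0 < e / (N2 win g + 1) by rewrite divr_gt0.
have [s [[hs Hs]]] := H _ e1; have hd : in_l2 win (f - s) := l2B hf hs.
rewrite norm_cabs ltcR (_ : inner win _ _ = ((N2 win (f - s))%:C)%C); last exact: innerN2.
rewrite cabs_real ger0_norm ?N2_ge0 // ltr_pdivlMr // => h.
have -> : inner win f g = inner win (f - s) g by rewrite innerBl // Hs // subr0.
have CS := nsq_inner_le W hd hg; apply: (le_lt_trans CS); apply: (le_lt_trans _ h).
by rewrite ler_wpM2l ?N2_ge0 // lerDl.
Qed.

Section Fixed.
Variables (m n : nat) (p : {poly {poly C}}) (r : {poly C}) (A B : {poly {poly C}}).
Hypotheses (degp : deg_le m n p) (nz : no_zeros_bidisk p) (cop : coprime2 (refl m n p) p).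
Hypothesis Er : r^:P = A * p + B * refl m n p.
Local Notation pt := (refl m n p).

(** [r v = A (p v) + B (p~ v)], and the second product is controlled by [contraction]; [v] itself
    need not be square-summable. *)
Lemma multiplier2 : exists K : R, 0 <= K /\ forall v, in_l2 win2 (acts2 p v) ->
  in_l2 win2 (acts2 r^:P v) /\ nm2 (acts2 r^:P v) <= K * nm2 (acts2 p v).
Proof.
have [KA [KA0 HA]] := bdd_acts2 A; have [KB [KB0 HB]] := bdd_acts2 B.
exists (KA + KB); split; first exact: addr_ge0.
move=> v hv; have [ht htn] := nm_le_window W2 W2 hv (contraction degp nz cop v).
have [h1 h2] := HA _ hv; have [h3 h4] := HB _ ht.
rewrite Er (actDl (acts2_action R)) !(actM (acts2_action R)); split; first exact: l2D.
apply: le_trans (nmD W2 h1 h3) _; rewrite mulrDl; apply: lerD => //.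
by apply: le_trans h4 _; rewrite ler_wpM2l.
Qed.

Lemma slice_r tau : (r.[tau])%:P = slice A tau * slice p tau + slice B tau * slice pt tau.
Proof.
have <- : slice r^:P tau = (r.[tau])%:P by rewrite sliceE horner_map.
by rewrite Er !sliceE !(hornerD, hornerM).
Qed.

Lemma contraction1 tau v N : cabs tau = 1 ->
  nS win1 (acts1 (slice pt tau) v) N <= nS win1 (acts1 (slice p tau) v) N.
Proof.
move=> t1; pose X : {poly C} := \poly_(i < N) v i.
have loc (q : {poly C}) (k : 'I_N) : acts1 q v k = (q * X)`_k.
  rewrite -[RHS]/(cf (q * X) k) -acts1_cf; apply: acts1_local => i ik.
  by rewrite /cf coef_poly (leq_ltn_trans ik).
rewrite /nS !big_win1; under eq_bigr do rewrite loc; under [in X in _ <= X]eq_bigr do rewrite loc.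
apply: le_trans (boundary_window degp nz t1 X N); apply: ler_sum => k _.
by rewrite slice_refl // -scalerAl coefZ nsqM {1}/nsq cabsX t1 !expr1n mul1r.
Qed.

(** The point is a constant independent of [tau], although the quotient by the slice of [p]
    degenerates as [tau] approaches [E_set p]. *)
Lemma multiplier1 : exists K : R, 0 <= K /\ forall tau v, cabs tau = 1 ->
  in_l2 win1 (acts1 (slice p tau) v) ->
  in_l2 win1 (r.[tau] *: v) /\ nm1 (r.[tau] *: v) <= K * nm1 (acts1 (slice p tau) v).
Proof.
have [KA [KA0 HA]] := bdd_slice A; have [KB [KB0 HB]] := bdd_slice B.
exists (KA + KB); split; first exact: addr_ge0.
move=> tau v t1 hv; have [ht htn] := nm_le_window W1 W1 hv (fun N => contraction1 v N t1).
have [h1 h2] := HA _ _ t1 hv; have [h3 h4] := HB _ _ t1 ht.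
rewrite -acts1_const slice_r (actDl (acts1_action R)) !(actM (acts1_action R)); split; first exact: l2D.
apply: le_trans (nmD W1 h1 h3) _; rewrite mulrDl; apply: lerD => //.
by apply: le_trans h4 _; rewrite ler_wpM2l.
Qed.

Lemma model2_vanish h a b : model2 pt p h -> (m <= a)%N -> (n <= b)%N -> acts2 p h (a, b) = 0.
Proof.
move=> [hh Hh] ma nb; pose x := ((a - m)%N, (b - n)%N).
have hd := l2_delta R x W2.
have := Hh (acts2 pt (delta R x)); rewrite (adjoint2 degp hh hd) inner_delta; last exact: W2.
rewrite iter_Bz1 iter_Bz2 /= !subnK //; apply; split; first exact: l2_acts2.
exists (acts2 p (delta R x)); split; first exact: l2_acts2.
by rewrite !conv2E acts2C.
Qed.

Lemma model1_vanish tau f k : cabs tau = 1 -> model1 (slice pt tau) (slice p tau) f ->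
  (m <= k)%N -> acts1 (slice p tau) f k = 0.
Proof.
move=> t1 [hf Hf] mk; have sp := size_slice tau degp.
have hd := l2_delta R (k - m)%N W1.
have := Hf (acts1 (slice pt tau) (delta R (k - m)%N)); rewrite slice_refl // acts1_scale.
rewrite (innerZr W1) //; last exact: l2_acts1.
rewrite (adjoint1 sp hf hd) inner_delta; last exact: W1.
rewrite iter_Bz subnK // => H; have /eqP : (tau ^+ n)^* * acts1 (slice p tau) f k = 0.
  apply: H; split; first by apply: l2Z; apply: l2_acts1.
  exists (acts1 (slice p tau) (delta R (k - m)%N)); split; first exact: l2_acts1.
  by rewrite !conv1E -acts1_scale acts1C.
by rewrite mulf_eq0 conjC_eq0 expf_eq0 -cabs_eq0 t1 oner_eq0 andbF /= => /eqP.
Qed.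

Lemma vanish_model1 tau v : cabs tau = 1 -> r.[tau] != 0 -> in_l2 win1 v ->
  (forall k, (m <= k)%N -> acts1 (slice p tau) v k = 0) -> model1 (slice pt tau) (slice p tau) v.
Proof.
move=> t1 r0 hv H; split => // g [hg [f [hf]]]; rewrite !conv1E => E.
have sp := size_slice tau degp.
have hF : in_l2 win1 (acts1 (slice A tau) f + acts1 (slice B tau) g) by apply: l2D; apply: l2_acts1.
(* From [p g = p~ f]: [r g = A p g + B p~ g = p~ (A f + B g)]. So a nonzero multiple of [g] is [p~]
   times a square-summable function and [orth1] applies. *)
have Eg : r.[tau] *: g = acts1 (slice pt tau) (acts1 (slice A tau) f + acts1 (slice B tau) g).
  rewrite -acts1_const slice_r (actDl (acts1_action R)) !(actM (acts1_action R)) E.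
  by rewrite (actDr (acts1_action R)); congr (_ + _); apply: acts1C.
have /eqP : r.[tau]^* * inner win1 v g = 0.
  rewrite -(innerZr W1) // Eg slice_refl // acts1_scale (innerZr W1) //; last exact: l2_acts1.
  by rewrite orth1 // mulr0.
by rewrite mulf_eq0 conjC_eq0 (negbTE r0) /= => /eqP.
Qed.

(** * Degree conditions and membership in the two summands *)

Section Decomposition.
Variables (S1 S2 : (nat * nat -> C) -> Prop).
Hypotheses (dec : orth_decomp (model2 pt p) S1 S2)
  (inv1 : forall f, S1 f -> S1 (Mz1 f)) (inv2 : forall f, S2 f -> S2 (Mz2 f)).

Lemma S1_l2 f : S1 f -> in_l2 win2 f. Proof. by case: dec => -[H _] _ /H. Qed.
Lemma S2_l2 f : S2 f -> in_l2 win2 f. Proof. by case: dec => _ [[H _] _] /H. Qed.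

Lemma S2_iter k f : S2 f -> S2 (iter k (@Mz2 R) f).
Proof. by move=> hf; elim: k => //= k IH; apply: inv2. Qed.

Lemma S2_D f g : S2 f -> S2 g -> S2 (f + g).
Proof. by case: dec => _ [[_ [_ [H _]]] _]; apply: H. Qed.

Lemma S2_Z c f : S2 f -> S2 (c *: f).
Proof. by case: dec => _ [[_ [_ [_ [H _]]]] _]; apply: H. Qed.

Lemma S2_acts q f : S2 f -> S2 (acts2 q^:P f).
Proof.
move=> hf; rewrite (@acts2_z2 _ _ (size q)) ?leqnSn //.
elim/big_ind: _ => [||i _]; [|exact: S2_D|by apply: S2_Z; apply: S2_iter].
by case: dec => _ [[_ [H _]] _].
Qed.

(** Invariance removes the restriction on [b] in [model2_vanish]: apply it to [z2^n h]. *)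
Lemma S2_vanish h a b : S2 h -> (m <= a)%N -> acts2 p h (a, b) = 0.
Proof.
move=> hS ma; have hK : model2 pt p (iter n (@Mz2 R) h) by apply: dec.2.2.2.1; apply: S2_iter.
have := model2_vanish hK ma (leq_addl b n); rewrite acts2_iter2 iter_Mz2 /= leq_addl.
by rewrite addnK.
Qed.

Lemma S1_vanish h a b : S1 h -> (n <= b)%N -> acts2 p h (a, b) = 0.
Proof.
move=> hS nb; have hK : model2 pt p (iter m (@Mz1 R) h).
  by apply: dec.2.2.1; elim: (m) => //= k IH; apply: inv1.
have := model2_vanish hK (leq_addl a m) nb; rewrite acts2_iter1 iter_Mz1 /= leq_addl.
by rewrite addnK.
Qed.

Let d := size r.

Lemma lift_S2 h : in_l2 win2 h -> (forall a b, (m <= a)%N -> acts2 p h (a, b) = 0) ->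
  exists J, S2 (iter J (@Mz2 R) (acts2 (refl1 d r)^:P h)).
Proof.
(* For [g] in [S1] the product [p g] has z2-degree below [n], so [A p g] stays below [n + size A]; a
   vector starting at [z2^J] has support disjoint from it. *)
move=> hh Hh; exists (n + size A)%N; set J := (n + size A)%N.
rewrite -acts2_iter2; set u := iter J _ h.
have hu : in_l2 win2 u by apply: (l2_iter W2 H2).
pose U := iter d (@Mz2 R) u; have hU : in_l2 win2 U by apply: (l2_iter W2 H2).
have UV a b : (m <= a)%N -> acts2 p U (a, b) = 0.
  by move=> ma; rewrite /U /u !acts2_iter2 iter_Mz2; case: ifP => // _; rewrite iter_Mz2; case: ifP => // _; apply: Hh.
set H := acts2 _ u; have hH : in_l2 win2 H by apply: l2_acts2.
(* The reflected [r] passes to the other side as [r], and the summand [B p~ g] dies by [orth2]. *)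
have key g : in_l2 win2 g -> inner win2 H g = inner win2 U (acts2 A (acts2 p g)).
  move=> hg; rewrite /H adjoint_z2 // Er (actDl (acts2_action R)) !(actM (acts2_action R)).
  rewrite (innerDr W2); try by do ?apply: l2_acts2.
  by rewrite (acts2C B) (orth2 degp) ?addr0 //; apply: l2_acts2.
have HK : model2 pt p H.
  split => // g [hg [f [hf]]]; rewrite !conv2E => E.
  by rewrite key // E acts2C (orth2 degp) //; apply: l2_acts2.
have [f1 [f2 [hf1 [hf2 E]]]] := dec.2.2.2.2.2 _ HK.
have l1 := S1_l2 hf1; have l2' := S2_l2 hf2.
have orthH : inner win2 H f1 = 0.
  rewrite key //; apply: inner_pointwise0 => -[a b].
  case: (ltnP b J) => bJ.
    by rewrite /U /u !iter_Mz2 /=; case: ifP => _; rewrite ?mul0r // leqNgt (leq_ltn_trans (leq_subr _ _) bJ) mul0r.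
  rewrite acts2E big1 ?rmorph0 ?mulr0 // => j _; rewrite big1 // => i _.
  case: (ltnP j (size A)) => jA; last by rewrite (nth_default 0 jA) coef0 mul0r.
  by rewrite S1_vanish ?mulr0 //; rewrite /J in bJ; lia.
have f10 : f1 = 0.
  apply: (N2_eq0 W2 l1); rewrite /N2.
  have := orthH; rewrite E (_ : Defs.addf f1 f2 = f1 + f2) // (innerDl W2 l1 l2' l1).
  rewrite (innerC W2 l1 l2') (dec.2.2.2.2.1 _ _ hf1 hf2) rmorph0 addr0 => -> //.
by rewrite E f10 (_ : Defs.addf 0 f2 = f2) //; apply/funext => x; rewrite /Defs.addf add0r.
Qed.

End Decomposition.
End Fixed.
End ModelSpaces.

(** * Tensors concentrated at a boundary point *)



Section Perturbation.
Variable R : realType.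
Local Notation C := R[i].
Variables (I : eqType) (win : nat -> seq I) (T B : (I -> C) -> I -> C).
Hypotheses (W : exhausting win) (sh : is_shift win T B).
Implicit Types (h g : I -> C).

Lemma nm_sub_le h g : in_l2 win h -> in_l2 win g -> `|nm win h - nm win g| <= nm win (h - g).
Proof.
move=> hh hg; have hd := l2B hh hg.
have h1 := nmD W hd hg; rewrite subrK in h1.
have h2 := nmD W (l2N hd) hh; have E : - (h - g) + h = g by rewrite opprB subrK.
by rewrite E nmN // in h2; rewrite ler_norml; lra.
Qed.

Lemma N2_perturb h g : in_l2 win h -> in_l2 win g ->
  `|N2 win h - N2 win g| <= nm win (h - g) * (nm win h + nm win g).
Proof.
move=> hh hg; rewrite -!(nm_sqr W) // subr_sqr normrM [`|nm win h + nm win g|]ger0_norm ?addr_ge0 ?nm_ge0 //.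
by apply: ler_wpM2r; rewrite ?addr_ge0 ?nm_ge0 //; apply: nm_sub_le.
Qed.

Lemma form_perturb h g : in_l2 win h -> in_l2 win g ->
  cabs (inner win (T h) h - inner win (T g) g) <= nm win (h - g) * (nm win h + nm win g).
Proof.
move=> hh hg; have hd := l2B hh hg; have Th := l2_shift W sh.
have -> : inner win (T h) h - inner win (T g) g = inner win (T (h - g)) h + inner win (T g) (h - g).
  have Td : T (h - g) = T h - T g.
    by rewrite (shD sh) -scaleN1r (shZ sh) scaleN1r.
  rewrite Td (innerBl W) ?(innerBr W) //; try exact: Th.
  by ring.
apply: le_trans (cabsD _ _) _; rewrite mulrDr; apply: lerD.
  by apply: le_trans (cabs_inner W _ _) _; rewrite ?(nm_shift W sh) //; apply: Th.
by apply: le_trans (cabs_inner W _ _) _; rewrite ?(nm_shift W sh) // 1?mulrC //; apply: Th.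
Qed.

End Perturbation.

Section Normalize.
Variable R : realType.
Local Notation C := R[i].

(** Here [s] stands for a squared norm and [z] for a value of the form. Normalisation is done once,
    in the limit, instead of inside the approximations. *)
Lemma clos_normalize (K : R -> C -> Prop) (A : C -> Prop) a :
  (forall s z, K s z -> 0 < s -> A (z / (s%:C)%C)) ->
  (forall e : R, 0 < e -> exists s z, K s z /\ `|s - 1| < e /\ cabs (z - a) < e) -> Clos A a.
Proof.
move=> HK H e e0; have a1 : 0 < 1 + cabs a by rewrite ltr_wpDr ?cabs_ge0.
(* With [s > 1/2], the numerator of [a - z/s] is below [b (1 + |a|) = e/2 < e s]. *)
pose b := e / (1 + cabs a) / 2; have b0 : 0 < b by rewrite !divr_gt0.
have Eb : b * (1 + cabs a) = e / 2 by rewrite /b mulrAC divfK // gt_eqF.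
have d0 : 0 < Num.min (1 / 2) b by rewrite lt_min b0 divr_gt0.
have [s [z [Ksz [hs hz]]]] := H _ d0.
move: hs hz; rewrite !lt_min => /andP[s1 s2] /andP[z1 z2].
have sp : 1 / 2 < s by move: s1; rewrite ltr_norml; lra.
have s0 : 0 < s by lra.
exists (z / (s%:C)%C); split; first exact: HK.
have sC : (s%:C)%C != 0 :> C by rewrite -cabs_eq0 cabs_real normr_eq0 gt_eqF.
rewrite norm_cabs ltcR (_ : a - z / _ = (a * ((s - 1)%:C)%C - (z - a)) / (s%:C)%C); last first.
  by rewrite rmorphB rmorph1 /=; field.
rewrite cabsM cabsV cabs_real gtr0_norm // ltr_pdivrMr //.
apply: le_lt_trans (cabsB _ _) _; rewrite cabsM cabs_real.
have : cabs a * `|s - 1| <= cabs a * b by rewrite ler_wpM2l ?cabs_ge0 // ltW.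
have : e / 2 < e * s by have : e * (1 / 2) < e * s; [rewrite ltr_pM2l|lra].
move: Eb; rewrite mulrDr mulr1 [b * cabs a]mulrC; lra.
Qed.

Lemma Clos_Clos (A : C -> Prop) a :
  (forall e : R, 0 < e -> exists b, Clos A b /\ cabs (a - b) < e) -> Clos A a.
Proof.
move=> H e e0; have e2 : 0 < e / 2 by rewrite divr_gt0.
have [b [Cb hb]] := H _ e2; have [w [Aw]] := Cb _ e2; rewrite norm_cabs ltcR => hw.
exists w; split => //; rewrite norm_cabs ltcR (_ : a - w = (a - b) + (b - w)); last by ring.
by apply: le_lt_trans (cabsD _ _) _; lra.
Qed.

End Normalize.

Section Tensor.
Variable R : realType.
Local Notation C := R[i].
Local Notation W1 := exhausting_win1.
Local Notation W2 := exhausting_win2.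
Implicit Types (phi f : nat -> C).

Definition tens phi f : nat * nat -> C := fun x => phi x.2 * f x.1.

Lemma nS_tens phi f N : nS win2 (tens phi f) N = nS win1 phi N * nS win1 f N.
Proof.
rewrite /nS big_win2 !big_win1 mulr_sumr; apply: eq_bigr => i _.
by rewrite mulr_suml; apply: eq_bigr => j _; rewrite /tens nsqM.
Qed.

Lemma l2_tens phi f : in_l2 win1 phi -> in_l2 win1 f -> in_l2 win2 (tens phi f).
Proof.
move=> hp hf; apply/in_l2E; exists (N2 win1 phi * N2 win1 f) => N; rewrite nS_tens.
by apply: ler_pM; rewrite ?nS_ge0 ?(nS_le_N2 W1).
Qed.

Lemma inner_tens phi f psi g : in_l2 win1 phi -> in_l2 win1 f -> in_l2 win1 psi -> in_l2 win1 g ->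
  inner win2 (tens phi f) (tens psi g) = inner win1 phi psi * inner win1 f g.
Proof.
move=> hp hf hq hg; apply: inner_eq; have := cvgCM (cvg_inner W1 hp hq) (cvg_inner W1 hf hg).
congr cvgC; apply/funext => N; rewrite big_win2 !big_win1 mulr_sumr; apply: eq_bigr => i _.
by rewrite mulr_suml; apply: eq_bigr => j _; rewrite /tens rmorphM /=; ring.
Qed.

Lemma N2_tens phi f : in_l2 win1 phi -> in_l2 win1 f -> N2 win2 (tens phi f) = N2 win1 phi * N2 win1 f.
Proof.
move=> hp hf; apply: realc_inj; rewrite -(innerN2 W2); last exact: l2_tens.
by rewrite inner_tens // !(innerN2 W1) // rmorphM.
Qed.

Lemma Mz1_tens phi f : Mz1 (tens phi f) = tens phi (Mz f).
Proof. by apply/funext => -[[|k] l]; rewrite /tens /Mz1 /= ?mulr0. Qed.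

Lemma acts2_tens1 (q : {poly C}) phi f : acts2 q%:P (tens phi f) = tens phi (acts1 q f).
Proof.
apply/funext => -[k l]; rewrite acts2E big_ord_recl [X in _ + X]big1 ?addr0; last first.
  by move=> j _; rewrite big1 // => i _; rewrite coefC /= coef0 mul0r.
rewrite /tens /= acts1E mulr_sumr; apply: eq_bigr => i _; rewrite coefC /= subn0; ring.
Qed.

Lemma acts2_tens2 (q : {poly C}) phi f : acts2 q^:P (tens phi f) = tens (acts1 q phi) f.
Proof.
rewrite (acts2_z2 _ (leqnSn _)) (acts1_wide _ (leqnSn _)); apply/funext => -[k l].
rewrite !fct_sumE [RHS]/tens /= mulr_suml; apply: eq_bigr => i _.
rewrite -[LHS]/(q`_i * iter i (@Mz2 R) (tens phi f) (k, l)).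
rewrite -[RHS]/(q`_i * iter i (@Mz R) phi l * f k) iter_Mz2 iter_Mz /tens /=.
by case: ifP => _; rewrite ?mulrA // !mulr0 mul0r.
Qed.

Lemma N2_cf (v : {poly C}) M : (size v <= M)%N ->
  in_l2 win1 (cf v) /\ N2 win1 (cf v) = \sum_(i < M) nsq v`_i.
Proof.
move=> sv; have key N : nS win1 (cf v) N <= \sum_(i < M) nsq v`_i.
  rewrite /nS big_win1; apply: (@le_trans _ _ (\sum_(i < maxn N M) nsq v`_i)).
    rewrite (big_ord_widen _ (fun i => nsq v`_i) (leq_maxl N M)) big_mkcond; apply: ler_sum => i _.
    by case: ifP => // _; apply: nsq_ge0.
  rewrite (big_ord_widen _ (fun i => nsq v`_i) (leq_maxr N M)) [X in _ <= X]big_mkcond.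
  apply: ler_sum => i _; case: ltnP => // h; rewrite nth_default ?nsq0 //; exact: leq_trans h.
have hl : in_l2 win1 (cf v) by apply/in_l2E; eexists; apply: key.
split=> //; apply/eqP; rewrite eq_le; apply/andP; split; first exact: (N2_le W1 key).
by have := nS_le_N2 W1 M hl; rewrite /nS big_win1.
Qed.

(** The Dirichlet kernel at [tau], with coefficients [conj(tau)^j] for [j <= k]: multiplication by
    [z - tau] telescopes to two unimodular coefficients, negligible against the squared norm
    [k + 1]. *)
Lemma fejer (tau : C) k : cabs tau = 1 -> exists phi,
  [/\ in_l2 win1 phi, N2 win1 phi = k.+1%:R & N2 win1 (acts1 ('X - tau%:P) phi) = 2].
Proof.
move=> t1; pose v : {poly C} := \poly_(j < k.+1) (tau^*) ^+ j; exists (cf v).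
have [h1 h2] := N2_cf (size_poly _ _ : (size v <= k.+1)%N); split => //.
  rewrite h2 (eq_bigr (fun=> 1)) ?sumr_const ?card_ord // => i _.
  by rewrite coef_poly ltn_ord /nsq cabsX cabs_conj t1 !expr1n.
have cu := conj_unit t1.
have E : ('X - tau%:P) * v = (tau^* ^+ k) *: 'X^(k.+1) - tau%:P.
  apply/polyP => i; rewrite mulrBl !coefB coefXM coefCM !coef_poly coefZ coefXn coefC.
  case: i => [|i] /=; first by rewrite mulr1 mulr0.
  rewrite ltnS eqSS subr0; case: (ltngtP i k) => ik.
  - by rewrite ltnS ik exprS mulrA cu mul1r subrr mulr0.
  - by rewrite ltnS ltnNge (ltnW ik) /= mulr0 subrr mulr0.
  - by rewrite ik ltnn mulr0 subr0 mulr1.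
have sE : (size (('X - tau%:P) * v)%R <= k.+2)%N.
  by apply: leq_trans (size_polyMleq _ _) _; rewrite size_XsubC /= ltnS size_poly.
rewrite acts1_cf; have [_ ->] := N2_cf sE; rewrite big_ord_recl big_ord_recr /= E.
rewrite big1 => [|i _]; last first.
  rewrite coefB coefZ coefXn coefC /= /bump /= add1n eqSS.
  by rewrite ltn_eqF // mulr0 subr0 nsq0.
rewrite !coefB !coefZ !coefXn !coefC /= /bump /= add1n eqxx mulr0 mulr1 sub0r subr0 nsqN.
by rewrite /nsq cabsX cabs_conj t1 !expr1n; lra.
Qed.

End Tensor.

(** * Convex combinations of slices are approximated *)



Lemma poly_split (A : comNzRingType) (q : {poly A}) a : exists s, q = (q.[a])%:P + ('X - a%:P) * s.
Proof.
have /factor_theorem [s Es] : root (q - (q.[a])%:P) a by rewrite rootE !hornerE subrr.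
by exists s; rewrite mulrC -Es addrC subrK.
Qed.

Section Superset.
Variable R : realType.
Local Notation C := R[i].
Local Notation W1 := exhausting_win1.
Local Notation W2 := exhausting_win2.
Local Notation H1 := (shift_Mz1 R).
Local Notation H2 := (shift_Mz2 R).
Local Notation N2' := (N2 win2).
Local Notation nm2 := (nm win2).
Local Notation l2' := (in_l2 win2).

Definition form2 (h : nat * nat -> C) : C := inner win2 (Mz1 h) h.

Lemma form2Z c h : l2' h -> form2 (c *: h) = ((nsq c)%:C)%C * form2 h.
Proof.
move=> hh; have hM := l2_shift W2 H1 hh.
by rewrite /form2 (shZ H1) (innerZl W2) ?(innerZr W2) // ?mulrA ?mulr_conj //; apply: l2Z.
Qed.

Lemma Mz1_iter2 k f : Mz1 (iter k (@Mz2 R) f) = iter k (@Mz2 R) (Mz1 f).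
Proof. by elim: k => //= k <-; rewrite Mz12C. Qed.

Lemma form2_iter k h : l2' h -> form2 (iter k (@Mz2 R) h) = form2 h.
Proof. by move=> hh; rewrite /form2 Mz1_iter2 (inner_iter W2 H2) //; apply: (l2_shift W2 H1). Qed.

Lemma form2_tens phi f : in_l2 win1 phi -> in_l2 win1 f ->
  form2 (tens phi f) = ((N2 win1 phi)%:C)%C * inner win1 (Mz f) f.
Proof.
move=> hp hf; rewrite /form2 Mz1_tens inner_tens // ?(innerN2 W1) //.
exact: (l2_shift W1 (shift_Mz R)).
Qed.

Section Appr.
Variable S : (nat * nat -> C) -> Prop.
Hypotheses (Sl2 : forall f, S f -> l2' f) (S0 : S 0)
  (SD : forall f g, S f -> S g -> S (f + g)) (SZ : forall c f, S f -> S (c *: f))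
  (SM : forall f, S f -> S (Mz2 f)).

Definition appr (s : R) (z : C) := forall e : R, 0 < e ->
  exists h, S h /\ `|N2' h - s| < e /\ cabs (form2 h - z) < e.

Lemma appr0 : appr 0 0.
Proof.
move=> e e0; exists 0; split=> //; rewrite /form2 /N2 !inner0l inner0r !subrr cabs0.
by rewrite normr0.
Qed.

Lemma apprZ t s z : 0 <= t -> appr s z -> appr (t * s) ((t%:C)%C * z).
Proof.
move=> t0 H e e0; have t1 : 0 < t + 1 by rewrite ltr_wpDl.
have [h [Sh [h1 h2]]] := H _ (divr_gt0 e0 t1); have hh := Sl2 Sh.
exists (((Num.sqrt t)%:C)%C *: h); split; first exact: SZ.
have E : nsq ((Num.sqrt t)%:C)%C = t by rewrite /nsq cabs_real ger0_norm ?sqrtr_ge0 // sqr_sqrtr.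
have key (x : R) : 0 <= x -> x < e / (t + 1) -> t * x < e.
  move=> x0; rewrite ltr_pdivlMr // => xe; nra.
rewrite (N2Z W2) // form2Z // E -!mulrBr normrM cabsM cabs_real !(ger0_norm t0).
by split; apply: key => //; apply: cabs_ge0.
Qed.

Lemma apprD s z s' z' : appr s z -> appr s' z' -> appr (s + s') (z + z').
Proof.
move=> Ha Hb e e0; have e4 : 0 < e / 4 by rewrite divr_gt0.
have [h [Sh [h1 h2]]] := Ha _ e4; have [g [Sg [g1 g2]]] := Hb _ e4.
have hh := Sl2 Sh; have hg := Sl2 Sg.
have Mh := l2_shift W2 H1 hh; have Mg := l2_shift W2 H1 hg.
have e8 : 0 < e / 8 by rewrite divr_gt0.
(* Three cross terms: one in the squared norm of [h + z2^k g], and two in its form, where z1 falls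
   on either vector. *)
have [N1 HN1] := weak_shift W2 H2 hg hh e8.
have [N2 HN2] := weak_shift W2 H2 hg Mh e8.
have [N3 HN3] := weak_shift W2 H2 Mg hh e8.
pose k := (N1 + N2 + N3)%N.
have {}HN1 := HN1 k (leq_trans (leq_addr N2 N1) (leq_addr _ _)).
have {}HN2 := HN2 k (leq_trans (leq_addl N1 N2) (leq_addr _ _)).
have {}HN3 := HN3 k (leq_addl _ _).
pose gk := iter k (@Mz2 R) g; have hgk : l2' gk by apply: (l2_iter W2 H2).
exists (h + gk); split; first by apply: SD => //; rewrite /gk; elim: (k) => //= j IH; apply: SM.
have Mgk := l2_shift W2 H1 hgk.
have hd := l2D hh hgk.
split.
  rewrite (N2D W2) // /gk (N2_iter W2 H2) // -/gk (innerC W2 hgk hh) cRe_conj.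
  have := le_trans (normRe_le_cabs _) HN1; move: h1 g1; rewrite !ltr_norml ler_norml -/gk.
  by set x := Re _; move=> /andP[??] /andP[??] /andP[??]; apply/andP; split; lra.
have -> : form2 (h + gk) - (z + z') = ((form2 h - z) + (form2 g - z')) +
    ((inner win2 gk (Mz1 h))^* + inner win2 (iter k (@Mz2 R) (Mz1 g)) h).
  rewrite {1}/form2 (shD H1) (innerDl W2) // !(innerDr W2) // -(innerC W2 hgk Mh).
  rewrite -!/(form2 _) /gk form2_iter // Mz1_iter2; ring.
apply: le_lt_trans (cabsD _ _) _.
have := cabsD (form2 h - z) (form2 g - z').
have := cabsD (inner win2 gk (Mz1 h))^* (inner win2 (iter k (@Mz2 R) (Mz1 g)) h).
rewrite cabs_conj; lra.
Qed.

Lemma appr_close a : (forall eta : R, 0 < eta -> exists h u, [/\ S h, l2' u, N2' u = 1,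
   form2 u = a & nm2 (h - u) <= eta]) -> appr 1 a.
Proof.
move=> H e e0; have m0 : 0 < Num.min 1 (e / 4) by rewrite lt_min ltr01 divr_gt0.
have [h [u [Sh hu Nu Fu]]] := H _ m0; rewrite le_min => /andP[d1 d2].
have hh := Sl2 Sh; exists h; split => //.
have nu : nm2 u = 1 by rewrite /nm Nu sqrtr1.
have nh : nm2 h <= 2 by have := nm_sub_le W2 hh hu; rewrite nu ler_norml; lra.
have d0 := nm_ge0 win2 (h - u); have nh0 := nm_ge0 win2 h.
have key : nm2 (h - u) * (nm2 h + nm2 u) < e by rewrite nu; nra.
by rewrite -Nu -Fu; split; apply: (le_lt_trans _ key); [exact: (N2_perturb W2 hh hu)|exact: (form_perturb W2 H1 hh hu)].
Qed.

Lemma appr_Conv (A : C -> Prop) a : (forall b, A b -> appr 1 b) -> Conv A a -> appr 1 a.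
Proof.
move=> HA [k [t [b [t0 [t1 [Ab ->]]]]]]; rewrite -t1.
elim/big_ind2: _ => [||i _]; [exact: appr0|by move=> *; apply: apprD|].
by rewrite -[X in appr X _]mulr1; apply: apprZ => //; apply: HA.
Qed.

End Appr.

Section Fixed.
Variables (m n : nat) (p : {poly {poly C}}) (r : {poly C}) (A B : {poly {poly C}}).
Hypotheses (degp : deg_le m n p) (nz : no_zeros_bidisk p) (cop : coprime2 (refl m n p) p).
Hypothesis Er : r^:P = A * p + B * refl m n p.
Local Notation pt := (refl m n p).
Variables (S1 S2 : (nat * nat -> C) -> Prop).
Hypotheses (dec : orth_decomp (model2 pt p) S1 S2)
  (inv1 : forall f, S1 f -> S1 (Mz1 f)) (inv2 : forall f, S2 f -> S2 (Mz2 f)).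

(* The z2-part [phi] of [tens phi f] concentrates at [tau]; the correction [r v] restores the
   degree condition on [p h']. *)
Lemma slice_appr tau f : cabs tau = 1 -> r.[tau] != 0 ->
  model1 (slice pt tau) (slice p tau) f -> N2 win1 f = 1 ->
  appr S2 1 (inner win1 (Mz f) f).
Proof.
move=> t1 r0 Kf Nf; apply: appr_close; first exact: S2_l2 dec.
have hf : in_l2 win1 f by case: Kf.
have tau0 : tau != 0 by rewrite -cabs_eq0 t1 oner_eq0.
set rs := refl1 (size r) r.
have rs0 : rs.[tau] != 0.
  rewrite refl1_horner // mulf_neq0 ?expf_neq0 // conjC_eq0.
  have -> : (tau^*)^-1 = tau; last by [].
  by apply: (mulfI (x := tau^*)); rewrite ?conjC_eq0 // divff ?conjC_eq0 // mulrC conj_unit.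
(* Near [tau] the two multiplications by [r] and by its reflection amount to multiplication by [c0],
   which must not vanish. *)
pose c0 := (rs * r).[tau]; have c00 : c0 != 0 by rewrite /c0 hornerM mulf_neq0.
have [s Es] := poly_split p tau%:P; rewrite -sliceE in Es.
have [s' Es'] := poly_split (rs * r)^:P tau%:P; rewrite horner_map -/c0 in Es'.
have [Ks [Ks0 HKs]] := bdd_acts2 s; have [Kq [Kq0 HKq]] := bdd_acts2 s'.
have [Kr [Kr0 HKr]] := bdd_acts2 rs^:P; have [K1 [K10 HK1]] := multiplier2 degp nz cop Er.
(* [D |c0|] will bound the distance of [h''] from [c0 u] for every [k]. As the squared norm of [u]
   is [k + 1], normalising leaves the error [D / sqrt (k + 1)]. *)
pose D := (Kq + Kr * (K1 * Ks)) * Num.sqrt 2 / cabs c0.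
have c0p : 0 < cabs c0 by rewrite lt_def cabs_eq0 c00 cabs_ge0.
have D0 : 0 <= D by rewrite /D !mulr_ge0 ?invr_ge0 ?addr_ge0 ?mulr_ge0 ?sqrtr_ge0 // ltW.
move=> eta eta0; have D1 : 0 < D + 1 by rewrite ltr_wpDl.
have [k HK] := iv_small (exprn_gt0 2 (divr_gt0 eta0 D1)); have {}HK := HK k (leqnn k).
have [phi [hp Np Ny]] := fejer k t1.
pose u := tens phi f; have hu : l2' u by apply: l2_tens.
pose y := tens (acts1 ('X - tau%:P) phi) f.
have hy : l2' y by apply: l2_tens => //; apply: l2_acts1.
have Ey : acts2 ('X - (tau%:P)%:P) u = y.
  rewrite /y -acts2_tens2; congr acts2.
  by rewrite rmorphB /= map_polyX map_polyC.
have ny : nm2 y = Num.sqrt 2 by rewrite /nm N2_tens ?Ny ?Nf ?mulr1 //; apply: l2_acts1.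
have Epu : acts2 p u = tens phi (acts1 (slice p tau) f) + acts2 s y.
  by rewrite {1}Es (actDl (acts2_action R)) acts2_tens1 mulrC (actM (acts2_action R)) Ey.
have [hsy nsy] := HKs _ hy.
(* In [p u], the first summand already has z1-degree below [m]; the second, [s (z2 - tau) u], is
   removed by subtracting its quotient [v] by [p]. Only [r v] is square-summable, so [r (u - v)] is
   used. *)
have [v Ev] := solve2 (acts2 s y) (p00 nz).
have [hw nw] := HK1 v ltac:(by rewrite Ev); rewrite Ev in nw.
set w := acts2 r^:P v in hw nw.
pose h' := acts2 r^:P u - w; have hh' : l2' h' by apply: l2B => //; apply: l2_acts2.
have h'V a b : (m <= a)%N -> acts2 p h' (a, b) = 0.
  move=> ma; rewrite (_ : acts2 p h' = tens (acts1 r phi) (acts1 (slice p tau) f)).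
    by rewrite /tens /= (model1_vanish degp t1 Kf ma) mulr0.
  rewrite /h' /w (actBr _ _ _ (acts2_action R)) !(acts2C p) -(actBr _ _ _ (acts2_action R)).
  by rewrite Ev Epu addrK acts2_tens2.
have [J HJ] := lift_S2 degp Er dec inv1 hh' h'V; rewrite -/rs in HJ.
set h'' := acts2 rs^:P h' in HJ; have hh'' : l2' h'' by apply: l2_acts2.
have dist : nm2 (h'' - c0 *: u) <= (Kq + Kr * (K1 * Ks)) * Num.sqrt 2.
  have [h1 h2] := HKq _ hy; have [h3 h4] := HKr _ hw.
  have -> : h'' - c0 *: u = acts2 s' y - acts2 rs^:P w.
    rewrite /h'' /h' (actBr _ _ _ (acts2_action R)) -(actM (acts2_action R)) -rmorphM /= Es'.
    rewrite (actDl (acts2_action R)) acts2_const [_ * s']mulrC (actM (acts2_action R)) Ey.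
    by rewrite addrAC [c0 *: u + _]addrC addrK.
  apply: le_trans (nmB W2 h1 h3) _; rewrite -ny mulrDl; apply: lerD => //.
  apply: le_trans h4 _; rewrite -!mulrA; apply: ler_wpM2l => //.
  by apply: le_trans nw _; apply: ler_wpM2l.
have kp : 0 < k.+1%:R :> R by rewrite ltr0n.
pose ga := (c0 * ((Num.sqrt k.+1%:R)%:C)%C)^-1.
have sk0 : 0 < Num.sqrt k.+1%:R :> R by rewrite sqrtr_gt0.
have Ega : cabs ga = (cabs c0)^-1 * Num.sqrt (iv R k).
  by rewrite /ga cabsV cabsM cabs_real ger0_norm ?sqrtr_ge0 // invfM /iv sqrtrV.
have Egc : nsq (ga * c0) = iv R k.
  by rewrite nsqM /nsq Ega exprMn sqr_sqrtr ?ltW ?iv_gt0 // mulrAC -exprMn mulVf ?gt_eqF // expr1n mul1r.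
have ivk : iv R k * k.+1%:R = 1 by rewrite /iv mulVf // gt_eqF.
have hJu : l2' (iter J (@Mz2 R) u) by apply: (l2_iter W2 H2).
exists (ga *: iter J (@Mz2 R) h''), ((ga * c0) *: iter J (@Mz2 R) u); split.
- by apply: (S2_Z dec).
- exact: l2Z.
- by rewrite (N2Z W2) // (N2_iter W2 H2) // N2_tens // Egc Np Nf mulr1.
- by rewrite form2Z // form2_iter // form2_tens // Egc Np mulrA -rmorphM ivk mul1r.
have -> : ga *: iter J (@Mz2 R) h'' - (ga * c0) *: iter J (@Mz2 R) u = ga *: iter J (@Mz2 R) (h'' - c0 *: u).
  rewrite -scalerA -scalerBr; congr (_ *: _).
  rewrite (iter_addf (shD H2)) -[- (c0 *: u)]scaleNr -scaleNr; congr (_ + _).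
  by elim: (J) => //= j <-; rewrite (shZ H2).
have hdd : l2' (h'' - c0 *: u) by apply: l2B => //; apply: l2Z.
rewrite (nmZ W2); last exact: (l2_iter W2 H2).
rewrite (nm_iter W2 H2) // Ega.
have sq : Num.sqrt (iv R k) <= eta / (D + 1).
  have q0 : 0 <= eta / (D + 1) by rewrite ltW ?divr_gt0.
  by rewrite -(@ler_sqr _ (Num.sqrt _)) ?nnegrE ?sqrtr_ge0 // sqr_sqrtr // ltW // iv_gt0.
apply: (@le_trans _ _ (D * Num.sqrt (iv R k))).
  rewrite mulrAC; apply: ler_wpM2r; first exact: sqrtr_ge0.
  by rewrite mulrC /D; apply: ler_wpM2r => //; rewrite invr_ge0 ltW.
apply: (@le_trans _ _ (D * (eta / (D + 1)))); first exact: ler_wpM2l.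
rewrite mulrA ler_pdivrMr // mulrC ler_pM2l //; lra.
Qed.

End Fixed.
End Superset.

(** * Removing the resultant *)



Section Cone.
Variable R : realType.
Local Notation C := R[i].
Variable A : C -> Prop.

(** The convex cone generated by the pairs [(1, a)] with [a] in [A]. The first component records the
    total weight, so that null vectors and vectors of any norm are treated alike. *)
Inductive cone : R -> C -> Prop :=
| cone0 : cone 0 0
| coneS s z t a : cone s z -> 0 < t -> A a -> cone (s + t) (z + (t%:C)%C * a).

Lemma coneD s z s' z' : cone s z -> cone s' z' -> cone (s + s') (z + z').
Proof.
by move=> H; elim=> [|s1 z1 t a _ IH t0 Aa]; rewrite ?addr0 // !addrA; apply: coneS.
Qed.

Lemma coneZ c s z : 0 < c -> cone s z -> cone (c * s) ((c%:C)%C * z).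
Proof.
move=> c0; elim=> [|s1 z1 t a _ IH t0 Aa]; first by rewrite !mulr0; apply: cone0.
by rewrite !mulrDr mulrA -rmorphM; apply: coneS => //; apply: mulr_gt0.
Qed.

Lemma cone_sum (J : Type) (l : seq J) (F : J -> R) (G : J -> C) :
  (forall j, cone (F j) (G j)) -> cone (\sum_(j <- l) F j) (\sum_(j <- l) G j).
Proof.
by move=> H; elim/big_ind2: _ => [||//]; [exact: cone0|move=> *; apply: coneD].
Qed.

Lemma cone_Conv s z : cone s z -> 0 < s -> Conv A (z / (s%:C)%C).
Proof.
move=> H s0.
have [k [t [a [H1 [Es Ez]]]]] : exists k (t : nat -> R) (a : nat -> C),
   (forall i, (i < k)%N -> 0 <= t i /\ A (a i)) /\ s = \sum_(i < k) t i /\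
   z = \sum_(i < k) ((t i)%:C)%C * a i.
  elim: H {s0} => [|s1 z1 t1 a1 _ [k [t [a [H1 [Es Ez]]]]] t10 Aa].
    by exists 0%N, (fun=> 0), (fun=> 0); rewrite !big_ord0.
  exists k.+1, (fun i => if (i < k)%N then t i else t1), (fun i => if (i < k)%N then a i else a1).
  split; first by move=> i _; case: ifP => [/H1//|_]; split => //; apply: ltW.
  rewrite !big_ord_recr /= ltnn Es Ez; split; congr (_ + _); apply: eq_bigr => i _; by rewrite ltn_ord.
exists k, (fun i => t i / s), (fun i => a i); split.
  by move=> i; rewrite divr_ge0 ?(ltW s0) //; apply: (H1 _ (ltn_ord i)).1.
split; first by rewrite -mulr_suml -Es divff // gt_eqF.
split; first by move=> i; apply: (H1 _ (ltn_ord i)).2.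
rewrite Ez mulr_suml; apply: eq_bigr => i _.
by rewrite (rmorphM (real_complex R)) /= (fmorphV (real_complex R)) mulrAC.
Qed.

Definition acone (s : R) (z : C) := forall e : R, 0 < e ->
  exists s' z', cone s' z' /\ `|s' - s| < e /\ cabs (z' - z) < e.

Lemma acone_lim (y : nat * nat -> C) : in_l2 win2 y ->
  (forall eta : R, 0 < eta -> exists y', [/\ in_l2 win2 y', nm win2 (y' - y) <= eta &
      acone (N2 win2 y') (form2 y')]) -> acone (N2 win2 y) (form2 y).
Proof.
move=> hy H e e0; pose G := nm win2 y; have G0 : 0 <= G := nm_ge0 win2 y.
have d0 : 0 < Num.min 1 (e / 2 / (2 * G + 1)).
  by rewrite lt_min ltr01 !divr_gt0 // ltr_wpDl // mulr_ge0.
have [y' [hy']] := H _ d0; rewrite le_min => /andP[d1 d2].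
have e2 : 0 < e / 2 by rewrite divr_gt0.
move=> /(_ _ e2) [s' [z' [K [h1 h2]]]]; exists s', z'; split => //.
rewrite ler_pdivlMr in d2; last by rewrite ltr_wpDl // mulr_ge0.
have n0 := nm_ge0 win2 (y' - y).
have ny' : nm win2 y' <= G + 1.
  by have := nm_sub_le exhausting_win2 hy' hy; rewrite ler_norml -/G; lra.
have key : nm win2 (y' - y) * (nm win2 y' + nm win2 y) <= e / 2.
  apply: le_trans d2; rewrite -/G; apply: ler_wpM2l => //; lra.
have p1 := le_trans (N2_perturb exhausting_win2 hy' hy) key.
have p2 := le_trans (form_perturb exhausting_win2 (shift_Mz1 R) hy' hy) key.
split.
  by move: p1 h1; rewrite ler_norml !ltr_norml => /andP[??] /andP[??]; apply/andP; split; lra.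
rewrite (_ : z' - _ = (z' - form2 y') + (form2 y' - form2 y)); last by ring.
by apply: le_lt_trans (cabsD _ _) _; rewrite /form2 in h2 *; lra.
Qed.

End Cone.

Section RemoveFactors.
Variable R : realType.
Local Notation C := R[i].
Local Notation W2 := exhausting_win2.
Local Notation H1 := (shift_Mz1 R).
Local Notation H2 := (shift_Mz2 R).
Local Notation l2' := (in_l2 win2).
Local Notation N2' := (N2 win2).

Lemma acts2_X f : acts2 'X f = Mz2 f :> (nat * nat -> C).
Proof. by rewrite /acts2 pactX //; [exact: acts21_action|exact: (shD H2)]. Qed.

Lemma acts2_Xn k f : acts2 'X^k f = iter k (@Mz2 R) f.
Proof.
elim: k => [|k IH]; first by rewrite expr0 (act1 (acts2_action R)).
by rewrite exprS (actM (acts2_action R)) IH acts2_X.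
Qed.

(* If [n] is large then [z2^n y] is almost orthogonal to what was built before, so the sum
   of [k] such terms has norm [O(sqrt k)] only. *)
Lemma sparse_mean (b : C) y k : l2' y -> cabs b <= 1 -> exists phi psi : {poly C},
  (1 - b *: 'X) * phi = (k%:R)%:P - psi /\ N2' (acts2 psi^:P y) <= k%:R * (N2' y + 2).
Proof.
move=> hy b1; elim: k => [|k [phi [psi [E H]]]].
  exists 0, 0; rewrite mulr0 subr0 polyC0 mul0r rmorph0 (act0l _ (acts2_action R)).
  by rewrite /N2 inner0l.
have hpsi : l2' (acts2 psi^:P y) by apply: l2_acts2.
have [N HN] := weak_shift W2 H2 hy hpsi ltr01; have {}HN := HN N (leqnn N).
(* The geometric sum times [1 - b X] is [1 - b^N X^N]. Divided by [k], the identity says that [y] is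
   a multiple of [(1 - b z2) y] up to [psi y / k]; the 2 in the bound absorbs the cross term. *)
exists (phi + \sum_(i < N) (b *: 'X) ^+ i), (psi + (b ^+ N) *: 'X^N); split.
  rewrite mulrDr E; have := subrX1 (b *: 'X) N => EX.
  have -> : (1 - b *: 'X) * \sum_(i < N) (b *: 'X) ^+ i = 1 - (b ^+ N) *: 'X^N.
    by rewrite -opprB mulNr -EX opprB exprZn.
  by rewrite -natr1 polyCD polyC1; ring.
have hi : l2' (iter N (@Mz2 R) y) by apply: (l2_iter W2 H2).
have -> : acts2 (psi + b ^+ N *: 'X^N)^:P y = b ^+ N *: iter N (@Mz2 R) y + acts2 psi^:P y.
  rewrite rmorphD (actDl (acts2_action R)) addrC; congr (_ + _).
  rewrite -mul_polyC rmorphM /= map_polyC /= map_polyXn (actM (acts2_action R)) acts2_const.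
  by rewrite acts2_Xn.
have bN : cabs (b ^+ N) <= 1 by rewrite cabsX exprn_ile1 ?cabs_ge0.
rewrite (N2D W2) //; last exact: l2Z.
rewrite (N2Z W2) // (N2_iter W2 H2) // (innerZl W2) //.
have h1 : nsq (b ^+ N) * N2' y <= N2' y.
  by rewrite ler_piMl ?(N2_ge0 W2) // /nsq exprn_ile1 ?cabs_ge0.
have h2 := Re_le_cabs (b ^+ N * inner win2 (iter N (@Mz2 R) y) (acts2 psi^:P y)).
have h3 : cabs (b ^+ N * inner win2 (iter N (@Mz2 R) y) (acts2 psi^:P y)) <= 1.
  rewrite cabsM -[X in _ <= X]mulr1; apply: ler_pM => //; exact: cabs_ge0.
rewrite -natr1 mulrDl mul1r; lra.
Qed.

(** [|z - al|] and [|1 - conj(al) z|] agree on the circle. Norm and form of a vector thus do not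
    change when a root is reflected across the circle. *)
Lemma inner_reflect (al : C) u y : l2' u -> l2' y ->
  inner win2 (Mz2 u - al *: u) (Mz2 y - al *: y) =
  inner win2 (u - al^* *: Mz2 u) (y - al^* *: Mz2 y).
Proof.
move=> hu hy; have hMu := l2_shift W2 H2 hu; have hMy := l2_shift W2 H2 hy.
have h1 := l2Z al hu; have h2 := l2Z al hy.
have h3 := l2Z al^* hMu; have h4 := l2Z al^* hMy.
rewrite (innerBl W2 hMu h1 (l2B hMy h2)) (innerBl W2 hu h3 (l2B hy h4)).
rewrite (innerBr W2 hMy h2 hMu) (innerBr W2 hMy h2 h1) (innerBr W2 hy h4 hu) (innerBr W2 hy h4 h3).
rewrite (innerZr W2 _ hy hMu) (innerZl W2 _ hu hMy) (innerZl W2 _ hu h2) (innerZr W2 _ hy hu).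
rewrite (innerZr W2 _ hMy hu) (innerZl W2 _ hMu hy) (innerZl W2 _ hMu h4) (innerZr W2 _ hMy hMu).
by rewrite (inner_shift W2 H2) // conjCK; ring.
Qed.

Variable A : C -> Prop.
Variable S : (nat * nat -> C) -> Prop.
Hypotheses (Sl2 : forall f, S f -> l2' f) (SZ : forall c f, S f -> S (c *: f))
  (SP : forall q f, S f -> S (acts2 q^:P f)).

Local Notation ac y := (acone A (N2' y) (form2 y)).
Definition acpoly (q : {poly C}) := forall h, S h -> ac (acts2 q^:P h).

Lemma acts2_z2Z c (q : {poly C}) h : acts2 (c *: q)^:P h = c *: acts2 q^:P h.
Proof. by rewrite -mul_polyC rmorphM /= map_polyC (actM (acts2_action R)) acts2_const. Qed.

Lemma acts2Zr q c h : acts2 q (c *: h) = c *: acts2 q h :> (nat * nat -> C).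
Proof. by rewrite -!acts2_const acts2C. Qed.

Lemma acpoly_scale c q : c != 0 -> acpoly (c *: q) -> acpoly q.
Proof.
move=> c0 H h Sh; have := H _ (SZ c^-1 Sh).
by rewrite acts2_z2Z acts2Zr scalerA divff // scale1r.
Qed.

(** A root in the closed disk is reflected and any other rescaled, so the factor becomes [1 - b z2]
    with [|b| <= 1]. The case [|b| = 1], where the factor has no bounded inverse, is why the mean in
    [sparse_mean] is needed. *)
Lemma acpoly_factor al q : acpoly (('X - al%:P) * q) -> acpoly q.
Proof.
move=> H.
have [b [b1 Hb]] : exists b, cabs b <= 1 /\ acpoly ((1 - b *: 'X) * q).
  have [al1|al1] := leP (cabs al) 1.
    exists al^*; rewrite cabs_conj; split; first exact: al1.
    move=> h Sh; have := H _ Sh.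
    set y := acts2 q^:P h; have hy : l2' y by apply: l2_acts2; apply: Sl2.
    have E1 : acts2 (('X - al%:P) * q)^:P h = Mz2 y - al *: y.
      rewrite rmorphM /= (actM (acts2_action R)) -/y rmorphB /= map_polyX map_polyC.
      by rewrite (actBl _ _ _ (acts2_action R)) acts2_const acts2_X.
    have E2 : acts2 ((1 - al^* *: 'X) * q)^:P h = y - al^* *: Mz2 y.
      rewrite rmorphM /= (actM (acts2_action R)) -/y rmorphB rmorph1 /=.
      rewrite (actBl _ _ _ (acts2_action R)) (act1 (acts2_action R)) acts2_z2Z.
      by rewrite map_polyX acts2_X.
    rewrite E1 E2; have -> : N2' (Mz2 y - al *: y) = N2' (y - al^* *: Mz2 y).
      by rewrite /N2 inner_reflect.
    have -> // : form2 (Mz2 y - al *: y) = form2 (y - al^* *: Mz2 y).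
    have hM := l2_shift W2 H1 hy; have := inner_reflect al hM hy; rewrite /form2.
    have L c (f g : nat * nat -> C) : Mz1 (f - c *: g) = Mz1 f - c *: Mz1 g.
      by rewrite (shD H1) -scaleNr (shZ H1) scaleNr.
    by rewrite !L Mz12C.
  have al0 : al != 0 by rewrite -cabs_eq0 gt_eqF // (lt_trans ltr01).
  exists al^-1; split; first by rewrite cabsV invf_le1 ?ltW // (lt_trans ltr01).
  apply: (@acpoly_scale (- al)); first by rewrite oppr_eq0.
  by rewrite scalerAl scalerBr scalerA mulNr (divff al0) !scaleNr scale1r opprK alg_polyC addrC.
move=> h Sh; set y := acts2 q^:P h; have hy : l2' y by apply: l2_acts2; apply: Sl2.
apply: acone_lim => // eta eta0.
have c0 : 0 < N2' y + 2 by rewrite ltr_wpDl ?(N2_ge0 W2).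
have [k HK] := iv_small (divr_gt0 (exprn_gt0 2 eta0) c0); have {}HK := HK k (leqnn k).
have [phi [psi [E HN]]] := sparse_mean k.+1 hy b1.
have kp : 0 < k.+1%:R :> R by rewrite ltr0n.
have kC : k.+1%:R != 0 :> C by rewrite pnatr_eq0.
exists (acts2 ((1 - b *: 'X) * q)^:P ((k.+1%:R)^-1 *: acts2 phi^:P h)).
have hpsi : l2' (acts2 psi^:P y) by apply: l2_acts2.
have EY : acts2 ((1 - b *: 'X) * q)^:P ((k.+1%:R)^-1 *: acts2 phi^:P h) =
    y - (k.+1%:R)^-1 *: acts2 psi^:P y.
  rewrite acts2Zr -(actM (acts2_action R)) -rmorphM /= mulrAC E mulrBl rmorphB /=.
  rewrite (actBl _ _ _ (acts2_action R)) !rmorphM /= map_polyC /= !(actM (acts2_action R)).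
  by rewrite acts2_const -/y scalerBr scalerA mulVf // scale1r.
split; first by rewrite EY; apply: l2B => //; apply: l2Z.
  rewrite EY addrC addKr nmN ?nmZ //; try exact: W2; last exact: l2Z.
  have iv0 := ltW (iv_gt0 R k); rewrite cabsV cabs_nat -/(iv R k).
  rewrite -ler_sqr ?nnegrE ?(ltW eta0) ?mulr_ge0 ?nm_ge0 // exprMn (nm_sqr W2) //.
  apply: le_trans (ler_wpM2l (sqr_ge0 _) HN) _; rewrite ler_pdivlMr // in HK.
  by rewrite expr2 -mulrA [iv R k * (k.+1%:R * _)]mulrA {2}/iv mulVf ?gt_eqF // mul1r.
by apply: Hb; apply: SZ; apply: SP.
Qed.

Lemma acpoly_all q : q != 0 -> acpoly q -> forall h, S h -> ac h.
Proof.
move=> q0 H h Sh; have [s Eq] := closed_field_poly_normal q.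
have {}H : acpoly (\prod_(z <- s) ('X - z%:P)).
  apply: (@acpoly_scale (lead_coef q)); first by rewrite lead_coef_eq0.
  by rewrite -Eq.
elim: s H {Eq} => [|z s IH]; last by rewrite big_cons => /acpoly_factor /IH.
by rewrite big_nil => /(_ _ Sh); rewrite rmorph1 (act1 (acts2_action R)).
Qed.

End RemoveFactors.

(** * Averages over roots of unity *)



Section Averaging.
Variable R : realType.
Local Notation C := R[i].
Local Notation W1 := exhausting_win1.
Local Notation W2 := exhausting_win2.
Implicit Types (U V X : {poly {poly C}}).

Lemma big_ord_support (A : nmodType) (F : nat -> A) L N : (L <= N)%N ->
  (forall i, (L <= i)%N -> F i = 0) -> \sum_(i < N) F i = \sum_(i < L) F i.
Proof.
move=> LN H; rewrite [RHS](big_ord_widen N F LN) [RHS]big_mkcond; apply: eq_bigr => i _.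
by case: ltnP => // /H.
Qed.

Lemma inner_cf (u v : {poly C}) L : (size v <= L)%N ->
  inner win1 (cf u) (cf v) = \sum_(a < L) u`_a * (v`_a)^*.
Proof.
move=> sv; apply: inner_eq; apply/cvgCE => e e0; exists L => N LN.
rewrite big_win1 (@big_ord_support _ (fun a => cf u a * (cf v a)^*) L) // ?subrr ?cabs0 //.
by move=> a La; rewrite /cf [v`_a]nth_default ?rmorph0 ?mulr0 // (leq_trans sv).
Qed.

Lemma inner_cf2 U V L M : (size V <= M)%N -> (forall b, (size (V`_b)%R <= L)%N) ->
  inner win2 (cf2 U) (cf2 V) = \sum_(a < L) \sum_(b < M) U`_b`_a * (V`_b`_a)^*.
Proof.
move=> sV sV'; apply: inner_eq; apply/cvgCE => e e0; exists (maxn L M) => N.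
rewrite geq_max => /andP[LN MN]; rewrite big_win2.
rewrite (@big_ord_support _ (fun a => \sum_(b < N) cf2 U (a, nat_of_ord b) * (cf2 V (a, nat_of_ord b))^*) L) //.
  rewrite (eq_bigr (fun a : 'I_L => \sum_(b < M) U`_b`_a * (V`_b`_a)^*)) ?subrr ?cabs0 // => a _.
  apply: (@big_ord_support _ (fun b => U`_b`_a * (V`_b`_a)^*)) => // b Mb.
  by rewrite [V`_b]nth_default ?coef0 ?rmorph0 ?mulr0 // (leq_trans sV).
move=> a La; rewrite big1 // => b _; rewrite /cf2 /=.
by rewrite [V`_b`_a]nth_default ?rmorph0 ?mulr0 // (leq_trans (sV' b)).
Qed.

Lemma l2_cf v : in_l2 win1 (cf v : nat -> C).
Proof. by have [] := N2_cf (leqnn (size v)). Qed.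

Lemma l2_cf2 V : in_l2 win2 (cf2 V).
Proof.
apply/in_l2E; pose L := \max_(b < size V) size (V`_b)%R.
exists (\sum_(a < L) \sum_(b < size V) nsq V`_b`_a) => N; rewrite /nS big_win2.
pose F a b := nsq V`_b`_a.
have Fb a b : (size V <= b)%N -> F a b = 0 by move=> h; rewrite /F [V`_b]nth_default // coef0 nsq0.
have Fa a b : (L <= a)%N -> F a b = 0.
  move=> h; case: (ltnP b (size V)) => bV; last exact: Fb.
  rewrite /F nth_default ?nsq0 //; apply: leq_trans h.
  exact: (@leq_bigmax _ (fun b : 'I_(size V) => size (V`_b)%R) (Ordinal bV)).
have le (G : nat -> R) n k : (forall i, 0 <= G i) -> (forall i, (k <= i)%N -> G i = 0) ->
    \sum_(i < n) G i <= \sum_(i < k) G i.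
  move=> G0 Gk; rewrite -(big_ord_support (leq_maxr n k) Gk).
  rewrite (big_ord_widen _ G (leq_maxl n k)) big_mkcond; apply: ler_sum => i _.
  by case: ifP.
apply: le_trans (_ : \sum_(a < N) \sum_(b < size V) F a b <= _).
  by apply: ler_sum => a _; apply: (le (F a)) => [b|b]; [apply: nsq_ge0|apply: Fb].
apply: (le (fun a => \sum_(b < size V) F a b)) => [a|a La].
  by apply: sumr_ge0 => b _; apply: nsq_ge0.
by rewrite big1 // => b _; apply: Fa.
Qed.

Lemma size_slice_le V tau L : (forall b, (size (V`_b)%R <= L)%N) -> (size (slice V tau) <= L)%N.
Proof.
move=> h; apply: leq_trans (size_sum _ _ _) _; apply/bigmax_leqP => j _.
exact: leq_trans (size_scale_leq _ _) (h j).
Qed.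

Lemma avg_inner U V L M zeta : (0 < M)%N -> M.-primitive_root zeta ->
  (size U <= M)%N -> (size V <= M)%N -> (forall b, (size (V`_b)%R <= L)%N) ->
  \sum_(k < M) inner win1 (cf (slice U (zeta ^+ k))) (cf (slice V (zeta ^+ k))) =
  M%:R * inner win2 (cf2 U) (cf2 V).
Proof.
move=> M0 hz sU sV sV'; rewrite (inner_cf2 _ sV sV') mulr_sumr.
rewrite (eq_bigr (fun k : 'I_M => \sum_(a < L) (slice U (zeta ^+ k))`_a * ((slice V (zeta ^+ k))`_a)^*)); last first.
  by move=> k _; apply: inner_cf; apply: size_slice_le.
by rewrite exchange_big; apply: eq_bigr => a _; apply: parseval.
Qed.

Lemma avg_N2 V L M zeta : (0 < M)%N -> M.-primitive_root zeta ->
  (size V <= M)%N -> (forall b, (size (V`_b)%R <= L)%N) ->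
  \sum_(k < M) N2 win1 (cf (slice V (zeta ^+ k))) = M%:R * N2 win2 (cf2 V).
Proof.
move=> M0 hz sV sV'; apply: realc_inj; rewrite rmorph_sum rmorphM rmorph_nat /=.
rewrite -(innerN2 W2 (l2_cf2 V)) -(avg_inner M0 hz sV sV sV').
by apply: eq_bigr => k _; rewrite (innerN2 W1) //; apply: l2_cf.
Qed.

Lemma Mz_cf (v : {poly C}) : Mz (cf v) = cf ('X * v).
Proof. by apply/funext => -[|k]; rewrite /cf /= coefXM. Qed.

Lemma Mz1_cf2 V : Mz1 (cf2 V) = cf2 ('X%:P * V).
Proof. by apply/funext => -[[|k] l]; rewrite /cf2 /Mz1 /= coefCM coefXM. Qed.

Lemma avg_form V L M zeta : (0 < M)%N -> M.-primitive_root zeta ->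
  (size V <= M)%N -> (forall b, (size (V`_b)%R <= L)%N) ->
  \sum_(k < M) inner win1 (Mz (cf (slice V (zeta ^+ k)))) (cf (slice V (zeta ^+ k))) =
  M%:R * form2 (cf2 V).
Proof.
move=> M0 hz sV sV'; have sXV : (size ('X%:P * V)%R <= M)%N.
  by rewrite mul_polyC; apply: leq_trans (size_scale_leq _ _) sV.
rewrite /form2 Mz1_cf2 -(avg_inner M0 hz sXV sV sV'); apply: eq_bigr => k _.
by rewrite Mz_cf !sliceE hornerM hornerC.
Qed.

(** * Slices of truncations and the one-variable model spaces *)

Section Fixed.
Variables (m n : nat) (p : {poly {poly C}}) (r : {poly C}) (A B : {poly {poly C}}).
Hypotheses (degp : deg_le m n p) (nz : no_zeros_bidisk p) (cop : coprime2 (refl m n p) p).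
Hypothesis Er : r^:P = A * p + B * refl m n p.
Local Notation pt := (refl m n p).

Definition slice_ranges (w : C) := exists tau, unit_circle tau /\ ~ E_set p tau /\
  num_range_compr win1 (model1 (slice pt tau) (slice p tau)) (@Mz R) w.

Lemma model1_closed tau : closed_subspace win1 (model1 (slice pt tau) (slice p tau)).
Proof. by apply: (orth_complement_closed W1) => g []. Qed.

(** On the torus the reflection vanishes wherever [p] does, and then so does [A p + B p~]. *)
Lemma r_zero_E tau : cabs tau = 1 -> r.[tau] != 0 -> ~ E_set p tau.
Proof.
move=> t1 r0 [_ [z [z1 h]]]; rewrite eval2E in h; rewrite /unit_circle norm_cabs in z1.
have {}z1 : cabs z = 1 by apply: realc_inj.
have := congr1 (fun q : {poly C} => q.[z]) (slice_r Er tau).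
rewrite hornerC hornerD !hornerM h (refl_zero degp t1 z1 h) !mulr0 addr0 => E.
by rewrite E eqxx in r0.
Qed.

Lemma model1_cone tau v : cabs tau = 1 -> r.[tau] != 0 ->
  model1 (slice pt tau) (slice p tau) v ->
  cone slice_ranges (N2 win1 v) (inner win1 (Mz v) v).
Proof.
move=> t1 r0 Kv; have hv : in_l2 win1 v by case: Kv.
have := N2_ge0 W1 hv; rewrite le_eqVlt => /orP[/eqP v0|v0].
  by rewrite -v0 (N2_eq0 W1 hv (esym v0)) inner0r; apply: cone0.
pose c : C := ((Num.sqrt (N2 win1 v))%:C)%C^-1.
have nc : nsq c = (N2 win1 v)^-1.
  by rewrite /nsq /c cabsV cabs_real ger0_norm ?sqrtr_ge0 // exprVn sqr_sqrtr // ltW.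
have cl := model1_closed tau; have hMv := l2_shift W1 (shift_Mz R) hv.
rewrite -[N2 win1 v]add0r -[inner win1 (Mz v) v]add0r.
have -> : inner win1 (Mz v) v = ((N2 win1 v)%:C)%C * inner win1 (Mz (c *: v)) (c *: v).
  rewrite (shZ (shift_Mz R)) (innerZl W1) //; last exact: l2Z.
  rewrite (innerZr W1) // [c * _]mulrA mulr_conj nc mulrA -rmorphM mulfV ?gt_eqF // mul1r //.
apply: coneS => //; first exact: cone0.
exists tau; split; first by rewrite /unit_circle norm_cabs t1.
split; first exact: r_zero_E.
apply/(num_range_comprE W1 _ cl); first by move=> h [hh _]; apply: (l2_shift W1 (shift_Mz R)).
exists (c *: v); split; first by apply: cl.2.2.2.1.
by split => //; rewrite (N2Z W1) // nc mulVf ?gt_eqF.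
Qed.

Variables (S1 S2 : (nat * nat -> C) -> Prop).
Hypotheses (dec : orth_decomp (model2 pt p) S1 S2)
  (inv2 : forall f, S2 f -> S2 (Mz2 f)).

(** Weighted Young inequality. The error of one slice is a product of norms, whereas averaging over
    roots of unity is only available for squares. *)
Lemma mean_bound (v w de : R) : 0 < de -> 0 <= v -> 0 <= w ->
  w * (v + w + v) <= de * v ^+ 2 + (de^-1 + 1) * w ^+ 2.
Proof.
move=> d0 v0 w0; have := sqr_ge0 (de * v - w); have di : de * de^-1 = 1 by rewrite mulfV ?gt_eqF.
move=> h; have : 0 <= de^-1 * (de * v - w) ^+ 2 by rewrite mulr_ge0 // invr_ge0 ltW.
have -> : de^-1 * (de * v - w) ^+ 2 = de * de^-1 * (de * v ^+ 2) - (de * de^-1) * (2 * v * w) + de^-1 * w ^+ 2 by ring.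
rewrite di; lra.
Qed.

(* One step of the approximation: the truncation [X] of [h] to the window [N], averaged over
   roots of unity; [Ep] is the part of [p X] of z1-degree at least [m], which is small. *)
Lemma acone_step (K1 : R) h N de : S2 h -> 0 <= K1 -> 0 < de ->
  (forall tau v, cabs tau = 1 -> in_l2 win1 (acts1 (slice p tau) v) ->
    in_l2 win1 (r.[tau] *: v) /\ nm win1 (r.[tau] *: v) <= K1 * nm win1 (acts1 (slice p tau) v)) ->
  let y := acts2 r^:P (trunc win2 N h) in
  let E := de * N2 win2 y + (de^-1 + 1) * (K1 ^+ 2 * N2 win2 (acts2 p (h - trunc win2 N h))) in
  exists s z, cone slice_ranges s z /\ `|s - N2 win2 y| <= E /\ cabs (z - form2 y) <= E.
Proof.
move=> Sh K10 de0 HK1 y E; have hh := S2_l2 dec Sh.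
pose X : {poly {poly C}} := \poly_(b < N) \poly_(a < N) h (a, b).
have EX : trunc win2 N h = cf2 X.
  apply/funext => -[a b]; rewrite /trunc mem_win2 /cf2 /= coef_poly.
  by case: (ltnP b N) => bN; rewrite ?andbF ?coef0 // coef_poly andbT.
(* [M] and [L] bound the z2- and z1-sizes of [r X] and [p X], which makes all averages over the
   roots of unity exact. *)
pose M := (N + n + size r).+1; pose L := (N + m).+1.
have M0 : (0 < M)%N by [].
have [zeta hz] := prim_root_exists C M0.
have sX : (size X <= N)%N by apply: size_poly.
have sXb b : (size (X`_b)%R <= N)%N.
  by rewrite coef_poly; case: ifP => _; rewrite ?size_poly0 // size_poly.
pose Y := r^:P * X.
have sY : (size Y <= M)%N.
  have sr : (size r^:P <= size r)%N by apply: size_poly.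
  apply: leq_trans (size_polyMleq _ _) _; apply: leq_trans (leq_pred _) _.
  by apply: leq_trans (leq_add sr sX) _; rewrite /M; lia.
have sYb b : (size (Y`_b)%R <= L)%N.
  rewrite /Y coefM; apply: leq_trans (size_sum _ _ _) _; apply/bigmax_leqP => j _.
  rewrite coef_map /= mul_polyC; apply: leq_trans (size_scale_leq _ _) _.
  by apply: leq_trans (sXb _) _; rewrite /L; lia.
have spX : (size (p * X)%R <= M)%N.
  by apply: leq_trans (size_polyMleq _ _) _; have := degp.1; rewrite /M; lia.
have spXb b : (size ((p * X)`_b)%R <= L)%N.
  rewrite coefM; apply: leq_trans (size_sum _ _ _) _; apply/bigmax_leqP => j _.
  apply: leq_trans (size_polyMleq _ _) _; have := degp.2 j; have := sXb (b - j)%N; rewrite /L; lia.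
pose Ep : {poly {poly C}} := \poly_(b < M) \poly_(a < L) (if (m <= a)%N then (p * X)`_b`_a else 0).
have coefEp b a : Ep`_b`_a = if (m <= a)%N then (p * X)`_b`_a else 0.
  rewrite coef_poly; case: ltnP => bM; last first.
    by rewrite coef0 [(p * X)`_b]nth_default ?coef0 ?if_same // (leq_trans spX).
  rewrite coef_poly; case: ltnP => // aL.
  by rewrite [(p * X)`_b`_a]nth_default ?if_same // (leq_trans (spXb b)).
have sEp : (size Ep <= M)%N by apply: size_poly.
have sEpb b : (size (Ep`_b)%R <= L)%N.
  by rewrite coef_poly; case: ifP => _; rewrite ?size_poly0 // size_poly.
have sliceEp tau a : (slice Ep tau)`_a = if (m <= a)%N then (slice (p * X) tau)`_a else 0.
  rewrite (coef_slice _ _ sEp) (coef_slice _ _ spX); case: ifP => ma.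
    by apply: eq_bigr => j _; rewrite coefEp ma.
  by rewrite big1 // => j _; rewrite coefEp ma mulr0.
pose tau k := zeta ^+ k; have t1 k : cabs (tau k) = 1 by apply: cabs_primX hz k.
have solv k : exists w, acts1 (slice p (tau k)) w = cf (slice Ep (tau k)).
  by apply: solve1; apply: (boundary_const degp nz cop).
pose w0 k := sval (cid (solv k)).
have Hw0 k : acts1 (slice p (tau k)) (w0 k) = cf (slice Ep (tau k)) by rewrite /w0; case: cid.
(* [w0] is the formal quotient of the slice of [Ep] by that of [p]. Hence [p (v - w)] is [r(tau)]
   times the slice of [p X - Ep], of degree below [m]. *)
pose w k := r.[tau k] *: w0 k; pose v k := cf (slice Y (tau k)).
have Hw k : in_l2 win1 (w k) /\ nm win1 (w k) <= K1 * nm win1 (cf (slice Ep (tau k))).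
  by have := HK1 (tau k) (w0 k) (t1 k); rewrite Hw0; apply; apply: l2_cf.
have hw k := (Hw k).1; have hv k : in_l2 win1 (v k) by apply: l2_cf.
have Ev k : v k = r.[tau k] *: cf (slice X (tau k)).
  rewrite /v /Y sliceE hornerM horner_map -sliceE mul_polyC.
  by apply/funext => a; rewrite /cf coefZ.
pose d k := v k - w k; have hd k : in_l2 win1 (d k) by apply: l2B.
have dcone k : cone slice_ranges (N2 win1 (d k)) (inner win1 (Mz (d k)) (d k)).
  (* A root of unity may be a zero of [r], in particular a point of [E_set p]; there [v] and [w]
     both vanish. *)
  have [r0|r0] := eqVneq r.[tau k] 0.
    have -> : d k = 0 by rewrite /d Ev /w r0 !scale0r subrr.
    by rewrite /N2 !inner0r; apply: cone0.
  apply: (model1_cone (t1 k) r0); apply: (vanish_model1 degp Er (t1 k) r0) => // a ma.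
  rewrite /d Ev /w -scalerBr -acts1_const acts1C acts1_const (actBr _ _ _ (acts1_action R)) Hw0 acts1_cf.
  rewrite -[LHS]/(r.[tau k] * ((slice p (tau k) * slice X (tau k))`_a - (slice Ep (tau k))`_a)).
  by rewrite sliceEp ma !sliceE hornerM subrr mulr0.
have Mp : 0 < M%:R :> R by rewrite ltr0n.
have csum := coneZ (c := M%:R^-1) _ (cone_sum (index_enum 'I_M) (fun k : 'I_M => dcone k)).
have {}csum := csum ltac:(by rewrite invr_gt0).
exists (M%:R^-1 * \sum_(k < M) N2 win1 (d k)),
  (((M%:R^-1 : R)%:C)%C * \sum_(k < M) inner win1 (Mz (d k)) (d k)); split; first exact: csum.
have Ey : y = cf2 Y by rewrite /y EX acts2_cf.
have avN : M%:R^-1 * \sum_(k < M) N2 win1 (v k) = N2 win2 y.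
  by rewrite /v (avg_N2 M0 hz sY sYb) mulKf ?gt_eqF // Ey.
have MC : M%:R != 0 :> C by rewrite pnatr_eq0.
have MiC : ((M%:R^-1 : R)%:C)%C = M%:R^-1 :> C by rewrite (fmorphV (real_complex R)) rmorph_nat.
have avF : ((M%:R^-1 : R)%:C)%C * \sum_(k < M) inner win1 (Mz (v k)) (v k) = form2 y.
  by rewrite /v (avg_form M0 hz sY sYb) MiC mulKf // Ey.
(* [p h] has no coefficients of z1-degree at least [m], so there those of [p X] are, up to sign,
   coefficients of [p (h - X)], where the truncation error enters. *)
have NEp : N2 win2 (cf2 Ep) <= N2 win2 (acts2 p (h - trunc win2 N h)).
  have hd2 : in_l2 win2 (acts2 p (h - trunc win2 N h)).
    by apply: l2_acts2; exact: (l2_subtrunc W2 N hh).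
  apply: (N2_le W2) => K; apply: le_trans (nS_le_N2 W2 K hd2).
  apply: ler_sum => -[a b] _; rewrite {1}/cf2 /= coefEp; case: ifP => ma; last by rewrite nsq0 nsq_ge0.
  rewrite (actBr _ _ _ (acts2_action R)) EX acts2_cf -[X in _ <= nsq X]/(acts2 p h (a, b) - (p * X)`_b`_a).
  by rewrite (S2_vanish degp dec inv2 b Sh ma) sub0r nsqN.
have avW : M%:R^-1 * \sum_(k < M) nm win1 (w k) ^+ 2 <= K1 ^+ 2 * N2 win2 (acts2 p (h - trunc win2 N h)).
  apply: le_trans (_ : K1 ^+ 2 * N2 win2 (cf2 Ep) <= _); last by apply: ler_wpM2l; rewrite ?sqr_ge0.
  rewrite mulrC ler_pdivrMr // -mulrA [N2 _ _ * _]mulrC -(avg_N2 M0 hz sEp sEpb) mulr_sumr.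
  apply: ler_sum => k _; rewrite -(nm_sqr W1 (l2_cf (slice Ep (zeta ^+ k)))) -exprMn ler_sqr ?nnegrE ?nm_ge0 ?mulr_ge0 ?nm_ge0 //.
  exact: (Hw k).2.
have point k : nm win1 (d k - v k) * (nm win1 (d k) + nm win1 (v k)) <=
    de * N2 win1 (v k) + (de^-1 + 1) * nm win1 (w k) ^+ 2.
  have -> : d k - v k = - w k by rewrite /d addrC addKr.
  rewrite (nmN W1) // -(nm_sqr W1) //.
  apply: le_trans (mean_bound de0 (nm_ge0 _ _) (nm_ge0 _ _)); apply: ler_wpM2l; first exact: nm_ge0.
  by rewrite lerD2r; exact: (nmB W1 (hv k) (hw k)).
have tot : M%:R^-1 * \sum_(k < M) (nm win1 (d k - v k) * (nm win1 (d k) + nm win1 (v k))) <= E.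
  apply: le_trans (_ : M%:R^-1 * \sum_(k < M) (de * N2 win1 (v k) + (de^-1 + 1) * nm win1 (w k) ^+ 2) <= _).
    by apply: ler_wpM2l; [rewrite invr_ge0 ltW|apply: ler_sum => k _].
  rewrite big_split -!mulr_sumr mulrDr mulrCA avN lerD2l mulrCA; apply: ler_wpM2l => //.
  by rewrite addr_ge0 // invr_ge0 ltW.
split.
  rewrite -avN -mulrBr -sumrB normrM ger0_norm ?invr_ge0 ?(ltW Mp) //; apply: le_trans tot.
  apply: ler_wpM2l; first by rewrite invr_ge0 ltW.
  by apply: le_trans (ler_norm_sum _ _ _) _; apply: ler_sum => k _; exact: (N2_perturb W1 (hd k) (hv k)).
rewrite -avF -mulrBr -sumrB cabsM cabs_real ger0_norm ?invr_ge0 ?(ltW Mp) //; apply: le_trans tot.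
apply: ler_wpM2l; first by rewrite invr_ge0 ltW.
apply: le_trans (cabs_sum _ _ _) _; apply: ler_sum => k _.
exact: (form_perturb W1 (shift_Mz R) (hd k) (hv k)).
Qed.

Lemma acone_r h : S2 h -> acone slice_ranges (N2 win2 (acts2 r^:P h)) (form2 (acts2 r^:P h)).
Proof.
move=> Sh; have hh := S2_l2 dec Sh; have hg : in_l2 win2 (acts2 r^:P h) by apply: l2_acts2.
have [K1 [K10 HK1]] := multiplier1 degp nz Er.
have [Kp [Kp0 HKp]] := bdd_acts2 p; have [Kr [Kr0 HKr]] := bdd_acts2 r^:P.
move=> e e0; pose G := nm win2 (acts2 r^:P h) + Kr.
have G0 : 0 <= G by rewrite addr_ge0 ?nm_ge0.
have G1 : 0 < G ^+ 2 + 1 by rewrite ltr_wpDl ?sqr_ge0.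
pose de := e / 4 / (G ^+ 2 + 1); have de0 : 0 < de by rewrite !divr_gt0.
(* [de] is fixed first, so that [de * N2 win2 y] is at most [e/4]. All other errors are at most [Q]
   times the truncation error [t], and [t <= 1] allows [t^2 <= t]. *)
pose Q := 2 * G * Kr + (de^-1 + 1) * (K1 ^+ 2 * Kp ^+ 2).
have di0 : 0 <= de^-1 + 1 by rewrite addr_ge0 // invr_ge0 ltW.
have Q0 : 0 <= Q by rewrite addr_ge0 ?mulr_ge0 ?sqr_ge0.
have Q1 : 0 < Q + 1 by rewrite ltr_wpDl.
have eta0 : 0 < Num.min 1 (e / 4 / (Q + 1)) by rewrite lt_min ltr01 !divr_gt0.
have [N /(_ N (leqnn N))] := trunc_cvg W2 hh eta0; rewrite le_min => /andP[t1 t2].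
have hX := l2_trunc W2 N hh; have hd := l2_subtrunc W2 N hh.
have [s [z [Kc]]] := acone_step N Sh K10 de0 HK1.
set X := trunc win2 N h in t1 t2 hX hd *; set t := nm win2 (h - X) in t1 t2.
set y := acts2 r^:P X; set E := (de * _ + _); move=> [hs hz].
have t0 : 0 <= t by apply: nm_ge0.
rewrite ler_pdivlMr // in t2; have hy : in_l2 win2 y by apply: l2_acts2.
have dy : nm win2 (y - acts2 r^:P h) <= Kr * t.
  rewrite -(actBr _ _ _ (acts2_action R)) -opprB (actNr _ _ (acts2_action R)) (nmN W2); last exact: l2_acts2.
  exact: (HKr _ hd).2.
have Krt : Kr * t <= Kr by rewrite ler_piMr.
have ny : nm win2 y <= G.
  by have := nm_sub_le W2 hy hg; rewrite ler_norml /G; lra.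
have N2y : N2 win2 y <= G ^+ 2.
  by rewrite -(nm_sqr W2) // ler_sqr ?nnegrE ?nm_ge0.
have N2p : N2 win2 (acts2 p (h - X)) <= Kp ^+ 2 * t.
  have [h1 h2] := HKp _ hd; rewrite -(nm_sqr W2) //.
  apply: le_trans (_ : (Kp * t) ^+ 2 <= _).
    by rewrite ler_sqr ?nnegrE ?mulr_ge0 ?nm_ge0.
  by rewrite exprMn; apply: ler_wpM2l; rewrite ?sqr_ge0 // expr2 ler_piMr.
have Ebd : E <= e / 4 + (de^-1 + 1) * (K1 ^+ 2 * Kp ^+ 2) * t.
  apply: lerD.
    apply: le_trans (_ : de * (G ^+ 2 + 1) <= _); last by rewrite /de divfK ?gt_eqF.
    by apply: ler_wpM2l; [exact: ltW|apply: le_trans N2y _; rewrite lerDl].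
  rewrite -mulrA; apply: ler_wpM2l => //; rewrite -[X in _ <= X]mulrA; apply: ler_wpM2l => //; exact: sqr_ge0.
have pert : nm win2 (y - acts2 r^:P h) * (nm win2 y + nm win2 (acts2 r^:P h)) <= 2 * G * Kr * t.
  have -> : 2 * G * Kr * t = Kr * t * (2 * G) by ring.
  apply: ler_pM => //; rewrite ?nm_ge0 ?addr_ge0 ?nm_ge0 //.
  by rewrite /G in ny *; have := nm_ge0 win2 (acts2 r^:P h); lra.
have tot : E + 2 * G * Kr * t < e.
  have -> : e = e / 4 + e / 4 + e / 2 by field.
  move: t2; rewrite [t * _]mulrC mulrDl mul1r /Q mulrDl; lra.
have P1 := le_trans (N2_perturb W2 hy hg) pert.
have P2 := le_trans (form_perturb W2 (shift_Mz1 R) hy hg) pert.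
exists s, z; split => //; split.
  rewrite (_ : s - _ = (s - N2 win2 y) + (N2 win2 y - N2 win2 (acts2 r^:P h))); last by ring.
  apply: le_lt_trans (ler_normD _ _) _; lra.
rewrite (_ : z - _ = (z - form2 y) + (form2 y - form2 (acts2 r^:P h))); last by ring.
apply: le_lt_trans (cabsD _ _) _; rewrite /form2 in hz *; lra.
Qed.

End Fixed.
End Averaging.

Theorem theorem3p5 (R : realType) (m n : nat) (p : {poly {poly R[i]}})
  (S1 S2 : (nat * nat -> R[i]) -> Prop) :
  deg_le m n p ->
  no_zeros_bidisk p ->
  coprime2 (refl m n p) p ->
  orth_decomp (model2 (refl m n p) p) S1 S2 ->
  (forall f, S1 f -> S1 (Mz1 f)) ->
  (forall f, S2 f -> S2 (Mz2 f)) ->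
  Clos (num_range_compr (win2) S2 (@Mz1 R)) =
  Clos (Conv (fun w => exists tau, unit_circle tau /\ ~ E_set p tau /\
     num_range_compr win1 (model1 (slice (refl m n p) tau) (slice p tau)) (@Mz R) w)).
Proof.
move=> degp nz cop dec inv1 inv2; rewrite -/(slice_ranges m n p).
have [r [A [B [Er r0 rE]]]] := elimination degp nz cop.
have W2 := exhausting_win2; have sl2 := S2_l2 dec.
have cS2 : closed_subspace win2 S2 := dec.2.1.
have rangeE w := num_range_comprE (T := @Mz1 R) W2 w cS2
  (fun h Sh => l2_shift W2 (shift_Mz1 R) (sl2 h Sh)).
apply/funext => a; apply/propext; split => Ha.
  apply: Clos_Clos => e e0; have [w [/rangeE [h [Sh [Nh ->]]]]] := Ha _ e0.
  rewrite norm_cabs ltcR => hw; exists (form2 h); split => //.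
  apply: (clos_normalize (K := cone (slice_ranges m n p))); first exact: cone_Conv.
  have := acpoly_all sl2 (S2_Z dec) (S2_acts dec inv2) r0 (acone_r degp nz cop Er dec inv2) Sh.
  rewrite Nh => H e' /H [s [z [K [h1 h2]]]].
  by exists s, z; split.
apply: Clos_Clos => e e0; have [b [Cb]] := Ha _ e0; rewrite norm_cabs ltcR => hb.
exists b; split => //.
have ap : appr S2 1 b.
  have S20 : S2 0 by case: cS2 => _ [].
  apply: (appr_Conv sl2 S20 (S2_D dec) (S2_Z dec) inv2 _ Cb) => w [tau [t1 [nE]]].
  have {}t1 : cabs tau = 1 by apply: realc_inj.
  case/(num_range_comprE exhausting_win1 _ (model1_closed m n p tau)).
    by move=> h [hh _]; apply: (l2_shift exhausting_win1 (shift_Mz R)).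
  by move=> f [Kf [Nf ->]]; apply: (slice_appr degp nz cop Er dec inv1 t1 (rE _ t1 nE) Kf Nf).
(* Any nonzero vector of [S2] can be rescaled to a unit vector of [S2], which divides its form by
   its squared norm. *)
apply: (clos_normalize (K := fun s z => exists h, [/\ S2 h, s = N2 win2 h & z = form2 h])).
  move=> s z [h [Sh -> ->]] s0; have hh := sl2 _ Sh; apply/rangeE.
  pose c : R[i] := (((Num.sqrt (N2 win2 h))%:C)%C)^-1.
  have nc : nsq c = (N2 win2 h)^-1.
    by rewrite /nsq /c cabsV cabs_real ger0_norm ?sqrtr_ge0 // exprVn sqr_sqrtr // ltW.
  exists (c *: h); split; first exact: (S2_Z dec).
  split; first by rewrite (N2Z W2) // nc mulVf ?gt_eqF.
  by rewrite -/(form2 _) form2Z // nc (fmorphV (real_complex R)) mulrC.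
move=> e' /ap [h [Sh [h1 h2]]]; exists (N2 win2 h), (form2 h); split => //.
by exists h; split.
Qed.
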